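(* Let $F$ be a distribution function on $\mathbb{R}$, $g:\mathbb{R}^2\to\mathbb{R}$ measurable, and for each $n\in\mathbb{N}$ let $F_n$ be an estimate of $F$ based on $X_1,\dots,X_n$. Let $(\mathbf{V},d)$ be a metric subspace of $\mathbb{D}$ and $(a_n)$ a sequence in $(0,\infty)$ with $a_n\to\infty$. Assume that: (a) the regularity conditions (A1)–(A8) listed in the context hold for $g$, $F$ and $(F_n)$; (b) on $\mathbf{V}$ the functions $$\Phi_{i,g}(f):=-\int f(x-)\,dg_{i,F}(x)\ (i=1,2),\qquad \Phi_{3,g}(f):=\iint f(x_1-)f(x_2-)\,dg(x_1,x_2)$$ are well-defined, $(\mathcal{V},\mathcal{B}(\mathbb{R}))$-measurable and $d$-continuous; (c) the process $a_n(F_n-F)$ is a random element of $(\mathbf{V},\mathcal{V})$ for all $n\in\mathbb{N}$, and there is a random element $B^\circ$ of $(\mathbf{V},\mathcal{V})$ such that $\mathbb{P}[B^\circ\in S]=1$ for some $d$-separable $S\in\mathcal{V}$ consisting only of $(\mathcal{V},d)$-completely regular points, and $$a_n(F_n-F)\stackrel{\mathsf d}{\longrightarrow}B^\circ\quad\text{in }(\mathbf{V},\mathcal{V},d).$$ Then: (i) We always have $$a_n\big(V_g(F_n)-V_g(F)\big)\stackrel{\mathsf d}{\longrightarrow}-\sum_{i=1}^2\int B^\circ(x-)\,dg_{i,F}(x)\quad\text{in }(\mathbb{R},\mathcal{B}(\mathbb{R})).$$ (ii) If the $V$-statistic $V_g(F_n)$ is degenerate w.r.t. $(g,F)$, then additionally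 $$a_n^2\big(V_g(F_n)-V_g(F)\big)\stackrel{\mathsf d}{\longrightarrow}\iint B^\circ(x_1-)B^\circ(x_2-)\,dg(x_1,x_2)\quad\text{in }(\mathbb{R},\mathcal{B}(\mathbb{R})).$$
   Context: $(X_i)_{i\in\mathbb{N}}$ is a sequence of random variables on a probability space $(\Omega,\mathcal{F},\mathbb{P})$, identically distributed with distribution function $F$. $V_g(H):=\iint g(x_1,x_2)\,dH(x_1)dH(x_2)$ whenever this exists; $g_{1,F}(x):=\int g(x,x_2)\,dF(x_2)$, $g_{2,F}(x):=\int g(x_1,x)\,dF(x_1)$. $f(x-)$ is the left-hand limit. Integrals without limits are over $(-\infty,\infty)$, $(-\infty,\infty)^2$; $\int_a^b$ is over $(a,b]$. The integral of $f$ w.r.t. a signed measure $\mu$ exists if $\int f^\pm d\mu^\pm$ are all four finite. The $V$-statistic $V_g(F_n)$ is degenerate w.r.t. $(g,F)$ if $\sum_{i=1}^2\int g_{i,F}\,d(F_n-F)=0$ $\mathbb{P}$-a.s. for every $n\in\mathbb{N}$. $\mathbb{D}$ is the space of bounded càdlàg functions on $\overline{\mathbb{R}}=[-\infty,\infty]$, and $\mathcal{D}$ is the $\sigma$-algebra on $\mathbb{D}$ generated by the coordinate projections $f\mapsto f(x)$, $x\in\overline{\mathbb{R}}$. A metric subspace $(\mathbf{V},d)$ of $\mathbb{D}$ is a subset $\mathbf{V}\subset\mathbb{D}$ with a metric $d$, equipped with $\mathcal{V}:=\mathcal{D}\cap\mathbf{V}$ (trace $\sigma$-algebra). $F_n$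 and $F$ are regarded as functions on $\overline{\mathbb{R}}$ via their limits at $\pm\infty$. $\stackrel{\mathsf d}{\to}$ is convergence in distribution in the sense of Pollard: $\mathbb{E}[h(\xi_n)]\to\mathbb{E}[h(\xi)]$ for all bounded, $d$-continuous, $\mathcal{V}$-measurable $h:\mathbf{V}\to\mathbb{R}$. A point $f\in\mathbf{V}$ is $(\mathcal{V},d)$-completely regular if for every neighbourhood $U$ of $f$ there is a $d$-uniformly continuous, $\mathcal{V}$-measurable $h:\mathbf{V}\to\mathbb{R}$ with $h(f)=1$ and $h\le\mathbf{1}_U$. $\mathbb{BV}_{\mathrm{loc},\mathrm{rc}}$: right-continuous functions $\psi:\mathbb{R}\to\mathbb{R}$ locally of bounded variation; $d\psi=d\psi^+-d\psi^-$ with $d\psi^\pm$ the positive Radon measures from the Jordan decomposition, $|d\psi|=d\psi^++d\psi^-$. A function $\tau:\mathbb{R}^2\to\mathbb{R}$ is locally of bounded variation if for every bounded rectangle $(a_1,a_2]\times(b_1,b_2]$ the supremum over grids $a_1=x_0\le\dots\le x_n=a_2$, $b_1=y_0\le\dots\le y_m=b_2$ of $\sum_{i,j}|\tau(x_i,y_j)-\tau(x_{i-1},y_j)-\tau(x_i,y_{j-1})+\tau(x_{i-1},y_{j-1})|$ is finite. $\mathbb{BV}^2_{\mathrm{loc},\mathrm{rc}}$: upper right-continuous functions $\tau$ on $\mathbb{R}^2$ (i.e. $\tau(y_1,y_2)\to\tau(x_1,x_2)$ as $(y_1,y_2)\to(x_1,x_2)$ with $y_i\ge x_i$) that are locally of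 bounded variation; $d\tau=d\tau^+-d\tau^-$ is the generated signed measure ($d\tau((a_1,a_2]\times(b_1,b_2])=\tau(a_2,b_2)-\tau(a_1,b_2)-\tau(a_2,b_1)+\tau(a_1,b_1)$), $d\tau^\pm$ the positive Radon measures from the two-dimensional Jordan decomposition, $|d\tau|=d\tau^++d\tau^-$. Conditions, with $H_n:=F_n-F$: (A1) $\iint|g|\,dF\,dF<\infty$; each $F_n$ is a non-decreasing càdlàg process with variation bounded by $1$; for all $n$, $\mathbb{P}$-a.s. $\iint|g|\,dF_n\,dF_n<\infty$. (A2) For all $n$, $\mathbb{P}$-a.s. $\iint|g(x_1,x_2)|\,dF_n(x_1)dF(x_2)<\infty$ and $\iint|g(x_1,x_2)|\,dF(x_1)dF_n(x_2)<\infty$. (A3) $g_{1,F},g_{2,F}\in\mathbb{BV}_{\mathrm{loc},\mathrm{rc}}$. (A4) $\int|H_n(x-)|\,|dg_{i,F}|(x)<\infty$ $\mathbb{P}$-a.s. for all $n$ and $i=1,2$. (A5) $\lim_{|x|\to\infty}H_n(x)g_{i,F}(x)=0$ $\mathbb{P}$-a.s. for all $n$ and $i=1,2$. (A6) $g\in\mathbb{BV}^2_{\mathrm{loc},\mathrm{rc}}$, and $g(x_1,\cdot)$ and $g(\cdot,x_2)$ are locally of bounded variation for every fixed $x_1$ and $x_2$, respectively. (A7) $\iint|H_n(x_1-)||H_n(x_2-)|\,|dg|(x_1,x_2)<\infty$ $\mathbb{P}$-a.s. for all $n$. (A8) $\mathbb{P}$-a.s. for all $n$, as $a_1,b_1\to-\infty$,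 $a_2,b_2\to\infty$ jointly, the following three expressions converge to $0$: $H_n(b_2)\int_{a_1}^{a_2}H_n(x_1-)\,d[g(\cdot,b_2)](x_1)-H_n(b_1)\int_{a_1}^{a_2}H_n(x_1-)\,d[g(\cdot,b_1)](x_1)$; $H_n(a_2)\int_{b_1}^{b_2}H_n(x_2-)\,d[g(a_2,\cdot)](x_2)-H_n(a_1)\int_{b_1}^{b_2}H_n(x_2-)\,d[g(a_1,\cdot)](x_2)$; $H_n(a_2)H_n(b_2)g(a_2,b_2)-H_n(a_1)H_n(b_2)g(a_1,b_2)-H_n(a_2)H_n(b_1)g(a_2,b_1)+H_n(a_1)H_n(b_1)g(a_1,b_1)$. *)

(* Defs.v *)
From HB Require Import structures.
From mathcomp Require Import all_boot all_order all_algebra.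
From mathcomp Require Import all_classical all_reals all_analysis.

Set Implicit Arguments.
Unset Strict Implicit.
Unset Printing Implicit Defensive.

Import Order.TTheory GRing.Theory Num.Theory.
Import numFieldNormedType.Exports.

Local Open Scope classical_set_scope.
Local Open Scope ring_scope.

Section one_dimensional.
Context {R : realType}.
Implicit Types psi f : R -> R.

Definition left_limit f (x : R) : R := lim (f y @[y --> x^'-]).

Definition locally_BV psi := forall a b : R, bounded_variation a b psi.

Definition BVloc_rc psi := right_continuous psi /\ locally_BV psi.

End one_dimensional.

(* "The" measure satisfying [P]; the zero measure when there is none. It is only
   used below for properties that determine a measure, and at functions for
   which that measure exists. *)
Definition the_measure {d} {T : measurableType d} {R : realType}
    (P : {measure set T -> \bar R} -> Prop) : {measure set T -> \bar R} :=
  match pselect (exists mu, P mu) with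
  | left h => sval (cid h)
  | right _ => mzero
  end.

Section stieltjes.
Context {R : realType}.
Implicit Types psi f : R -> R.

(* [pos_tv a psi] and [neg_tv a psi] are the components of the Jordan
   decomposition of psi on [a, +oo[; their increments on ]a, b] are the positive
   and the negative variation of psi there. *)
Definition stieltjes_pos psi : {measure set (measurableTypeR R) -> \bar R} :=
  the_measure (fun mu : {measure set (measurableTypeR R) -> \bar R} =>
    forall a b : R, a <= b ->
    mu `]a, b]%classic = (pos_tv a psi b - pos_tv a psi a)%E).

Definition stieltjes_neg psi : {measure set (measurableTypeR R) -> \bar R} :=
  the_measure (fun mu : {measure set (measurableTypeR R) -> \bar R} =>
    forall a b : R, a <= b ->
    mu `]a, b]%classic = (neg_tv a psi b - neg_tv a psi a)%E).

Definition stieltjes_abs psi : {measure set (measurableTypeR R) -> \bar R} :=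
  measure_add (stieltjes_pos psi) (stieltjes_neg psi).

(* integrability against both parts amounts to the finiteness of the four
   integrals of the positive and negative parts of f *)
Definition stieltjes_integrable psi f :=
  (stieltjes_pos psi).-integrable setT (EFin \o f) /\
  (stieltjes_neg psi).-integrable setT (EFin \o f).

Definition stieltjes_integral psi (D : set R) f : R :=
  \int[stieltjes_pos psi]_(x in D) f x - \int[stieltjes_neg psi]_(x in D) f x.

End stieltjes.

Section two_dimensional.
Context {R : realType}.
Implicit Types tau : R -> R -> R.

Definition increment2 tau (a1 a2 b1 b2 : R) : R :=
  tau a2 b2 - tau a1 b2 - tau a2 b1 + tau a1 b1.

(* [a :: s] is a weakly increasing grid from a to b *)
Definition grid (a b : R) (s : seq R) := path <=%R a s && (last a s == b).

Definition grid_variation tau (a1 b1 : R) (s t : seq R) : R :=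
  \sum_(i < size s) \sum_(j < size t)
    `|increment2 tau (nth a1 (a1 :: s) i) (nth a1 (a1 :: s) i.+1)
                     (nth b1 (b1 :: t) j) (nth b1 (b1 :: t) j.+1)|.

Definition variation2 tau (a1 a2 b1 b2 : R) : \bar R :=
  ereal_sup [set v | exists s t, [/\ grid a1 a2 s, grid b1 b2 t &
                                     v = (grid_variation tau a1 b1 s t)%:E]].

Definition locally_BV2 tau := forall a1 a2 b1 b2 : R, a1 <= a2 -> b1 <= b2 ->
  (variation2 tau a1 a2 b1 b2 < +oo)%E.

Definition upper_right_continuous tau := forall x : R * R,
  tau y.1 y.2 @[y --> within [set y : R * R | x.1 <= y.1 /\ x.2 <= y.2] (nbhs x)]
    --> tau x.1 x.2.

Definition BV2loc_rc tau := upper_right_continuous tau /\ locally_BV2 tau.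

Let RR := (measurableTypeR R * measurableTypeR R)%type.

(* as in dimension one, the Jordan decomposition attaches to a rectangle its
   positive variation (V + Delta) / 2 and its negative variation (V - Delta) / 2,
   where V is the variation and Delta the increment of tau *)
Definition stieltjes2_pos tau : {measure set RR -> \bar R} :=
  the_measure (fun mu : {measure set RR -> \bar R} =>
    forall a1 a2 b1 b2 : R, a1 <= a2 -> b1 <= b2 ->
    mu (`]a1, a2]%classic `*` `]b1, b2]%classic) =
    ((variation2 tau a1 a2 b1 b2 + (increment2 tau a1 a2 b1 b2)%:E)
       * 2^-1%:E)%E).

Definition stieltjes2_neg tau : {measure set RR -> \bar R} :=
  the_measure (fun mu : {measure set RR -> \bar R} =>
    forall a1 a2 b1 b2 : R, a1 <= a2 -> b1 <= b2 ->
    mu (`]a1, a2]%classic `*` `]b1, b2]%classic) =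
    ((variation2 tau a1 a2 b1 b2 - (increment2 tau a1 a2 b1 b2)%:E)
       * 2^-1%:E)%E).

Definition stieltjes2_abs tau : {measure set RR -> \bar R} :=
  measure_add (stieltjes2_pos tau) (stieltjes2_neg tau).

Definition stieltjes2_integrable tau (f : R * R -> R) :=
  (stieltjes2_pos tau).-integrable setT (EFin \o f) /\
  (stieltjes2_neg tau).-integrable setT (EFin \o f).

Definition stieltjes2_integral tau (f : R * R -> R) : R :=
  \int[stieltjes2_pos tau]_z f z - \int[stieltjes2_neg tau]_z f z.

End two_dimensional.

Section v_statistics.
Context {R : realType}.
Implicit Types (g : R -> R -> R) (F H : cumulative R R).

Definition Vfun g H : R :=
  \int[(lebesgue_stieltjes_measure H \x lebesgue_stieltjes_measure H)%E]_z
    g z.1 z.2.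

Definition gproj1 g F (x : R) : R :=
  \int[lebesgue_stieltjes_measure F]_x2 g x x2.

Definition gproj2 g F (x : R) : R :=
  \int[lebesgue_stieltjes_measure F]_x1 g x1 x.

Context {d} {T : measurableType d} (P : probability T R).
Variables (g : R -> R -> R) (F : cumulative R R) (Fn : nat -> T -> cumulative R R).

Let LS H := lebesgue_stieltjes_measure H.

Definition Hdiff (n : nat) (w : T) (x : R) : R := Fn n w x - F x.

Local Notation H := Hdiff.

(* Monotonicity and right-continuity of the paths of F_n are part of the type
   [cumulative R R], and left limits follow from monotonicity. *)
Definition condA1 :=
  [/\ (\int[(LS F \x LS F)%E]_z `|g z.1 z.2|%:E < +oo)%E,
      forall n w x y, x <= y -> (total_variation x y (Fn n w) <= 1)%E &
      forall n, {ae P, forall w,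
        (\int[(LS (Fn n w) \x LS (Fn n w))%E]_z `|g z.1 z.2|%:E < +oo)%E}].

Definition condA2 := forall n, {ae P, forall w,
  (\int[(LS (Fn n w) \x LS F)%E]_z `|g z.1 z.2|%:E < +oo)%E /\
  (\int[(LS F \x LS (Fn n w))%E]_z `|g z.1 z.2|%:E < +oo)%E}.

(* That the two functions are real-valued on the whole line, i.e. that their
   defining integrals exist everywhere, is part of the condition. *)
Definition condA3 :=
  (forall x, (LS F).-integrable setT (fun x2 => (g x x2)%:E)) /\
  (forall x, (LS F).-integrable setT (fun x1 => (g x1 x)%:E)) /\
  BVloc_rc (gproj1 g F) /\ BVloc_rc (gproj2 g F).

Definition condA4 := {ae P, forall w, forall n,
  (\int[stieltjes_abs (gproj1 g F)]_x `|left_limit (H n w) x|%:E < +oo)%E /\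
  (\int[stieltjes_abs (gproj2 g F)]_x `|left_limit (H n w) x|%:E < +oo)%E}.

Definition vanishes_at_infinity (f : R -> R) :=
  f x @[x --> -oo] --> (0 : R) /\ f x @[x --> +oo] --> (0 : R).

Definition condA5 := {ae P, forall w, forall n,
  vanishes_at_infinity (fun x => H n w x * gproj1 g F x) /\
  vanishes_at_infinity (fun x => H n w x * gproj2 g F x)}.

Definition condA6 :=
  [/\ BV2loc_rc g, forall x1, locally_BV (g x1) &
      forall x2, locally_BV (g ^~ x2)].

Definition condA7 := {ae P, forall w, forall n,
  (\int[stieltjes2_abs g]_z
    (`|left_limit (H n w) z.1| * `|left_limit (H n w) z.2|)%:E < +oo)%E}.

(* the quadruple is ((a1, b1), (a2, b2)) *)
Definition box_to_plane : set_system ((R * R) * (R * R)) :=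
  filter_prod (filter_prod (-oo)%R (-oo)%R) (filter_prod (+oo)%R (+oo)%R).

Definition condA8 := {ae P, forall w, forall n,
  [/\ (H n w q.2.2 * stieltjes_integral (g ^~ q.2.2) `]q.1.1, q.2.1]
         (left_limit (H n w))
       - H n w q.1.2 * stieltjes_integral (g ^~ q.1.2) `]q.1.1, q.2.1]
         (left_limit (H n w))) @[q --> box_to_plane] --> (0 : R),
      (H n w q.2.1 * stieltjes_integral (g q.2.1) `]q.1.2, q.2.2]
         (left_limit (H n w))
       - H n w q.1.1 * stieltjes_integral (g q.1.1) `]q.1.2, q.2.2]
         (left_limit (H n w))) @[q --> box_to_plane] --> (0 : R) &
      (H n w q.2.1 * H n w q.2.2 * g q.2.1 q.2.2
       - H n w q.1.1 * H n w q.2.2 * g q.1.1 q.2.2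
       - H n w q.2.1 * H n w q.1.2 * g q.2.1 q.1.2
       + H n w q.1.1 * H n w q.1.2 * g q.1.1 q.1.2)
         @[q --> box_to_plane] --> (0 : R)]}.

Definition degenerate := forall n, {ae P, forall w,
  stieltjes_integral (H n w) setT (gproj1 g F) +
  stieltjes_integral (H n w) setT (gproj2 g F) = 0}.

End v_statistics.

Section cadlag.
Context {R : realType}.

(* at +oo (resp. -oo) the right (resp. left) filter is not proper and the
   corresponding requirement is void *)
Definition bounded_cadlag : set (\bar R -> R) := [set f |
  [/\ exists M : R, forall x, `|f x| <= M,
      forall x, f y @[y --> within [set y | (x < y)%E] (nbhs x)] --> f x &
      forall x, exists l : R,
        f y @[y --> within [set y | (y < x)%E] (nbhs x)] --> l]].

Definition projection_sigma_algebra : set (set (\bar R -> R)) :=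
  <<s bounded_cadlag, \bigcup_(x in [set: \bar R])
        preimage_set_system bounded_cadlag (fun f => f x) measurable >>.

Definition extend_by_limits (f : R -> R) (x : \bar R) : R :=
  match x with
  | r%:E => f r
  | +oo%E => lim (f y @[y --> +oo%R])
  | -oo%E => lim (f y @[y --> -oo%R])
  end.

End cadlag.

Record metric_subspace (R : realType) := MetricSubspace {
  ms_carrier : set (\bar R -> R) ;
  ms_cadlag : ms_carrier `<=` bounded_cadlag ;
  ms_dist : ms_carrier -> ms_carrier -> R ;
  ms_distxx : forall f, ms_dist f f = 0 ;
  ms_dist_eq0 : forall f h, ms_dist f h = 0 -> f = h ;
  ms_dist_sym : forall f h, ms_dist f h = ms_dist h f ;
  ms_dist_triangle : forall k f h, ms_dist f h <= ms_dist f k + ms_dist k h }.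

Definition ms_type (R : realType) (V : metric_subspace R) : Type :=
  set_type (ms_carrier V).

Coercion ms_type : metric_subspace >-> Sortclass.

HB.instance Definition _ (R : realType) (V : metric_subspace R) :=
  Choice.copy (ms_type V) (set_type (ms_carrier V)).

HB.instance Definition _ (R : realType) (V : metric_subspace R) :=
  @isMetric.Build R (ms_type V) (@ms_dist R V) (@ms_distxx R V)
    (@ms_dist_eq0 R V) (@ms_dist_sym R V) (@ms_dist_triangle R V).

Section subspace_notions.
Context {R : realType} (V : metric_subspace R).

Definition ms_fun (f : V) : \bar R -> R := \val f.

Definition ms_left_limit (f : V) : R -> R := left_limit (ms_fun f \o EFin).

Definition trace_sigma_algebra : set (set V) :=
  preimage_set_system setT ms_fun projection_sigma_algebra.

End subspace_notions.

Section convergence.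
Context {R : realType}.

(* measurability with respect to a family of sets, for spaces (such as the
   metric subspaces) whose sigma-algebra is not that of a measurableType *)
Definition measurable_for {S : Type} {d} {U : measurableType d}
    (M : set (set S)) (h : S -> U) :=
  forall B, measurable B -> M (h @^-1` B).

Definition random_element {d} {T : measurableType d} {S : Type}
    (M : set (set S)) (xi : T -> S) :=
  forall A, M A -> measurable (xi @^-1` A).

Definition cvg_in_distribution {S : topologicalType} (M : set (set S))
    {d} {T : measurableType d} (P : probability T R) (xi : nat -> T -> S)
    {d'} {T' : measurableType d'} (P' : probability T' R) (xi0 : T' -> S) :=
  forall h : S -> R, continuous h -> measurable_for M h ->
    (exists C : R, forall s, `|h s| <= C) ->
    'E_P[h \o xi n]%E @[n --> \oo] --> 'E_P'[h \o xi0]%E.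

Definition separable_subset {S : topologicalType} (A : set S) :=
  exists C : set S, [/\ countable C, C `<=` A & A `<=` closure C].

Definition completely_regular_point {S : uniformType} (M : set (set S)) (f : S) :=
  forall U : set S, nbhs f U -> exists h : S -> R,
    [/\ unif_continuous h, measurable_for M h, h f = 1 &
        forall x, h x <= \1_U x].

End convergence.

(* Main.v *)
(**
Write H = F_n - F. Bilinearity gives the von Mises decomposition
  V_g(F_n) - V_g(F) = \int g_1 dH + \int g_2 dH + \iint g dH dH.
On a bounded interval or rectangle, integration by parts is Fubini's theorem for
the set {x < y} (in each coordinate) under the product of the measures of F_n, F
with the positive and negative parts of dg_i, dg. Letting the box grow, the
boundary terms vanish by (A5) and (A8), and
  V_g(F_n) - V_g(F) = - \int H_- dg_1 - \int H_- dg_2 + \iint H_- H_- dg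
almost surely. At Z_n = a_n H this says
  a_n (V_g(F_n) - V_g(F)) = Phi_1(Z_n) + Phi_2(Z_n) + a_n^-1 Phi_3(Z_n),
so (i) follows from the continuous mapping theorem and Slutsky's lemma. In
the degenerate case the two linear terms vanish and
a_n^2 (V_g(F_n) - V_g(F)) = Phi_3(Z_n). The planar Jordan measures dg^+, dg^-
exist by Caratheodory extension from rectangles of (variation +- increment) / 2.
*)
Require Import Defs.
From HB Require Import structures.
From mathcomp Require Import all_boot all_order all_algebra.
From mathcomp Require Import finmap.
From mathcomp Require Import all_classical all_reals all_analysis.
From mathcomp Require Import measurable_realfun.
From mathcomp Require Import ring lra.

Set Implicit Arguments.
Unset Strict Implicit.
Unset Printing Implicit Defensive.

Import Order.TTheory GRing.Theory Num.Theory.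
Import numFieldNormedType.Exports.

Local Open Scope classical_set_scope.
Local Open Scope ring_scope.

(** No measurability of [w |-> V_g(F_n(w))] is available, and the expansion holds only almost
    surely. Expectations are therefore treated as integrals of arbitrary functions, which still
    ignore null sets, and each statistic is exchanged at once for a measurable function of [Z n].
    The sigma-algebra of [V] need not be the Borel one of its metric, so continuity does not give
    measurability; all test functions are built from [Phi1], [Phi2], [Phi3], which have both
    properties, and are thus admissible in [Z_cvg]. The measures of [dg_i] and [dg] are selected by
    [the_measure], which returns the zero measure until existence is proved. This is why the
    variation has to be shown additive across cuts and small on thin strips, and why such a
    rectangle function has to be countably additive. Since [F_n - F] is not monotone, integration by
    parts is carried out for pairs of cumulative functions and combined bilinearly. Degeneracy,
    however, is stated with the Jordan measures of [F_n - F], which must be reconciled with the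
    measures of [F_n] and [F]. *)

Lemma lerN_natr {R : numDomainType} (n : nat) : - n%:R <= n%:R :> R.
Proof. by rewrite lerNl (le_trans _ (ler0n _ _))// oppr_le0. Qed.

(** * Measures on the plane from additive rectangle functions *)

Section rectangles.
Context {R : realType}.
Implicit Types (p q : R * R).

(** A copy of the plane that carries the semiring of half-open rectangles, kept apart from the plane
    with its product sigma-algebra. *)
Definition rect_type : Type := (R * R)%type.

Definition rect p q : set (R * R) := `]p.1, q.1] `*` `]p.2, q.2].

Definition rects : set (set rect_type) :=
  [set rect pq.1 pq.2 | pq in [set: (R * R) * (R * R)]].

Lemma rect_rects p q : rects (rect p q).
Proof. by exists (p, q). Qed.

Lemma rectsX (A B : set R) : ocitv A -> ocitv B -> rects (A `*` B).
Proof. by move=> [a _ <-] [b _ <-]; exists ((a.1, b.1), (a.2, b.2)). Qed.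

Lemma rects_ocitv (A : set rect_type) : rects A ->
  exists I J, [/\ ocitv I, ocitv J & A = I `*` J].
Proof.
move=> [[p q] _ <-] /=; exists `]p.1, q.1]%classic, `]p.2, q.2]%classic.
by split=> //; exact: is_ocitv.
Qed.

(** Corners in the wrong order are allowed in [rect p q] and give the empty set; [rect 0 0] then
    supplies ordered ones. *)
Lemma rects_le (A : set rect_type) : rects A ->
  exists p q, [/\ p.1 <= q.1, p.2 <= q.2 & A = rect p q].
Proof.
move=> [[p q] _ <-] /=.
have r0 : rect 0 0 = set0.
  by apply/seteqP; split=> // -[x y] []; rewrite /= !in_itv/=; lra.
case: (leP p.1 q.1) => p1; case: (leP p.2 q.2) => p2; first by exists p, q.
all: exists 0, 0; split => //; rewrite r0.
all: by apply/seteqP; split=> // -[x y] []; rewrite /= !in_itv/=; lra.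
Qed.

Lemma rects0 : rects set0.
Proof.
by rewrite -[set0](@set0X R R (set0 : set R)); apply: rectsX; exact: ocitv0.
Qed.

Lemma rectsI : setI_closed rects.
Proof.
move=> _ _ /rects_ocitv[A [B [oA oB ->]]] /rects_ocitv[C [D [oC oD ->]]].
by rewrite -setXI; apply: rectsX; exact: ocitvI.
Qed.

(** [(A x B) \ (C x E)] is the disjoint union of [(A \ C) x B] and [(A & C) x (B \ E)], and each
    difference of intervals splits into finitely many intervals. *)
Lemma rectsD : semi_setD_closed rects.
Proof.
move=> _ _ /rects_ocitv[A [B [oA oB ->]]] /rects_ocitv[C [E [oC oE ->]]].
have [D1 [fD1 oD1 D1E tD1]] := ocitvD oA oC.
have [D2 [fD2 oD2 D2E tD2]] := ocitvD oB oE.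
exists ([set X `*` B | X in D1] `|` [set (A `&` C) `*` Y | Y in D2]); split.
- by rewrite finite_setU; split; apply: finite_image.
- move=> _ [[X D1X <-]|[Y D2Y <-]].
    by apply: rectsX => //; exact: oD1.
  by apply: rectsX; [exact: ocitvI|exact: oD2].
- rewrite bigcup_setU !bigcup_image.
  have -> : \bigcup_(X in D1) (X `*` B) = (A `\` C) `*` B.
    by rewrite D1E; apply/seteqP; split=> [[x y] [X DX [/= Xx By]]|[x y] [[X DX /= Xx] /= By]];
      [split=> //; exists X|exists X].
  have -> : \bigcup_(Y in D2) ((A `&` C) `*` Y) = (A `&` C) `*` (B `\` E).
    by rewrite D2E; apply/seteqP; split=> [[x y] [X DX [/= Xx By]]|[x y] [/= Xx [X DX /= By]]];
      [split=> //; exists X|exists X].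
  apply/seteqP; split=> [[x y] /= [[Ax By] nCE]|[x y] /= [[[Ax nCx] By]|[[Ax Cx] [By nEy]]]].
  + have [Cx|nCx] := pselect (C x); last by left.
    by right; split=> //; split=> // Ey; apply: nCE.
  + by split=> // -[].
  + by split=> // -[].
- have sub1 X x : D1 X -> X x -> ~ C x.
    by move=> DX Xx; suff [] : (A `\` C) x by []; rewrite D1E; exists X.
  move=> _ _ [[X DX <-]|[X DX <-]] [[Y DY <-]|[Y DY <-]] [[x y] /= [[X1 X2] [Y1 Y2]]].
  + by rewrite (tD1 _ _ DX DY)//; exists x.
  + by case: Y1 => _ /(sub1 _ _ DX X1).
  + by case: X1 => _ /(sub1 _ _ DY Y1).
  + by rewrite (tD2 _ _ DX DY)//; exists y.
Qed.

Definition rect_display : Type -> measure_display. Proof. exact. Qed.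

HB.instance Definition _ := Pointed.copy rect_type (R * R)%type.
HB.instance Definition _ :=
  @isSemiRingOfSets.Build (rect_display R) rect_type rects rects0 rectsI rectsD.

Lemma measurable_rect p q :
  measurable (rect p q : set (measurableTypeR R * measurableTypeR R)).
Proof. by apply: measurableX; exact: measurable_itv. Qed.

Lemma bigcup_rect :
  \bigcup_k rect (- k%:R, - k%:R) (k%:R, k%:R) = [set: R * R].
Proof.
apply/seteqP; split=> // -[x y] _; set M := Num.max `|x| `|y|.
have : M < (Num.bound M)%:R by rewrite archi_boundP// le_max normr_ge0.
rewrite gt_max !ltr_norml => /andP[/andP[x1 x2] /andP[y1 y2]].
exists (Num.bound M) => //; split; rewrite /= in_itv/= ?x1 ?y1 ltW//.
Qed.

(** The Caratheodory extension lives on the right-hand side, product measures on the left. A strip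
    [I x R] is a countable union of rectangles, and the sets [A] with [A x R] in the generated
    sigma-algebra form a sigma-algebra, hence include all Borel sets; a measurable product is an
    intersection of two strips. *)
Lemma measurable_prod_rects :
  (measurable : set (set (measurableTypeR R * measurableTypeR R))) = <<s rects >>.
Proof.
apply/seteqP; split; last first.
  apply: smallest_sub => [|A [pq _ <-]]; last exact: measurable_rect.
  split=> [|A mA|F mF]; [exact: measurable0|rewrite setTD; exact: measurableC|].
  exact: bigcupT_measurable.
pose g (A : set (R * R)) := measurable (A : set (g_sigma_algebraType rects)).
have oct : forall I : set R, ocitv I -> g (I `*` [set: R]).
  move=> I oI; have -> : I `*` [set: R] = \bigcup_k (I `*` `]- k%:R, k%:R]%classic).
    rewrite -[in LHS](bigcup_itvT false false).
    apply/seteqP; split=> [[x y] [Ix [k _ ky]]|[x y] [k _ [Ix ky]]].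
      by exists k.
    by split => //; exists k.
  apply: bigcupT_measurable => k; apply: sub_sigma_algebra.
  by apply: rectsX => //; exact: is_ocitv.
have oct' : forall I : set R, ocitv I -> g ([set: R] `*` I).
  move=> I oI; have -> : [set: R] `*` I = \bigcup_k (`]- k%:R, k%:R]%classic `*` I).
    rewrite -[in LHS](bigcup_itvT false false).
    apply/seteqP; split=> [[x y] [[k _ ky] Ix]|[x y] [k _ [ky Ix]]].
      by exists k.
    by split => //; exists k.
  apply: bigcupT_measurable => k; apply: sub_sigma_algebra.
  by apply: rectsX => //; exact: is_ocitv.
have mX1 (A : set (measurableTypeR R)) : measurable A -> g (A `*` [set: R]).
  move=> mA; have : <<s @ocitv R >> A by [].
  apply: (@smallest_sub _ _ _ (fun A => g (A `*` [set: R]))) => //; split.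
  - by rewrite set0X; exact: measurable0.
  - move=> X mX; rewrite setTD.
    have -> : ~` X `*` [set: R] = ~` (X `*` setT).
      apply/seteqP; split=> [[x y] /= [nX _] [X' _]//|[x y] /= nX].
      by split=> // Xx; apply: nX.
    exact: measurableC.
  - move=> F mF.
    have -> : \bigcup_n F n `*` [set: R] = \bigcup_n (F n `*` setT).
      by apply/seteqP; split=> [[x y] [[k _ ky] Ix]|[x y] [k _ [ky Ix]]];
        [exists k|split => //; exists k].
    exact: bigcupT_measurable.
have mX2 (A : set (measurableTypeR R)) : measurable A -> g ([set: R] `*` A).
  move=> mA; have : <<s @ocitv R >> A by [].
  apply: (@smallest_sub _ _ _ (fun A => g ([set: R] `*` A))) => //; split.
  - by rewrite setX0; exact: measurable0.
  - move=> X mX; rewrite setTD.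
    have -> : [set: R] `*` ~` X = ~` (setT `*` X).
      apply/seteqP; split=> [[x y] /= [_ nX] [_ X']//|[x y] /= nX].
      by split=> // Xx; apply: nX.
    exact: measurableC.
  - move=> F mF.
    have -> : [set: R] `*` \bigcup_n F n = \bigcup_n (setT `*` F n).
      by apply/seteqP; split=> [[x y] [Ix [k _ ky]]|[x y] [k _ [Ix ky]]];
        [exists k|split => //; exists k].
    exact: bigcupT_measurable.
rewrite measurable_prod_measurableType.
apply: (@smallest_sub _ _ _ g).
  split=> [|A mA|F mF]; [exact: measurable0|rewrite setTD; exact: measurableC|].
  exact: bigcupT_measurable.
move=> _ [A mA [B mB <-]].
have -> : A `*` B = (A `*` setT) `&` (setT `*` B) by rewrite -setXI setIT setTI.
by apply: measurableI; [exact: mX1|exact: mX2].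
Qed.

End rectangles.

(** * Stieltjes measures on the line from interval functions *)

Section interval_functions.
Context {R : realType}.

Lemma lebesgue_stieltjes_measure_itv (G : cumulative R R) (a b : R) : a <= b ->
  lebesgue_stieltjes_measure G `]a, b]%classic = (G b - G a)%:E.
Proof.
move=> ab; rewrite /lebesgue_stieltjes_measure /measure_extension.
by rewrite measurable_mu_extE/= ?wlength_itv_bnd//; exact: is_ocitv.
Qed.

Lemma measure_itv_unique
    (mu nu : {measure set (measurableTypeR R) -> \bar R}) :
  (forall a b : R, a <= b ->
     mu `]a, b]%classic = nu `]a, b]%classic /\ (mu `]a, b]%classic < +oo)%E) ->
  forall A, measurable A -> mu A = nu A.
Proof.
move=> munu A mA.
apply: (@measure_unique _ R (measurableTypeR R) (@ocitv R)
  (fun k => `]- k%:R, k%:R]%classic) erefl (@ocitvI R)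
  (fun k => is_ocitv _ _) (bigcup_itvT false false) mu nu) => //.
- move=> C [[a b] _ <-] /=; have [ab|ba] := leP a b; first by have [] := munu _ _ ab.
  by rewrite set_itv_ge ?measure0// bnd_simp -leNgt ltW.
- by move=> k; have [] := munu _ _ (lerN_natr k).
Qed.

Lemma nondecreasing_right_cvg (f : R -> R) (a : R) :
  {homo f : x y / x <= y} ->
  (forall e, 0 < e -> exists2 d, 0 < d & f (a + d) - f a <= e) ->
  f @ a^'+ --> f a.
Proof.
move=> ndf fa; apply/cvgrPdist_le => e e0; have [d d0 fd] := fa _ e0.
near=> x; have ax : a <= x by near: x; exact: nbhs_right_ge.
rewrite distrC ger0_norm ?subr_ge0 ?ndf// (le_trans _ fd)// lerD2r ndf//.
by near: x; apply: nbhs_right_le; rewrite ltrDl.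
Unshelve. all: by end_near. Qed.

(** The primitive is normalised at 0: [G x] is the mass of []0, x]], or minus the mass of []x, 0]].
    As [G] is monotone, a single [d] for each [e] is enough for right-continuity. *)
Lemma interval_function_cumulative (m : R -> R -> R) :
  (forall a b, a <= b -> 0 <= m a b) ->
  (forall a b c, a <= b -> b <= c -> m a c = m a b + m b c) ->
  (forall a e, 0 < e -> exists2 d, 0 < d & m a (a + d) <= e) ->
  exists G : cumulative R R, forall a b, a <= b -> m a b = G b - G a.
Proof.
move=> m0 mD mrc; pose G x := if 0 <= x then m 0 x else - m x 0.
have GE a b : a <= b -> m a b = G b - G a.
  move=> ab; rewrite /G; have [a0|a0] := leP 0 a.
    by rewrite (le_trans a0 ab) (mD 0 a b)// addrAC subrr add0r.
  have [b0|b0] := leP 0 b; first by rewrite (mD a 0 b)// ?ltW// addrC opprK.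
  by rewrite (mD a b 0)// ?ltW// opprK addrC addrK.
have ndG : {homo G : x y / x <= y}.
  by move=> x y xy; rewrite -subr_ge0 -GE// m0.
have rcG : right_continuous G.
  move=> a; apply: nondecreasing_right_cvg => // e e0.
  by have [d d0 md] := mrc a _ e0; exists d => //; rewrite -GE// lerDl ltW.
by exists (HB.pack_for (cumulative R R) G (isCumulative.Build R _ R G ndG rcG)).
Qed.

End interval_functions.

(** * Additive functions of rectangles *)

Section rect_content.
Context {R : realType}.

(** The last two fields concern one thin strip in one coordinate, the other side being fixed. With
    positivity and additivity they suffice to approximate a rectangle from inside and from
    outside. *)
Record rect_additive (m : R -> R -> R -> R -> R) : Prop := RectAdditive {
  rect_ge0 : forall a1 a2 b1 b2, a1 <= a2 -> b1 <= b2 -> 0 <= m a1 a2 b1 b2 ;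
  rect_add1 : forall a1 a2 a3 b1 b2, a1 <= a2 -> a2 <= a3 -> b1 <= b2 ->
    m a1 a3 b1 b2 = m a1 a2 b1 b2 + m a2 a3 b1 b2 ;
  rect_add2 : forall a1 a2 b1 b2 b3, a1 <= a2 -> b1 <= b2 -> b2 <= b3 ->
    m a1 a2 b1 b3 = m a1 a2 b1 b2 + m a1 a2 b2 b3 ;
  rect_rc1 : forall a b1 b2 e, b1 <= b2 -> 0 < e ->
    exists2 d, 0 < d & m a (a + d) b1 b2 <= e ;
  rect_rc2 : forall a1 a2 b e, a1 <= a2 -> 0 < e ->
    exists2 d, 0 < d & m a1 a2 b (b + d) <= e }.

Lemma measure_finadd d (T : measurableType d) (mu : {measure set T -> \bar R})
    (I : finType) (D : pred I) (F : I -> set T) (A : set T) :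
  (forall i, D i -> measurable (F i)) ->
  (forall i j x, D i -> D j -> F i x -> F j x -> i = j) ->
  (forall x, A x <-> exists2 i, D i & F i x) ->
  mu A = (\sum_(i | D i) mu (F i))%E.
Proof.
move=> mF tF AE; have -> : A = \bigcup_(i in [set` D]) F i.
  apply/seteqP; split=> x; first by move=> /AE[i Di Fi]; exists i.
  by move=> [i Di Fi]; apply/AE; exists i.
rewrite measure_fin_bigcup//; last first.
  by move=> i j Di Dj [x [Fi Fj]]; exact: tF Di Dj Fi Fj.
by rewrite [RHS]bigfs ?index_enum_uniq// => i; rewrite mem_index_enum.
Qed.

Lemma itv_oc_inj (a b a' b' : R) : a < b -> `]a, b]%classic = `]a', b']%classic ->
  a = a' /\ b = b'.
Proof.
move=> ab /seteqP[s1 s2].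
have /= := s1 b; rewrite !in_itv/= ab lexx => /(_ isT)/andP[a'b bb'].
have /= := s2 b'; rewrite !in_itv/= lexx (lt_le_trans a'b bb') => /(_ isT)/andP[ab' b'b].
split; last by apply/eqP; rewrite eq_le bb'.
apply/eqP; rewrite eq_le; apply/andP; split; rewrite leNgt; apply/negP => aa.
  have /= := s2 a; rewrite !in_itv/= ltxx/= aa => /(_ (ltW ab')).
  by [].
have /= := s1 a'; rewrite !in_itv/= ltxx/= aa => /(_ (ltW a'b)).
by [].
Qed.

Context (m : R -> R -> R -> R -> R) (hm : rect_additive m).

Lemma rect_empty1 a b1 b2 : b1 <= b2 -> m a a b1 b2 = 0.
Proof.
move=> b12; have := rect_add1 hm (lexx a) (lexx a) b12.
by move/eqP; rewrite addrC -subr_eq subrr eq_sym => /eqP.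
Qed.

Lemma rect_empty2 a1 a2 b : a1 <= a2 -> m a1 a2 b b = 0.
Proof.
move=> a12; have := rect_add2 hm a12 (lexx b) (lexx b).
by move/eqP; rewrite addrC -subr_eq subrr eq_sym => /eqP.
Qed.

(** A nonempty rectangle determines its corners through its two projections, and an empty one has
    mass 0. So [m] is a function of sets. *)
Lemma rect_inj (p q p' q' : R * R) : p.1 <= q.1 -> p.2 <= q.2 ->
  p'.1 <= q'.1 -> p'.2 <= q'.2 -> rect p q = rect p' q' ->
  m p.1 q.1 p.2 q.2 = m p'.1 q'.1 p'.2 q'.2.
Proof.
have nonempty (u v : R * R) : rect u v !=set0 -> u.1 < v.1 /\ u.2 < v.2.
  by move=> [[x y] []]; rewrite /= !in_itv/= => /andP[a b] /andP[c d];
    split; [exact: lt_le_trans b|exact: lt_le_trans d].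
have empty (u v : R * R) : u.1 <= v.1 -> u.2 <= v.2 -> rect u v = set0 ->
    m u.1 v.1 u.2 v.2 = 0.
  rewrite !le_eqVlt => /predU1P[-> uv2 _|uv1].
    by rewrite rect_empty1// le_eqVlt.
  move=> /predU1P[-> _|uv2]; first by rewrite rect_empty2// ltW.
  by move/seteqP => [/(_ v) + _] /=; case; split; rewrite /= in_itv/= lexx andbT.
move=> p1 p2 p'1 p'2 pq; have [r0|/set0P r0] := eqVneq (rect p q) set0.
  by rewrite !empty// -pq.
have [p1' p2'] := nonempty _ _ r0; have [p1'' p2''] : p'.1 < q'.1 /\ p'.2 < q'.2.
  by apply: nonempty; rewrite -pq.
have i1 : fst @` rect p q = `]p.1, q.1]%classic.
  apply/seteqP; split=> [x [[u v] [/= ? ?] <-]//|x px].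
  by exists (x, q.2) => //; split=> //; rewrite /= in_itv/= lexx p2'.
have i2 : snd @` rect p q = `]p.2, q.2]%classic.
  apply/seteqP; split=> [x [[u v] [/= ? ?] <-]//|x px].
  by exists (q.1, x) => //; split=> //; rewrite /= in_itv/= lexx p1'.
have i1' : fst @` rect p' q' = `]p'.1, q'.1]%classic.
  apply/seteqP; split=> [x [[u v] [/= ? ?] <-]//|x px].
  by exists (x, q'.2) => //; split=> //; rewrite /= in_itv/= lexx p2''.
have i2' : snd @` rect p' q' = `]p'.2, q'.2]%classic.
  apply/seteqP; split=> [x [[u v] [/= ? ?] <-]//|x px].
  by exists (q'.1, x) => //; split=> //; rewrite /= in_itv/= lexx p1''.
have [-> ->] : p.1 = p'.1 /\ q.1 = q'.1 by apply: itv_oc_inj; rewrite // -i1 -i1' pq.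
by have [-> ->] : p.2 = p'.2 /\ q.2 = q'.2 by apply: itv_oc_inj; rewrite // -i2 -i2' pq.
Qed.

(** With one side frozen, [m] becomes a measure in the other variable and can be evaluated at sets
    that are not intervals. *)
Lemma rect_measure1 b1 b2 : b1 <= b2 ->
  exists mu : {measure set (measurableTypeR R) -> \bar R},
    forall a1 a2, a1 <= a2 -> mu `]a1, a2]%classic = (m a1 a2 b1 b2)%:E.
Proof.
move=> b12; have [|||G GE] := @interval_function_cumulative R (fun a1 a2 => m a1 a2 b1 b2).
- by move=> a b ab; exact: rect_ge0 hm _ _ _ _ ab b12.
- by move=> a b c ab bc; exact: rect_add1.
- by move=> a e e0; exact: rect_rc1.
exists (lebesgue_stieltjes_measure G) => a1 a2 a12.
by rewrite GE//; exact: lebesgue_stieltjes_measure_itv.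
Qed.

Lemma rect_measure2 a1 a2 : a1 <= a2 ->
  exists mu : {measure set (measurableTypeR R) -> \bar R},
    forall b1 b2, b1 <= b2 -> mu `]b1, b2]%classic = (m a1 a2 b1 b2)%:E.
Proof.
move=> a12; have [|||G GE] := @interval_function_cumulative R (m a1 a2).
- by move=> a b ab; exact: rect_ge0 hm _ _ _ _ a12 ab.
- by move=> a b c ab bc; exact: rect_add2.
- by move=> a e e0; exact: rect_rc2.
exists (lebesgue_stieltjes_measure G) => b1 b2 b12.
by rewrite GE//; exact: lebesgue_stieltjes_measure_itv.
Qed.

End rect_content.

Section rect_finite_additivity.
Context {R : realType} (m : R -> R -> R -> R -> R) (hm : rect_additive m).

(** A tiling need not arise from successive cuts across whole rectangles, which is all that
    [rect_add1] and [rect_add2] allow. Each mass is instead written as a frozen-side measure of an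
    interval, distributed over atoms in the first coordinate, and the two sums are exchanged. *)
Lemma rect_finite_additivity (n : nat) (p q : 'I_n -> R * R) (P Q : R * R) :
  (forall i, (p i).1 <= (q i).1) -> (forall i, (p i).2 <= (q i).2) ->
  P.1 <= Q.1 -> P.2 <= Q.2 ->
  (forall i j x, rect (p i) (q i) x -> rect (p j) (q j) x -> i = j) ->
  (forall x, rect P Q x <-> exists i, rect (p i) (q i) x) ->
  m P.1 Q.1 P.2 Q.2 = \sum_i m (p i).1 (q i).1 (p i).2 (q i).2.
Proof.
move=> pq1 pq2 PQ1 PQ2 tri cov.
have /choice[mu1 mu1E] : forall b : R * R,
    exists mu : {measure set (measurableTypeR R) -> \bar R}, b.1 <= b.2 ->
    forall a1 a2, a1 <= a2 -> mu `]a1, a2]%classic = (m a1 a2 b.1 b.2)%:E.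
  move=> b; have [b12|b12] := leP b.1 b.2; last by exists mzero.
  by have [mu muE] := rect_measure1 hm b12; exists mu.
have /choice[mu2 mu2E] : forall a : R * R,
    exists mu : {measure set (measurableTypeR R) -> \bar R}, a.1 <= a.2 ->
    forall b1 b2, b1 <= b2 -> mu `]b1, b2]%classic = (m a.1 a.2 b1 b2)%:E.
  move=> a; have [a12|a12] := leP a.1 a.2; last by exists mzero.
  by have [mu muE] := rect_measure2 hm a12; exists mu.
pose I i : set R := `](p i).1, (q i).1]%classic.
pose J i : set R := `](p i).2, (q i).2]%classic.
(* Empty tiles are discarded: one of their sides may be nonempty and stick out of the large
   rectangle. *)
pose N (i : 'I_n) := ((p i).1 < (q i).1) && ((p i).2 < (q i).2).
have NI i : N i -> I i `<=` `]P.1, Q.1]%classic.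
  move=> /andP[_ Ni] x Ix; have [] : rect P Q (x, (q i).2) by
    apply/cov; exists i; split=> //; rewrite /= in_itv/= lexx Ni.
  by [].
have NJ i x y : I i x -> J i y -> N i.
  rewrite /I /J /= !in_itv/= => /andP[a b] /andP[c d].
  by rewrite /N (lt_le_trans a b) (lt_le_trans c d).
apply: EFin_inj; rewrite -sumEFin (bigID N)/= [X in (_ + X)%E]big1 ?adde0; last first.
  move=> i; rewrite /N negb_and -!leNgt => /orP[h|h].
    by rewrite (_ : (p i).1 = (q i).1) ?rect_empty1//; apply/eqP; rewrite eq_le pq1.
  by rewrite (_ : (p i).2 = (q i).2) ?rect_empty2//; apply/eqP; rewrite eq_le pq2.
(* The horizontal sides of the rectangles generate finitely many atoms A s; over a fixed atom the
   rectangles met are those in s, and their vertical sides partition that of the whole. *)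
pose A (s : {set 'I_n}) : set R :=
  `]P.1, Q.1]%classic `&` [set x | forall i, i \in s <-> I i x].
have mA s : measurable (A s : set (measurableTypeR R)).
  apply: measurableI; first exact: measurable_itv.
  rewrite (_ : [set _ | _] = \bigcap_i (if i \in s then I i else ~` I i)).
    apply: fin_bigcap_measurable => // i _.
    by case: ifP => _; [|apply: measurableC]; exact: measurable_itv.
  apply/seteqP; split=> x /=.
    by move=> h i _; case: ifP => [/h//|/negP si] /h.
  by move=> h i; have := h i Logic.I; case: ifP => // _ Ii; split.
have triA s t x : A s x -> A t x -> s = t.
  by move=> [_ h] [_ h']; apply/setP => i; apply/idP/idP => /= ?; [apply/h'/h|apply/h/h'].
have covA x : `]P.1, Q.1]%classic x -> exists s, A s x.
  move=> Px; exists [set i | `[< I i x >]]%SET; split=> // i.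
  by rewrite inE; split=> /asboolP.
rewrite -(mu1E (P.2, Q.2))//.
rewrite (measure_finadd (mu1 (P.2, Q.2)) (D := xpredT) (F := A))//; last first.
- by move=> x; split=> [/covA[s]|[s _ []]//]; exists s.
- by move=> i j x _ _; exact: triA.
transitivity (\sum_(i | N i) \sum_(s : {set 'I_n} | i \in s)
    mu1 ((p i).2, (q i).2) (A s))%E; last first.
  apply: eq_bigr => i Ni; rewrite -(mu1E ((p i).2, (q i).2) (pq2 i))//; apply/esym.
  apply: measure_finadd => // [s t x _ _|x]; first exact: triA.
  split=> [Ix|[s si [_]]]; last by move/(_ i)/iffLR; exact.
  by have [s sx] := covA x (NI _ Ni _ Ix); exists s => //; case: sx => _ ->.
rewrite [RHS](exchange_big_dep xpredT)//=; apply: eq_bigr => s _.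
have [->|/set0P[x sx]] := eqVneq (A s) set0.
  by rewrite measure0 big1// => i _; rewrite measure0.
(* The atom is not an interval, so the identity is proved between measures in the first coordinate:
   it is checked on all []c, d]] and then read at [A s]. The zero measure pads the family beyond [n]
   and at the tiles that do not meet the atom. *)
pose nu (k : nat) : {measure set (measurableTypeR R) -> \bar R} :=
  if insub k is Some i then
    if N i && (i \in s) then mu1 ((p i).2, (q i).2) else mzero
  else mzero.
transitivity (msum nu n (A s)); last first.
  rewrite [RHS]big_mkcond; apply: eq_bigr => i _.
  by rewrite /nu valK; case: ifP.
apply: measure_itv_unique => // c d cd; split; last by rewrite mu1E ?ltry.
rewrite (mu1E (P.2, Q.2))// -(mu2E (c, d))//.
transitivity (\sum_(i | N i && (i \in s)) mu2 (c, d) (J i))%E.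
  apply: measure_finadd => [i _|i j y /andP[_ si] /andP[_ sj] Ji Jj|y].
  - exact: measurable_itv.
  - by apply: (tri _ _ (x, y)); split=> //; apply/sx.2.
  - split=> [Jy|[i /andP[Ni si] Ji]].
      have /cov[i [Ii Ji]] : rect P Q (x, y) by split=> //; exact: sx.1.
      by exists i => //; rewrite (NJ _ _ _ Ii Ji)/=; apply/sx.2.
    have [] : rect P Q (x, y) by apply/cov; exists i; split=> //; apply/sx.2.
    by [].
rewrite big_mkcond; apply: eq_bigr => i _; rewrite /nu valK; case: ifP => // _.
by rewrite [RHS](mu1E (_, _) (pq2 i))//; exact: (mu2E (c, d)) (pq2 i).
Qed.

End rect_finite_additivity.

Lemma open_setX (T U : topologicalType) (A : set T) (B : set U) :
  open A -> open B -> open (A `*` B).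
Proof.
move=> oA oB; rewrite openE => -[x y] [/= Ax By]; exists (A, B) => //.
by split; apply: open_nbhs_nbhs.
Qed.

(** * Caratheodory extension from the semiring of rectangles *)

Section rect_measure.
Context {R : realType} (m : R -> R -> R -> R -> R) (hm : rect_additive m).

(** Ordered corners of [A] are chosen, and [rect_inj] makes the value independent of the choice;
    sets that are not rectangles get 0. *)
Definition rect_content of rect_additive m := fun A : set (@rect_type R) =>
  if pselect (exists pq : (R * R) * (R * R), [/\ pq.1.1 <= pq.2.1,
    pq.1.2 <= pq.2.2 & A = rect pq.1 pq.2]) is left h
  then let pq := sval (cid h) in (m pq.1.1 pq.2.1 pq.1.2 pq.2.2)%:E else 0%E.

Local Notation mu := (rect_content hm).

Lemma rect_contentE (p q : R * R) : p.1 <= q.1 -> p.2 <= q.2 ->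
  mu (rect p q) = (m p.1 q.1 p.2 q.2)%:E.
Proof.
move=> pq1 pq2; rewrite /rect_content; case: pselect => [h|[]]; last by exists (p, q).
case: cid => -[u v] /= [u1 u2 uv]; congr EFin.
by apply: (rect_inj hm) => //; rewrite uv.
Qed.

Lemma rect_content_ge0 A : (0 <= mu A)%E.
Proof.
rewrite /rect_content; case: pselect => // h; case: cid => -[u v] /= [u1 u2 _].
by rewrite lee_fin (rect_ge0 hm).
Qed.

Lemma rect_content_semi_additive : measure_function.semi_additive mu.
Proof.
move=> F n mF tF mU.
have /choice[pq pqE] : forall k, exists pq : (R * R) * (R * R),
    [/\ pq.1.1 <= pq.2.1, pq.1.2 <= pq.2.2 & F k = rect pq.1 pq.2].
  by move=> k; have [p [q [? ? ?]]] := rects_le (mF k); exists (p, q).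
have [P [Q [P1 P2 UE]]] := rects_le mU.
rewrite UE rect_contentE// (rect_finite_additivity hm
  (p := fun i : 'I_n => (pq i).1) (q := fun i : 'I_n => (pq i).2))//.
- by rewrite -sumEFin; apply: eq_bigr => i _; have [? ? ->] := pqE i; rewrite rect_contentE.
- by move=> i; have [] := pqE i.
- by move=> i; have [] := pqE i.
- move=> i j x; have [_ _ <-] := pqE i; have [_ _ <-] := pqE j => Fi Fj.
  by apply: val_inj; apply: tF => //; exists x.
- move=> x; rewrite -UE -bigcup_mkord; split=> [[k /= kn Fx]|[i ix]].
    by exists (Ordinal kn) => /=; have [_ _ <-] := pqE k.
  by exists i => //=; have [_ _ ->] := pqE i.
Qed.

HB.instance Definition _ := isContent.Build _ _ R mu
  rect_content_ge0 rect_content_semi_additive.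

Lemma le_rect1 a1 a2 a3 b1 b2 : a1 <= a2 -> a2 <= a3 -> b1 <= b2 ->
  m a1 a2 b1 b2 <= m a1 a3 b1 b2.
Proof.
by move=> a12 a23 b12; rewrite (rect_add1 hm a12 a23 b12) lerDl (rect_ge0 hm).
Qed.

Lemma le_rect1l a1 a2 a3 b1 b2 : a1 <= a2 -> a2 <= a3 -> b1 <= b2 ->
  m a2 a3 b1 b2 <= m a1 a3 b1 b2.
Proof.
by move=> a12 a23 b12; rewrite (rect_add1 hm a12 a23 b12) lerDr (rect_ge0 hm).
Qed.

Lemma le_rect2 a1 a2 b1 b2 b3 : a1 <= a2 -> b1 <= b2 -> b2 <= b3 ->
  m a1 a2 b1 b2 <= m a1 a2 b1 b3.
Proof.
by move=> a12 b12 b23; rewrite (rect_add2 hm a12 b12 b23) lerDl (rect_ge0 hm).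
Qed.

(** A thin strip is cut off on the left and another at the bottom, each of mass at most [e / 2]. The
    strict inequalities keep the closed rectangle from [c] to [q] inside [rect p q]. *)
Lemma rect_shrink (p q : R * R) (e : R) : p.1 < q.1 -> p.2 < q.2 -> 0 < e ->
  exists c, [/\ p.1 < c.1, c.1 <= q.1, p.2 < c.2, c.2 <= q.2 &
    m p.1 q.1 p.2 q.2 <= m c.1 q.1 c.2 q.2 + e].
Proof.
move=> pq1 pq2 e0; have e20 : 0 < e / 2 by rewrite divr_gt0.
have [d1 d10 md1] := rect_rc1 hm p.1 (ltW pq2) e20.
have [d2 d20 md2] := rect_rc2 hm p.2 (ltW pq1) e20.
pose c1 := Num.min (p.1 + d1) q.1; pose c2 := Num.min (p.2 + d2) q.2.
have pc1 : p.1 < c1 by rewrite lt_min pq1 ltrDl d10.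
have pc2 : p.2 < c2 by rewrite lt_min pq2 ltrDl d20.
have cq1 : c1 <= q.1 by rewrite ge_min lexx orbT.
have cq2 : c2 <= q.2 by rewrite ge_min lexx orbT.
have h1 : m p.1 c1 p.2 q.2 <= e / 2.
  by apply: le_trans md1; apply: le_rect1; rewrite ?ge_min ?lexx// ltW.
have h2 : m p.1 q.1 p.2 c2 <= e / 2.
  by apply: le_trans md2; apply: le_rect2; rewrite ?ge_min ?lexx// ltW.
exists (c1, c2); split => //=.
rewrite (rect_add1 hm (ltW pc1) cq1 (ltW pq2)).
rewrite (rect_add2 hm cq1 (ltW pc2) cq2).
have h3 := le_rect1l (ltW pc1) cq1 (ltW pc2).
by rewrite [e]splitr; lra.
Qed.

Lemma rect_enlarge (p q : R * R) (e : R) : p.1 <= q.1 -> p.2 <= q.2 -> 0 < e ->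
  exists2 d, 0 < d &
    m p.1 (q.1 + d) p.2 (q.2 + d) <= m p.1 q.1 p.2 q.2 + e.
Proof.
move=> pq1 pq2 e0; have e20 : 0 < e / 2 by rewrite divr_gt0.
(* The strip on the right is estimated over the height up to [q.2 + 1], because the enlargement [d]
   at the top is not chosen yet; hence the bound 1 in the minimum below. *)
have pq21 : p.2 <= q.2 + 1 by rewrite (le_trans pq2)// lerDl.
have [d1 d10 md1] := rect_rc1 hm q.1 pq21 e20.
have [d2 d20 md2] := rect_rc2 hm q.2 pq1 e20.
pose d := Num.min (Num.min d1 d2) 1.
have d0 : 0 < d by rewrite !lt_min d10 d20 ltr01.
have dd1 : d <= d1 by rewrite !ge_min lexx.
have dd2 : d <= d2 by rewrite !ge_min lexx orbT.
have d1' : d <= 1 by rewrite !ge_min lexx !orbT.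
have qd1 : q.1 <= q.1 + d by rewrite lerDl ltW.
have qd2 : q.2 <= q.2 + d by rewrite lerDl ltW.
exists d => //.
rewrite (rect_add1 hm pq1 qd1 (le_trans pq2 qd2)) (rect_add2 hm pq1 pq2 qd2).
have h1 : m q.1 (q.1 + d) p.2 (q.2 + d) <= e / 2.
  apply: le_trans md1; apply: (@le_trans _ _ (m q.1 (q.1 + d) p.2 (q.2 + 1))).
    by apply: le_rect2; rewrite ?lerD2l// (le_trans pq2).
  by apply: le_rect1; rewrite // lerD2l.
have h2 : m p.1 q.1 q.2 (q.2 + d) <= e / 2.
  by apply: le_trans md2; apply: le_rect2; rewrite // lerD2l.
by rewrite [e]splitr; lra.
Qed.

Lemma rect_content_sigma_subadditive : measurable_subset_sigma_subadditive mu.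
Proof.
move=> A F mF /rects_le[P [Q [P1 P2 ->]]] AF.
have /choice[pq pqE] : forall k, exists pq : (R * R) * (R * R),
    [/\ pq.1.1 <= pq.2.1, pq.1.2 <= pq.2.2 & F k = rect pq.1 pq.2].
  by move=> k; have [p [q [? ? ?]]] := rects_le (mF k); exists (p, q).
have {mF}pq1 k : (pq k).1.1 <= (pq k).2.1 by have [] := pqE k.
have pq2 k : (pq k).1.2 <= (pq k).2.2 by have [] := pqE k.
have {pqE}FE k : F k = rect (pq k).1 (pq k).2 by have [] := pqE k.
rewrite rect_contentE//.
have sum_ge0 : (0 <= \sum_(n <oo) mu (F n))%E.
  by apply: nneseries_ge0 => *; exact: rect_content_ge0.
move: P1 P2; rewrite le_eqVlt => /predU1P[-> P2|P1]; first by rewrite rect_empty1.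
rewrite le_eqVlt => /predU1P[->|P2]; first by rewrite rect_empty2// ltW.
apply/lee_addgt0Pr => e e0; have e20 : 0 < e / 2 by rewrite divr_gt0.
(* Compactness: a slightly smaller closed rectangle is covered by finitely many of the slightly
   larger open ones. *)
have [c [Pc1 cQ1 Pc2 cQ2 mc]] := rect_shrink P1 P2 e20.
have /choice[D D0] : forall k, exists d, 0 < d /\
    m (pq k).1.1 ((pq k).2.1 + d) (pq k).1.2 ((pq k).2.2 + d) <=
    m (pq k).1.1 (pq k).2.1 (pq k).1.2 (pq k).2.2 + (e / 2) / (2 ^ k.+1)%:R.
  move=> k; have [|||d d0 md] := @rect_enlarge (pq k).1 (pq k).2 ((e / 2) / (2 ^ k.+1)%:R) => //.
    by rewrite divr_gt0// ltr0n expn_gt0.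
  by exists d.
pose O k : set (R * R) := `](pq k).1.1, (pq k).2.1 + D k[%classic `*`
                           `](pq k).1.2, (pq k).2.2 + D k[%classic.
have oO k : [set: nat] k -> open (O k).
  by move=> _; apply: open_setX; exact: interval_open.
have KO : `[c.1, Q.1]%classic `*` `[c.2, Q.2]%classic `<=` cover [set: nat] O.
  move=> [x y] [/=]; rewrite !in_itv/= => /andP[cx xQ] /andP[cy yQ].
  have : rect P Q (x, y) by split; rewrite /= in_itv/= ?xQ ?yQ andbT;
    [exact: lt_le_trans cx|exact: lt_le_trans cy].
  move=> /AF[k _]; rewrite FE => -[/=]; rewrite !in_itv/= => /andP[h1 h2] /andP[h3 h4].
  have [Dk _] := D0 k.
  exists k => //; split; rewrite /= in_itv/=; apply/andP; split=> //.
    by rewrite (le_lt_trans h2)// ltrDl.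
  by rewrite (le_lt_trans h4)// ltrDl.
have : compact (`[c.1, Q.1]%classic `*` `[c.2, Q.2]%classic).
  by apply: compact_setX; exact: segment_compact.
rewrite (@compact_cover (HB.pack_for ptopologicalType (R * R)%type
  (Pointed.on (R * R)%type) (Topological.on (R * R)%type))) => /(_ _ _ _ oO KO)[X _ XK].
(* The open rectangles [O k] are outside the semiring; the half-open ones with the same corners
   contain them and belong to it. *)
pose q' k : R * R := ((pq k).2.1 + D k, (pq k).2.2 + D k).
have q'1 k : (pq k).1.1 <= (q' k).1.
  by have [Dk _] := D0 k; rewrite (le_trans (pq1 k))//= lerDl ltW.
have q'2 k : (pq k).1.2 <= (q' k).2.
  by have [Dk _] := D0 k; rewrite (le_trans (pq2 k))//= lerDl ltW.
have sub : rect c Q `<=` \bigcup_(k in [set` X]) rect (pq k).1 (q' k).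
  move=> [x y] [/=]; rewrite !in_itv/= => /andP[cx xQ] /andP[cy yQ].
  have [|k Xk [/=]] := XK (x, y).
    by split; rewrite /= in_itv/= ?xQ ?yQ ?(ltW cx) ?(ltW cy).
  rewrite !in_itv/= => /andP[h1 h2] /andP[h3 h4]; exists k => //.
  by split; rewrite /= in_itv/= ?h1 ?h3 ltW.
have mq' k : [set` X] k -> measurable (rect (pq k).1 (q' k) : set (@rect_type R)).
  by move=> _; exact: rect_rects.
have hX : (mu (rect c Q) <= \sum_(k \in [set` X]) mu (rect (pq k).1 (q' k)))%E :=
  content_sub_fsum mu (finite_fset X) mq' (rect_rects c Q) sub.
rewrite rect_contentE// fsbig_finite//= set_fsetK in hX.
apply: (@le_trans _ _ ((m c.1 Q.1 c.2 Q.2)%:E + (e / 2)%:E)%E).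
  by rewrite -EFinD lee_fin.
rewrite [e in leRHS]splitr [in leRHS]EFinD addeA leeD2r//.
apply: le_trans (epsilon_trick _ _ (ltW e20)); last first.
  by move=> n; exact: rect_content_ge0.
apply: (le_trans hX).
rewrite nneseries_esum; last first.
  by move=> n _; rewrite adde_ge0 ?rect_content_ge0// lee_fin divr_ge0// ltW.
apply: esum_ge; exists [set` X] => //; rewrite fsbig_finite//= set_fsetK.
apply: lee_sum => k _; rewrite rect_contentE// FE rect_contentE// -EFinD lee_fin.
by have [_] := D0 k.
Qed.

HB.instance Definition _ := Content_SigmaSubAdditive_isMeasure.Build _ _ _
  mu rect_content_sigma_subadditive.

Lemma rect_measure_exists :
  exists nu : {measure set (measurableTypeR R * measurableTypeR R) -> \bar R},
    forall a1 a2 b1 b2, a1 <= a2 -> b1 <= b2 ->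
      nu (`]a1, a2]%classic `*` `]b1, b2]%classic) = (m a1 a2 b1 b2)%:E.
Proof.
pose ext : set (measurableTypeR R * measurableTypeR R) -> \bar R := measure_extension mu.
have mE (A : set (measurableTypeR R * measurableTypeR R)) : measurable A ->
    measurable (A : set (g_sigma_algebraType (@rects R))).
  by rewrite measurable_prod_rects.
have ext0 : ext set0 = 0%E by exact: measure0.
have ext_ge0 A : (0 <= ext A)%E by exact: measure_ge0.
have ext_sa : semi_sigma_additive ext.
  move=> F mF tF mU; apply: (@measure_semi_sigma_additive _ _ _ (measure_extension mu)) => //.
    by move=> i; exact: mE.
  exact: mE.
pose nu : {measure set (measurableTypeR R * measurableTypeR R) -> \bar R} :=
  HB.pack_for {measure set (measurableTypeR R * measurableTypeR R) -> \bar R}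
    ext (isMeasure.Build _ _ _ ext ext0 ext_ge0 ext_sa).
exists nu => a1 a2 b1 b2 a12 b12.
rewrite -(@rect_contentE (a1, b1) (a2, b2))//.
exact: (measurable_mu_extE mu (rect_rects (a1, b1) (a2, b2))).
Qed.

End rect_measure.

(** * Variation and Jordan-Stieltjes measures *)

Section chain_sums.
Context {R : realType}.
Implicit Types (phi : R -> R -> R) (s t : seq R).

(** Sums over the consecutive points of the grid [a :: s], in a form that suits induction on the
    grid. *)
Fixpoint chain_sum phi (a : R) (s : seq R) : R :=
  if s is x :: s' then phi a x + chain_sum phi x s' else 0.

Lemma chain_sumE phi z a s :
  \sum_(i < size s) phi (nth z (a :: s) i) (nth z (a :: s) i.+1) = chain_sum phi a s.
Proof.
elim: s a => [a|x s IH a]; first by rewrite big_ord0.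
by rewrite big_ord_recl/= IH.
Qed.

Lemma chain_sum_cat phi a s t :
  chain_sum phi a (s ++ t) = chain_sum phi a s + chain_sum phi (last a s) t.
Proof. by elim: s a => [a|x s IH a]/=; rewrite ?add0r// IH addrA. Qed.

Lemma chain_sum_ge0 phi a s : (forall x y, 0 <= phi x y) -> 0 <= chain_sum phi a s.
Proof. by move=> p0; elim: s a => // x s IH a /=; rewrite addr_ge0. Qed.

Lemma le_chain_sum phi psi a s : (forall x y, phi x y <= psi x y) ->
  chain_sum phi a s <= chain_sum psi a s.
Proof. by move=> le; elim: s a => // x s IH a /=; rewrite lerD. Qed.

Lemma chain_sumD phi psi a s :
  chain_sum (fun x y => phi x y + psi x y) a s = chain_sum phi a s + chain_sum psi a s.
Proof. by elim: s a => [a|x s IH a] /=; rewrite ?addr0// IH addrACA. Qed.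

(** Inserting a point raises the sum, by the triangle inequality for [phi]. *)
Lemma chain_sum_subseq phi a s t : (forall x y, 0 <= phi x y) ->
  (forall x y z, phi x z <= phi x y + phi y z) ->
  subseq s t -> last a s = last a t -> chain_sum phi a s <= chain_sum phi a t.
Proof.
move=> p0 ptri; elim: t a s => [a s|y t IH a s].
  by rewrite subseq0 => /eqP ->.
case: s => [_ _|x s]; first exact: chain_sum_ge0.
rewrite [subseq _ _]/=; case: ifP => [/eqP ->|_] st lst.
  by rewrite /= lerD2l IH.
rewrite [leRHS]/=; apply: (@le_trans _ _ (phi a y + chain_sum phi y (x :: s))).
  by rewrite /= addrA lerD2r.
by rewrite lerD2l IH.
Qed.

Lemma grid_seq1 (a b : R) : a <= b -> grid a b [:: b].
Proof. by move=> ab; rewrite /grid /= ab eqxx. Qed.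

Lemma grid_cat (a b c : R) s t : grid a b s -> grid b c t -> grid a c (s ++ t).
Proof.
by rewrite /grid cat_path last_cat => /andP[-> /eqP ->] /andP[-> ->].
Qed.

Lemma grid_le (a b : R) s : grid a b s -> a <= b.
Proof.
elim: s a => [a|x s IH a]; rewrite /grid/=; first by move=> /eqP ->.
by move=> /andP[/andP[ax px] l]; apply: (le_trans ax); apply: IH; rewrite /grid px.
Qed.

Lemma grid_split (a b c : R) s : grid a c s -> a <= b -> b <= c ->
  exists s1 s2, [/\ grid a b s1, grid b c s2 & subseq s (s1 ++ s2)].
Proof.
elim: s a => [a /andP[_ /eqP/= <-] ab ba|x s IH a].
  by exists [::], [::]; rewrite /grid/=; split=> //; rewrite eq_le ab ba.
move=> /andP[/= /andP[ax px] l] ab bc; have [bx|xb] := leP b x.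
  exists [:: b], (x :: s); split; [exact: grid_seq1|by rewrite /grid/= bx px|].
  exact: subseq_cons.
have [|s1 [s2 [g1 g2 sub]]] := IH x _ (ltW xb) bc; first by rewrite /grid px.
exists (x :: s1), s2; split=> //; last by rewrite /= eqxx.
by move: g1; rewrite /grid/= ax.
Qed.

Lemma grid_refine (a b : R) s t : grid a b s -> grid a b t ->
  exists u, [/\ grid a b u, subseq s u & subseq t u].
Proof.
elim: s a t => [a t _ gt|x s IH a t]; first by exists t; split=> //; exact: sub0seq.
move=> /andP[/= /andP[ax px] l] gt; have gs : grid x b s by rewrite /grid px.
have [t1 [t2 [g1 g2 sub]]] := grid_split gt ax (grid_le gs).
have [u [gu su tu]] := IH x t2 gs g2.
(* The piece [t1] already leads to [x]; repeating [x] is harmless in a weakly increasing grid and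
   makes [x :: s] a subsequence. *)
exists (t1 ++ x :: u); split.
- by apply: (grid_cat g1); move: gu; rewrite /grid/= lexx.
- by rewrite -[x :: s]cat0s; apply: cat_subseq; rewrite ?sub0seq//= eqxx.
- apply: (subseq_trans sub); apply: cat_subseq => //.
  exact: subseq_trans tu (subseq_cons _ _).
Qed.

(** Leading copies of [a] in a weakly increasing grid contribute nothing, as [phi a a = 0]. The
    strict [a < x] leaves room for a new point to the right of [a]. *)
Lemma grid_head phi (a c : R) s : (forall x y, 0 <= phi x y) ->
  phi a a = 0 -> a < c -> grid a c s ->
  exists x t, [/\ a < x, grid x c t & chain_sum phi a s = phi a x + chain_sum phi x t].
Proof.
move=> p0 paa ac; elim: s => [/andP[_ /= /eqP eac]|x s IH].
  by rewrite eac ltxx in ac.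
move=> /andP[/= /andP[]]; rewrite le_eqVlt => /predU1P[<-|ax] px l.
  by rewrite paa add0r; apply: IH; rewrite /grid px.
by exists x, s; split=> //; rewrite /grid px.
Qed.

End chain_sums.

(** * The variation of a function on a rectangle *)

Section variation2.
Context {R : realType}.
Implicit Types (tau : R -> R -> R) (s t : seq R).

Lemma increment2_tr tau a1 a2 b1 b2 :
  increment2 (fun x y => tau y x) b1 b2 a1 a2 = increment2 tau a1 a2 b1 b2.
Proof. by rewrite /increment2; ring. Qed.

Lemma grid_variation_tr tau a1 b1 s t :
  grid_variation (fun x y => tau y x) b1 a1 t s = grid_variation tau a1 b1 s t.
Proof.
rewrite /grid_variation exchange_big; apply: eq_bigr => i _.
by apply: eq_bigr => j _; rewrite increment2_tr.
Qed.

Lemma variation2_tr tau a1 a2 b1 b2 :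
  variation2 (fun x y => tau y x) b1 b2 a1 a2 = variation2 tau a1 a2 b1 b2.
Proof.
congr ereal_sup; apply/seteqP; split=> v [s [t [gs gt ->]]]; exists t, s; split=> //.
  by rewrite -grid_variation_tr.
by rewrite grid_variation_tr.
Qed.

(** For fixed ordinates this function of two abscissas satisfies the triangle inequality, and the
    planar grid variation is its sum along the abscissas. Two-dimensional statements thus reduce to
    chains on the line. *)
Definition strip_variation tau b1 t (x x' : R) : R :=
  chain_sum (fun y y' => `|increment2 tau x x' y y'|) b1 t.

Lemma grid_variationE tau a1 b1 s t :
  grid_variation tau a1 b1 s t = chain_sum (strip_variation tau b1 t) a1 s.
Proof.
rewrite -(chain_sumE _ a1); apply: eq_bigr => i _.
by rewrite /strip_variation -(chain_sumE _ b1).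
Qed.

Lemma strip_variation_ge0 tau b1 t x x' : 0 <= strip_variation tau b1 t x x'.
Proof. exact: chain_sum_ge0. Qed.

Lemma strip_variation_triangle tau b1 t x y z :
  strip_variation tau b1 t x z <=
  strip_variation tau b1 t x y + strip_variation tau b1 t y z.
Proof.
rewrite -chain_sumD; apply: le_chain_sum => u v.
rewrite (le_trans _ (ler_normD _ _))// le_eqVlt; apply/orP; left; apply/eqP.
by congr `|_|; rewrite /increment2; ring.
Qed.

Lemma strip_variationxx tau b1 t x : strip_variation tau b1 t x x = 0.
Proof.
rewrite /strip_variation; elim: t b1 => //= y t IH b1; rewrite IH addr0.
by apply/normr0P; rewrite /increment2; apply/eqP; ring.
Qed.

Lemma grid_variation_cat tau (a a' b1 : R) s s' t : grid a a' s ->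
  grid_variation tau a b1 (s ++ s') t =
  grid_variation tau a b1 s t + grid_variation tau a' b1 s' t.
Proof. by move=> /andP[_ /eqP l]; rewrite !grid_variationE chain_sum_cat l. Qed.

Lemma grid_variation_subseq1 tau (a1 a2 b1 : R) s s' t :
  grid a1 a2 s -> grid a1 a2 s' -> subseq s s' ->
  grid_variation tau a1 b1 s t <= grid_variation tau a1 b1 s' t.
Proof.
move=> /andP[_ /eqP ls] /andP[_ /eqP ls'] ss; rewrite !grid_variationE.
apply: chain_sum_subseq; rewrite ?ls ?ls'//; first exact: strip_variation_ge0.
exact: strip_variation_triangle.
Qed.

Lemma grid_variation_subseq2 tau (a1 b1 b2 : R) s t t' :
  grid b1 b2 t -> grid b1 b2 t' -> subseq t t' ->
  grid_variation tau a1 b1 s t <= grid_variation tau a1 b1 s t'.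
Proof.
by move=> gt gt' tt'; rewrite -!(grid_variation_tr tau); exact: grid_variation_subseq1 gt gt' tt'.
Qed.

Lemma locally_BV2_tr tau : locally_BV2 tau -> locally_BV2 (fun x y => tau y x).
Proof. by move=> bv b1 b2 a1 a2 b12 a12; rewrite variation2_tr bv. Qed.

Context tau (bv : locally_BV2 tau).

Lemma variation2_ge_increment a1 a2 b1 b2 : a1 <= a2 -> b1 <= b2 ->
  (`|increment2 tau a1 a2 b1 b2|%:E <= variation2 tau a1 a2 b1 b2)%E.
Proof.
move=> a12 b12; apply: ereal_sup_ubound; exists [:: a2], [:: b2].
split; [exact: grid_seq1|exact: grid_seq1|].
by rewrite grid_variationE /= /strip_variation/= !addr0.
Qed.

Lemma variation2_fin a1 a2 b1 b2 : a1 <= a2 -> b1 <= b2 ->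
  variation2 tau a1 a2 b1 b2 = (fine (variation2 tau a1 a2 b1 b2))%:E.
Proof.
move=> a12 b12; rewrite fineK// ge0_fin_numE ?bv//.
by apply: le_trans (variation2_ge_increment a12 b12); rewrite lee_fin.
Qed.

Local Notation v a1 a2 b1 b2 := (fine (variation2 tau a1 a2 b1 b2)).

Lemma grid_variation_le a1 a2 b1 b2 s t : grid a1 a2 s -> grid b1 b2 t ->
  grid_variation tau a1 b1 s t <= v a1 a2 b1 b2.
Proof.
move=> gs gt; rewrite -lee_fin -variation2_fin ?(grid_le gs) ?(grid_le gt)//.
by apply: ereal_sup_ubound; exists s, t.
Qed.

Lemma variation2_le a1 a2 b1 b2 (c : R) : a1 <= a2 -> b1 <= b2 ->
  (forall s t, grid a1 a2 s -> grid b1 b2 t -> grid_variation tau a1 b1 s t <= c) ->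
  v a1 a2 b1 b2 <= c.
Proof.
move=> a12 b12 h; rewrite -lee_fin -variation2_fin//.
by apply: ge_ereal_sup => _ [s [t [gs gt ->]]]; rewrite lee_fin h.
Qed.

(** For one inequality the abscissa [a2] is inserted into a grid. For the other, grids on the two
    halves can be concatenated only when they share their ordinates, so these are first replaced by
    a common refinement. *)
Lemma variation2D a1 a2 a3 b1 b2 : a1 <= a2 -> a2 <= a3 -> b1 <= b2 ->
  v a1 a3 b1 b2 = v a1 a2 b1 b2 + v a2 a3 b1 b2.
Proof.
move=> a12 a23 b12; apply/eqP; rewrite eq_le; apply/andP; split.
  apply: variation2_le => // [|s t gs gt]; first exact: le_trans a23.
  have [s1 [s2 [g1 g2 sub]]] := grid_split gs a12 a23.
  apply: (le_trans (grid_variation_subseq1 _ _ _ gs (grid_cat g1 g2) sub)).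
  by rewrite (grid_variation_cat _ _ _ _ g1) lerD// grid_variation_le.
rewrite -lerBrDr; apply: variation2_le => // s1 t1 gs1 gt1.
rewrite lerBrDr -lerBrDl; apply: variation2_le => // s2 t2 gs2 gt2.
have [t [gt st1 st2]] := grid_refine gt1 gt2.
rewrite lerBrDr addrC; apply: le_trans (grid_variation_le (grid_cat gs1 gs2) gt).
rewrite (grid_variation_cat _ _ _ _ gs1).
apply: lerD; [exact: grid_variation_subseq2 gt1 gt st1|exact: grid_variation_subseq2 gt2 gt st2].
Qed.

(** Only finitely many ordinates occur, and each increment over the strip is a difference of two
    increments of sections of [tau]. Each section gets [e / 4] in the first cell, and the remaining
    cells get [e / 2]. *)
Lemma strip_variation_rc (a b1 : R) t e : (forall y, right_continuous (tau ^~ y)) ->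
  0 < e -> exists2 d0, 0 < d0 & forall d, 0 <= d -> d <= d0 ->
    strip_variation tau b1 t a (a + d) <= e.
Proof.
move=> rc; elim: t b1 e => [b1 e e0|y t IH b1 e e0].
  by exists 1 => // d _ _; exact: ltW.
have e20 : 0 < e / 2 by rewrite divr_gt0.
have e40 : 0 < e / 4 by rewrite divr_gt0.
have rcd z : exists2 d0, 0 < d0 & forall d, 0 <= d -> d <= d0 ->
    `|tau (a + d) z - tau a z| <= e / 4.
  have /cvgrPdist_le/(_ _ e40) := rc z a; rewrite nearE => -[r /= r0 hr].
  exists (r / 2); first exact: divr_gt0.
  move=> d; rewrite le_eqVlt => /predU1P[<-|d0] dr.
    by rewrite addr0 subrr normr0 ltW.
  rewrite distrC; apply: hr => /=; last by rewrite ltrDl.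
  rewrite opprD addNKr normrN gtr0_norm// (le_lt_trans dr)// ltr_pdivrMr//.
  by rewrite ltr_pMr// ltrDl.
have [d1 d10 h1] := rcd b1; have [d2 d20 h2] := rcd y; have [d3 d30 h3] := IH y _ e20.
exists (Num.min (Num.min d1 d2) d3); first by rewrite !lt_min d10 d20.
move=> d d0; rewrite !le_min => /andP[/andP[dd1 dd2] dd3].
rewrite /strip_variation/= [leRHS]splitr lerD ?h3//.
have -> : increment2 tau a (a + d) b1 y = (tau (a + d) y - tau a y) - (tau (a + d) b1 - tau a b1).
  by rewrite /increment2; ring.
rewrite (le_trans (ler_normB _ _))// (_ : e / 2 = e / 4 + e / 4) ?lerD ?h1 ?h2//.
by field.
Qed.

Lemma variation2_rc (a b1 b2 e : R) : (forall y, right_continuous (tau ^~ y)) ->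
  b1 <= b2 -> 0 < e -> exists2 d0, 0 < d0 & forall d, 0 <= d -> d <= d0 ->
    v a (a + d) b1 b2 <= e.
Proof.
move=> rc b12 e0; have e20 : 0 < e / 2 by rewrite divr_gt0.
(* On a nearly optimal grid of [a, a + 1], replacing the first abscissa x by a + d changes the
   sum by at most the strip over (a, a + d], so the variation over that strip is not larger
   than the defect of the grid plus a term controlled by the right-continuity of tau. *)
have aa1 : a < a + 1 by rewrite ltrDl.
have [s [t [gs gt hst]]] : exists s t, [/\ grid a (a + 1) s, grid b1 b2 t &
    v a (a + 1) b1 b2 - e / 2 < grid_variation tau a b1 s t].
  apply: contrapT => h; suff : v a (a + 1) b1 b2 <= v a (a + 1) b1 b2 - e / 2.
    by rewrite lerBrDr gerDl leNgt e20.
  apply: variation2_le => //; first exact: ltW.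
  by move=> s t gs gt; rewrite leNgt; apply/negP => hst; apply: h; exists s, t.
have [x [s' [ax gs' hs]]] := grid_head (strip_variation_ge0 tau b1 t)
  (strip_variationxx _ _ _ _) aa1 gs.
have [d1 d10 h1] := strip_variation_rc a b1 t rc e20.
exists (Num.min d1 (x - a)); first by rewrite lt_min d10 subr_gt0.
move=> d d0; rewrite le_min => /andP[dd1]; rewrite lerBrDl => adx.
have ad : a <= a + d by rewrite lerDl.
have gx : grid (a + d) (a + 1) (x :: s') by move: gs'; rewrite /grid/= adx.
have := variation2D ad (grid_le gx) b12.
have := grid_variation_le gx gt; rewrite grid_variationE/=.
move: hst; rewrite grid_variationE hs.
have := strip_variation_triangle tau b1 t a (a + d) x.
have := h1 _ d0 dd1; lra.
Qed.

End variation2.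

(** * Jordan measures in the plane *)

Section stieltjes2.
Context {R : realType}.
Implicit Types tau : R -> R -> R.

Lemma upper_right_continuous_tr tau :
  upper_right_continuous tau -> upper_right_continuous (fun x y => tau y x).
Proof.
move=> rc [a b] /= A /(rc (b, a)); rewrite /= !near_simpl.
rewrite !nearE => -[[U V] /= [hU hV] UV].
exists (V, U) => // -[x y] /= [Vx Uy] [ax bx].
by apply: (UV (y, x)).
Qed.

Lemma upper_right_continuous1 tau : upper_right_continuous tau ->
  forall y, right_continuous (tau ^~ y).
Proof.
move=> rc y a A /(rc (a, y)); rewrite /= !near_simpl.
rewrite !nearE => -[[U V] /= [hU hV] UV].
apply: filterS hU => x Ux ax; apply: (UV (x, y)); last by split=> //=; exact: ltW.
by split=> //; exact: nbhs_singleton.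
Qed.

(* e = 1 gives the positive variation on rectangles, e = -1 the negative one. *)
Definition jordan2 (e : R) tau a1 a2 b1 b2 : R :=
  (fine (variation2 tau a1 a2 b1 b2) + e * increment2 tau a1 a2 b1 b2) / 2.

Lemma jordan2_tr e tau a1 a2 b1 b2 :
  jordan2 e (fun x y => tau y x) b1 b2 a1 a2 = jordan2 e tau a1 a2 b1 b2.
Proof. by rewrite /jordan2 variation2_tr increment2_tr. Qed.

Lemma jordan2D e tau a1 a2 a3 b1 b2 : locally_BV2 tau ->
  a1 <= a2 -> a2 <= a3 -> b1 <= b2 ->
  jordan2 e tau a1 a3 b1 b2 = jordan2 e tau a1 a2 b1 b2 + jordan2 e tau a2 a3 b1 b2.
Proof.
move=> bv a12 a23 b12; rewrite /jordan2 (variation2D bv a12 a23 b12).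
by rewrite /increment2; field.
Qed.

Lemma jordan2_le_variation e tau a1 a2 b1 b2 : `|e| <= 1 -> locally_BV2 tau ->
  a1 <= a2 -> b1 <= b2 ->
  0 <= jordan2 e tau a1 a2 b1 b2 <= fine (variation2 tau a1 a2 b1 b2).
Proof.
move=> e1 bv a12 b12; have := variation2_ge_increment tau a12 b12.
rewrite (variation2_fin bv)// lee_fin => h.
have : `|e * increment2 tau a1 a2 b1 b2| <= fine (variation2 tau a1 a2 b1 b2).
  by rewrite normrM (le_trans _ h)// ler_piMl.
by rewrite /jordan2 ler_norml => /andP[]; lra.
Qed.

(** The Jordan parts lie between 0 and the variation, so they inherit its smallness on thin strips.
    The second coordinate is reduced to the first by exchanging the arguments of [tau]. *)
Lemma jordan2_rect_additive e tau : `|e| <= 1 -> BV2loc_rc tau ->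
  rect_additive (jordan2 e tau).
Proof.
move=> e1 [rc bv]; have bv' := locally_BV2_tr bv.
have rc1 := upper_right_continuous1 rc.
have rc2 := upper_right_continuous1 (upper_right_continuous_tr rc).
have jrc t : locally_BV2 t -> (forall y, right_continuous (t ^~ y)) ->
    forall a b1 b2 r, b1 <= b2 -> 0 < r ->
    exists2 d, 0 < d & jordan2 e t a (a + d) b1 b2 <= r.
  move=> bt rct a b1 b2 r b12 r0; have [d d0 hd] := variation2_rc bt a rct b12 r0.
  have ad : a <= a + d by rewrite lerDl ltW.
  exists d => //; apply: le_trans (hd d (ltW d0) (lexx _)).
  by have /andP[] := jordan2_le_variation e1 bt ad b12.
split.
- by move=> a1 a2 b1 b2 a12 b12; have /andP[] := jordan2_le_variation e1 bv a12 b12.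
- by move=> a1 a2 a3 b1 b2; exact: jordan2D.
- by move=> a1 a2 b1 b2 b3 a12 b12 b23; rewrite -!(jordan2_tr e tau); exact: jordan2D.
- exact: jrc.
- move=> a1 a2 b r a12 r0; have [d d0 hd] := jrc _ bv' rc2 b a1 a2 r a12 r0.
  by exists d => //; rewrite -jordan2_tr.
Qed.

Lemma the_measureP d (T : measurableType d)
    (Pr : {measure set T -> \bar R} -> Prop) :
  (exists mu, Pr mu) -> Pr (the_measure Pr).
Proof. by move=> h; rewrite /the_measure; case: pselect => // h'; case: cid. Qed.

(** Existence of a measure with these values takes [the_measure] out of its default branch, after
    which its specification can be used. *)
Lemma stieltjes2_posE tau a1 a2 b1 b2 : BV2loc_rc tau -> a1 <= a2 -> b1 <= b2 ->
  stieltjes2_pos tau (`]a1, a2]%classic `*` `]b1, b2]%classic) =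
  (jordan2 1 tau a1 a2 b1 b2)%:E.
Proof.
move=> bv a12 b12; have e1 : `|1 : R| <= 1 by rewrite normr1.
have jE c1 c2 d1 d2 : c1 <= c2 -> d1 <= d2 -> (jordan2 1 tau c1 c2 d1 d2)%:E =
    ((variation2 tau c1 c2 d1 d2 + (increment2 tau c1 c2 d1 d2)%:E) * 2^-1%:E)%E.
  by move=> c12 d12; rewrite (variation2_fin bv.2)// -EFinD -EFinM /jordan2 mul1r.
have [mu muE] := rect_measure_exists (jordan2_rect_additive e1 bv).
have ex : exists mu : {measure set (measurableTypeR R * measurableTypeR R) -> \bar R},
    forall a1 a2 b1 b2 : R, a1 <= a2 -> b1 <= b2 ->
    mu (`]a1, a2]%classic `*` `]b1, b2]%classic) =
    ((variation2 tau a1 a2 b1 b2 + (increment2 tau a1 a2 b1 b2)%:E) * 2^-1%:E)%E.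
  by exists mu => c1 c2 d1 d2 c12 d12; rewrite muE// jE.
by rewrite jE//; exact: (the_measureP ex).
Qed.

Lemma stieltjes2_negE tau a1 a2 b1 b2 : BV2loc_rc tau -> a1 <= a2 -> b1 <= b2 ->
  stieltjes2_neg tau (`]a1, a2]%classic `*` `]b1, b2]%classic) =
  (jordan2 (-1) tau a1 a2 b1 b2)%:E.
Proof.
move=> bv a12 b12; have e1 : `|-1 : R| <= 1 by rewrite normrN normr1.
have jE c1 c2 d1 d2 : c1 <= c2 -> d1 <= d2 -> (jordan2 (-1) tau c1 c2 d1 d2)%:E =
    ((variation2 tau c1 c2 d1 d2 - (increment2 tau c1 c2 d1 d2)%:E) * 2^-1%:E)%E.
  by move=> c12 d12; rewrite (variation2_fin bv.2)// -EFinB -EFinM /jordan2 mulN1r.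
have [mu muE] := rect_measure_exists (jordan2_rect_additive e1 bv).
have ex : exists mu : {measure set (measurableTypeR R * measurableTypeR R) -> \bar R},
    forall a1 a2 b1 b2 : R, a1 <= a2 -> b1 <= b2 ->
    mu (`]a1, a2]%classic `*` `]b1, b2]%classic) =
    ((variation2 tau a1 a2 b1 b2 - (increment2 tau a1 a2 b1 b2)%:E) * 2^-1%:E)%E.
  by exists mu => c1 c2 d1 d2 c12 d12; rewrite muE// jE.
by rewrite jE//; exact: (the_measureP ex).
Qed.

Lemma jordan2B tau a1 a2 b1 b2 :
  jordan2 1 tau a1 a2 b1 b2 - jordan2 (-1) tau a1 a2 b1 b2 = increment2 tau a1 a2 b1 b2.
Proof. by rewrite /jordan2; field. Qed.

End stieltjes2.

(** * Jordan measures on the line *)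

Section stieltjes1.
Context {R : realType}.
Implicit Types psi : R -> R.

Definition jordan1 (e : R) psi a b : R :=
  (fine (total_variation a b psi) + e * (psi b - psi a)) / 2.

Lemma total_variation_fin psi a b : locally_BV psi -> a <= b ->
  total_variation a b psi = (fine (total_variation a b psi))%:E.
Proof. by move=> bv ab; rewrite fineK//; apply/bounded_variationP. Qed.

Lemma jordan1_le_variation e psi a b : `|e| <= 1 -> locally_BV psi -> a <= b ->
  0 <= jordan1 e psi a b <= fine (total_variation a b psi).
Proof.
move=> e1 bv ab; have := total_variation_ge psi ab.
rewrite (total_variation_fin bv)// lee_fin => h.
have : `|e * (psi b - psi a)| <= fine (total_variation a b psi).
  by rewrite normrM (le_trans _ h)// ler_piMl.
by rewrite /jordan1 ler_norml => /andP[]; lra.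
Qed.

(** The total variation inherits right-continuity from [psi] and dominates both Jordan parts. *)
Lemma jordan1_cumulative e psi : `|e| <= 1 -> BVloc_rc psi ->
  exists G : cumulative R R, forall a b, a <= b -> jordan1 e psi a b = G b - G a.
Proof.
move=> e1 [rc bv]; apply: interval_function_cumulative.
- by move=> a b ab; have /andP[] := jordan1_le_variation e1 bv ab.
- move=> a b c ab bc; rewrite /jordan1 (total_variationD _ ab bc).
  by rewrite fineD; [field|apply/bounded_variationP..].
- move=> a r r0; have aa1 : a < a + 1 by rewrite ltrDl.
  have := total_variation_right_continuous (lexx a) aa1 (rc a) (bv _ _).
  rewrite total_variationxx/= => /cvgrPdist_le/(_ _ r0)[d /= d0 hd].
  have d20 : 0 < d / 2 by rewrite divr_gt0.
  have ad : a <= a + d / 2 by rewrite lerDl ltW.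
  exists (d / 2) => //.
  have /andP[_ /le_trans] := jordan1_le_variation e1 bv ad; apply.
  have TV0 := fine_ge0 (total_variation_ge0 psi ad).
  have := hd (a + d / 2); rewrite /= sub0r normrN (ger0_norm TV0); apply.
    by rewrite opprD addNKr normrN gtr0_norm// ltr_pdivrMr// ltr_pMr// ltrDl.
  by rewrite ltrDl.
Qed.

Lemma stieltjes_posE psi a b : BVloc_rc psi -> a <= b ->
  stieltjes_pos psi `]a, b]%classic = (jordan1 1 psi a b)%:E.
Proof.
move=> bv ab; have e1 : `|1 : R| <= 1 by rewrite normr1.
have jE c d : c <= d -> (jordan1 1 psi c d)%:E = (pos_tv c psi d - pos_tv c psi c)%E.
  move=> cd; rewrite /pos_tv /neg_tv !total_variationN total_variationxx.
  rewrite (total_variation_fin bv.2)// -!(EFinN, EFinD, EFinM).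
  by congr EFin; rewrite /jordan1 /=; field.
have [G GE] := jordan1_cumulative e1 bv.
have ex : exists mu : {measure set (measurableTypeR R) -> \bar R},
    forall a b : R, a <= b ->
    mu `]a, b]%classic = (pos_tv a psi b - pos_tv a psi a)%E.
  exists (lebesgue_stieltjes_measure G) => c d cd.
  by rewrite -jE// GE//; exact: lebesgue_stieltjes_measure_itv.
by rewrite jE//; exact: (the_measureP ex).
Qed.

Lemma stieltjes_negE psi a b : BVloc_rc psi -> a <= b ->
  stieltjes_neg psi `]a, b]%classic = (jordan1 (-1) psi a b)%:E.
Proof.
move=> bv ab; have e1 : `|-1 : R| <= 1 by rewrite normrN normr1.
have jE c d : c <= d -> (jordan1 (-1) psi c d)%:E = (neg_tv c psi d - neg_tv c psi c)%E.
  move=> cd; rewrite /neg_tv total_variationxx.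
  rewrite (total_variation_fin bv.2)// -!(EFinN, EFinD, EFinM).
  by congr EFin; rewrite /jordan1 /=; field.
have [G GE] := jordan1_cumulative e1 bv.
have ex : exists mu : {measure set (measurableTypeR R) -> \bar R},
    forall a b : R, a <= b ->
    mu `]a, b]%classic = (neg_tv a psi b - neg_tv a psi a)%E.
  exists (lebesgue_stieltjes_measure G) => c d cd.
  by rewrite -jE// GE//; exact: lebesgue_stieltjes_measure_itv.
by rewrite jE//; exact: (the_measureP ex).
Qed.

Lemma jordan1B psi a b : jordan1 1 psi a b - jordan1 (-1) psi a b = psi b - psi a.
Proof. by rewrite /jordan1; field. Qed.

End stieltjes1.

(** * Integration by parts *)

Section fubini_sections.
Context {R : realType} d1 d2 (T1 : measurableType d1) (T2 : measurableType d2).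
Context (m1 : {sigma_finite_measure set T1 -> \bar R}).
Context (m2 : {sigma_finite_measure set T2 -> \bar R}).

(* Unlike in Fubini's theorem for a function, the measurability of the section measures f1 and f2
   is a conclusion. *)
Lemma fubini_sections (D1 : set T1) (D2 : set T2) (E : set (T1 * T2))
    (f1 : T1 -> R) (f2 : T2 -> R) :
  measurable D1 -> measurable D2 -> measurable E ->
  (m1 D1 < +oo)%E -> (m2 D2 < +oo)%E ->
  (forall x, D1 x -> m2 [set y | D2 y /\ E (x, y)] = (f1 x)%:E) ->
  (forall y, D2 y -> m1 [set x | D1 x /\ E (x, y)] = (f2 y)%:E) ->
  [/\ m1.-integrable D1 (EFin \o f1), m2.-integrable D2 (EFin \o f2) &
      \int[m1]_(x in D1) f1 x = \int[m2]_(y in D2) f2 y].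
Proof.
move=> mD1 mD2 mE D1oo D2oo f1E f2E.
pose E' := (D1 `*` D2) `&` E.
have mE' : measurable E' by apply: measurableI => //; exact: measurableX.
have xE x : D1 x -> m2 (xsection E' x) = (f1 x)%:E.
  move=> D1x; rewrite -f1E//; congr (m2 _); apply/seteqP; split=> y.
    by move=> /xsectionP[[/= _ ?] ?].
  by move=> [? ?]; apply/xsectionP; split.
have yE y : D2 y -> m1 (ysection E' y) = (f2 y)%:E.
  move=> D2y; rewrite -f2E//; congr (m1 _); apply/seteqP; split=> x.
    by move=> /ysectionP[[/= ? _] ?].
  by move=> [? ?]; apply/ysectionP; split.
have x0 x : ~ D1 x -> m2 (xsection E' x) = 0%E.
  move=> D1x; rewrite (_ : xsection E' x = set0) ?measure0//.
  by apply/seteqP; split=> // y /xsectionP[[]].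
have y0 y : ~ D2 y -> m1 (ysection E' y) = 0%E.
  move=> D2y; rewrite (_ : ysection E' y = set0) ?measure0//.
  by apply/seteqP; split=> // x /ysectionP[[]].
have F1 : (m2 \o xsection E') = (EFin \o f1) \_ D1.
  by apply/funext => x /=; rewrite patchE; case: ifPn => [/set_mem/xE|/negP D1x]//;
    apply: x0 => D1x'; apply: D1x; rewrite inE.
have F2 : (m1 \o ysection E') = (EFin \o f2) \_ D2.
  by apply/funext => y /=; rewrite patchE; case: ifPn => [/set_mem/yE|/negP D2y]//;
    apply: y0 => D2y'; apply: D2y; rewrite inE.
have int1 : m1.-integrable D1 (EFin \o f1).
  apply: (le_integrable mD1 (f := EFin \o f1) (g := cst (fine (m2 D2))%:E)).
  - apply: (iffRL (@measurable_restrictT d1 _ T1 (\bar R) D1 (EFin \o f1) mD1)).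
    by rewrite -F1; exact: measurable_fun_xsection.
  - move=> x D1x; rewrite [(EFin \o f1) x]/= -(xE x D1x) /cst fineK ?ge0_fin_numE// !gee0_abs//.
    apply: le_measure; rewrite ?inE//; first exact: measurable_xsection.
    by move=> y /xsectionP[[]].
  - apply/integrableP; split; first exact: measurable_cst.
    by under eq_integral do rewrite /=; rewrite integral_cst// lte_mul_pinfty.
have int2 : m2.-integrable D2 (EFin \o f2).
  apply: (le_integrable mD2 (f := EFin \o f2) (g := cst (fine (m1 D1))%:E)).
  - apply: (iffRL (@measurable_restrictT d2 _ T2 (\bar R) D2 (EFin \o f2) mD2)).
    by rewrite -F2; exact: measurable_fun_ysection.
  - move=> x D2x; rewrite [(EFin \o f2) x]/= -(yE x D2x) /cst fineK ?ge0_fin_numE// !gee0_abs//.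
    apply: le_measure; rewrite ?inE//; first exact: measurable_ysection.
    by move=> y /ysectionP[[]].
  - apply/integrableP; split; first exact: measurable_cst.
    by under eq_integral do rewrite /=; rewrite integral_cst// lte_mul_pinfty.
split=> //; rewrite /Rintegral; congr fine.
rewrite integral_mkcond -F1 [RHS]integral_mkcond -F2.
have := indic_fubini_tonelli m1 m2 mE'.
by rewrite (indic_fubini_tonelli_FE m2)// (indic_fubini_tonelli_GE m1).
Qed.

End fubini_sections.

Section left_limits.
Context {R : realType}.
Implicit Types G : cumulative R R.

Lemma left_limit_cvg (G : R -> R) (y : R) : {homo G : x x' / x <= x'} ->
  G x @[x --> y^'-] --> left_limit G y.
Proof.
move=> ndG; apply: nondecreasing_at_left_is_cvgr.
  by near=> a => u v _ _; exact: ndG.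
near=> a; exists (G y) => _ [x /= xay <-]; apply: ndG.
by move: xay; rewrite in_itv/= => /andP[_ /ltW].
Unshelve. all: by end_near. Qed.

(** Continuity from below along []a, u n]], with [u n] increasing to [y] from [u 0 = a]. Open right
    ends arise as sections of [{x < y}], and this is how left limits enter integration by parts. *)
Lemma lebesgue_stieltjes_measure_oo G (a y : R) : a < y ->
  lebesgue_stieltjes_measure G `]a, y[%classic = (left_limit G y - G a)%:E.
Proof.
move=> ay; pose u n : R := y - (y - a) / n.+1%:R.
have ya0 : 0 < y - a by rewrite subr_gt0.
have uy n : u n < y by rewrite /u ltrBlDr ltrDl divr_gt0.
have au n : a <= u n.
  by rewrite /u lerBrDr -lerBrDl ler_pdivrMr// ler_peMr ?ler1n// ltW.
have u_cvg : u n @[n --> \oo] --> y.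
  rewrite -[X in _ --> X]subr0 -[X in _ - X](mulr0 (y - a)).
  apply: cvgB; first exact: cvg_cst.
  by apply: cvgM; [exact: cvg_cst|exact: cvg_harmonic].
have ndu : nondecreasing_seq (fun n => `]a, u n]%classic).
  move=> m n mn; apply/subsetPset => x /=; rewrite !in_itv/= => /andP[-> /le_trans->]//.
  by rewrite lerB// ler_pM2l// lef_pV2 ?posrE// ler_nat.
have uE : \bigcup_n `]a, u n]%classic = `]a, y[%classic.
  apply/seteqP; split=> [x [n _]|x]; rewrite /= !in_itv/= => /andP[ax xu].
    by rewrite ax (le_lt_trans xu (uy n)).
  have : \forall n \near \oo, x < u n.
    by apply: (cvgr_gt y) => //.
  by move=> [n _ /(_ n (leqnn _))/= /ltW xn]; exists n => //; rewrite /= in_itv/= ax.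
have := @nondecreasing_cvg_mu _ _ _ (lebesgue_stieltjes_measure G) _
  (fun n => measurable_itv _) (bigcup_measurable (fun n _ => measurable_itv _)) ndu.
rewrite uE => h1.
have h2 : (lebesgue_stieltjes_measure G \o (fun n => `]a, u n]%classic)) n @[n --> \oo]
    --> (left_limit G y - G a)%:E.
  rewrite (_ : _ \o _ = fun n => (G (u n) - G a)%:E); last first.
    by apply/funext => n /=; rewrite lebesgue_stieltjes_measure_itv.
  apply: cvg_EFin; first by near=> n.
  apply: cvgB; last exact: cvg_cst.
  have /cvg_at_leftP := left_limit_cvg (y := y) (cumulative_is_nondecreasing G).
  by apply.
exact: (cvg_unique _ h1 h2).
Unshelve. all: by end_near. Qed.

End left_limits.

(** The Jordan measures are given as bare measures; this copy carries the sigma-finiteness that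
    Fubini's theorem asks for. *)
Definition with_sigma_finite {R : realType} d (T : measurableType d)
  (mu : {measure set T -> \bar R}) of sigma_finite setT mu : set T -> \bar R := mu.

HB.instance Definition _ (R : realType) d (T : measurableType d)
    (mu : {measure set T -> \bar R}) (h : sigma_finite setT mu) :=
  Measure.copy (with_sigma_finite h) mu.
HB.instance Definition _ (R : realType) d (T : measurableType d)
    (mu : {measure set T -> \bar R}) (h : sigma_finite setT mu) :=
  @Measure_isSigmaFinite.Build d T R (with_sigma_finite h) h.

(** * Fubini's theorem for [{x < y}] and Stieltjes measures *)

Section fubini_stieltjes.
Context {R : realType}.
Local Notation mR := (measurableTypeR R).
Local Notation LS := lebesgue_stieltjes_measure.

Lemma fubini_sections_sigma_finite d1 d2 (T1 : measurableType d1) (T2 : measurableType d2)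
    (m1 : {measure set T1 -> \bar R}) (m2 : {measure set T2 -> \bar R})
    (D1 : set T1) (D2 : set T2) (E : set (T1 * T2))
    (f1 : T1 -> R) (f2 : T2 -> R) :
  sigma_finite setT m1 -> sigma_finite setT m2 ->
  measurable D1 -> measurable D2 -> measurable E ->
  (m1 D1 < +oo)%E -> (m2 D2 < +oo)%E ->
  (forall x, D1 x -> m2 [set y | D2 y /\ E (x, y)] = (f1 x)%:E) ->
  (forall y, D2 y -> m1 [set x | D1 x /\ E (x, y)] = (f2 y)%:E) ->
  [/\ m1.-integrable D1 (EFin \o f1), m2.-integrable D2 (EFin \o f2) &
      \int[m1]_(x in D1) f1 x = \int[m2]_(y in D2) f2 y].
Proof.
move=> s1 s2.
exact: (@fubini_sections R _ _ T1 T2 (with_sigma_finite s1) (with_sigma_finite s2)).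
Qed.

Lemma sigma_finite_itv (mu : {measure set mR -> \bar R}) :
  (forall a b : R, a <= b -> (mu `]a, b]%classic < +oo)%E) -> sigma_finite setT mu.
Proof.
move=> muoo; exists (fun k => `]- k%:R, k%:R]%classic).
  by rewrite (bigcup_itvT false false).
move=> k; split; first exact: measurable_itv.
by apply: muoo; exact: lerN_natr.
Qed.

Lemma sigma_finite_rect (mu : {measure set (mR * mR) -> \bar R}) :
  (forall p q, p.1 <= q.1 -> p.2 <= q.2 -> (mu (rect p q) < +oo)%E) ->
  sigma_finite setT mu.
Proof.
move=> muoo; exists (fun k => rect (- k%:R, - k%:R) (k%:R, k%:R)).
  by rewrite bigcup_rect.
move=> k; split; first exact: measurable_rect.
by apply: muoo; exact: lerN_natr.
Qed.

Lemma measurable_set_lt d (T : measurableType d) (f g : T -> R) :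
  measurable_fun setT f -> measurable_fun setT g -> measurable [set x | f x < g x].
Proof.
move=> mf mg; have := measurable_fun_ltr mf mg; move=> /(_ measurableT [set true] _).
by rewrite setTI; apply.
Qed.

Context (G K : cumulative R R).
Local Notation Gl := (left_limit G).
Local Notation Kl := (left_limit K).

Let LSfin (H : cumulative R R) (a b : R) : a <= b -> (LS H `]a, b]%classic < +oo)%E.
Proof. by move=> ab; rewrite lebesgue_stieltjes_measure_itv// ltry. Qed.

Lemma lebesgue_stieltjes_prod_rect (a1 a2 b1 b2 : R) : a1 <= a2 -> b1 <= b2 ->
  (LS G \x LS K)%E (rect (a1, b1) (a2, b2)) = ((G a2 - G a1) * (K b2 - K b1))%:E.
Proof.
move=> a12 b12; rewrite product_measure1E//=; [|exact: measurable_itv..].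
by rewrite !lebesgue_stieltjes_measure_itv.
Qed.

Lemma lebesgue_stieltjes_prod_fin (a1 a2 b1 b2 : R) : a1 <= a2 -> b1 <= b2 ->
  ((LS G \x LS K)%E (rect (a1, b1) (a2, b2)) < +oo)%E.
Proof. by move=> a12 b12; rewrite lebesgue_stieltjes_prod_rect// ltry. Qed.

Lemma sigma_finite_lebesgue_stieltjes_prod : sigma_finite setT (LS G \x LS K)%E.
Proof.
apply: sigma_finite_rect => -[a1 b1] [a2 b2] /= a12 b12.
by rewrite lebesgue_stieltjes_prod_rect// ltry.
Qed.

Section dim1.
Context (p : {measure set mR -> \bar R}) (Pf : R -> R -> R).
Hypothesis pE : forall c d : R, c <= d -> p `]c, d]%classic = (Pf c d)%:E.

(** Both integrals are the product mass of the triangle [a < x < y <= b]: the section at [x] is []x,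
    b]], the section at [y] is []a, y[]. *)
Lemma fubini_stieltjes1 a b : a <= b ->
  [/\ (LS G).-integrable `]a, b]%classic (EFin \o Pf ^~ b),
      p.-integrable `]a, b]%classic (EFin \o (fun y => Gl y - G a)) &
      \int[LS G]_(x in `]a, b]) Pf x b = \int[p]_(y in `]a, b]) (Gl y - G a)].
Proof.
move=> ab; apply: (@fubini_sections_sigma_finite _ _ mR mR (LS G) p _ _
  [set w | w.1 < w.2] (Pf ^~ b) (fun y => Gl y - G a)).
- by apply: sigma_finite_itv => c d cd; exact: LSfin.
- by apply: sigma_finite_itv => c d cd; rewrite pE// ltry.
- exact: measurable_itv.
- exact: measurable_itv.
- by apply: measurable_set_lt.
- exact: LSfin.
- by rewrite pE// ltry.
- move=> x; rewrite /= in_itv/= => /andP[ax xb]; rewrite -pE//; congr (p _).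
  apply/seteqP; split=> y /=; rewrite !in_itv/=.
    by move=> [/andP[_ ->] ->].
  by move=> /andP[xy ->]; rewrite (lt_trans ax xy).
- move=> y; rewrite /= in_itv/= => /andP[ay yb].
  rewrite -lebesgue_stieltjes_measure_oo//; congr (LS G _).
  apply/seteqP; split=> x /=; rewrite !in_itv/=.
    by move=> [/andP[-> _] ->].
  by move=> /andP[-> xy]; rewrite xy (le_trans (ltW xy)).
Qed.

End dim1.

Lemma measurable_set_lt1 d (T : measurableType d) (f g : T -> mR) :
  measurable_fun setT f -> measurable_fun setT g ->
  measurable [set x | (f x : R) < (g x : R)].
Proof. exact: measurable_set_lt. Qed.

(** Only the first coordinate is compared with [y]; the second runs freely and contributes the
    factor [K b2 - K b1]. This integrates a function of one coordinate against the product
    measure. *)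
Lemma fubini_stieltjes_side1 (q : {measure set mR -> \bar R}) (Qf : R -> R -> R)
    (a1 a2 b1 b2 : R) : (forall c d : R, c <= d -> q `]c, d]%classic = (Qf c d)%:E) ->
  a1 <= a2 -> b1 <= b2 ->
  [/\ (LS G \x LS K)%E.-integrable (rect (a1, b1) (a2, b2)) (fun z => (Qf z.1 a2)%:E),
      q.-integrable `]a1, a2]%classic (fun y => ((Gl y - G a1) * (K b2 - K b1))%:E) &
      \int[(LS G \x LS K)%E]_(z in rect (a1, b1) (a2, b2)) Qf z.1 a2 =
      \int[q]_(y in `]a1, a2]) ((Gl y - G a1) * (K b2 - K b1))].
Proof.
move=> qE a12 b12.
apply: (@fubini_sections_sigma_finite _ _ (mR * mR)%type mR (LS G \x LS K)%E q
  (rect (a1, b1) (a2, b2)) `]a1, a2]%classic [set w | (w.1.1 : R) < w.2]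
  (fun z => Qf z.1 a2) (fun y => (Gl y - G a1) * (K b2 - K b1))).
- exact: sigma_finite_lebesgue_stieltjes_prod.
- by apply: sigma_finite_itv => c d cd; rewrite qE// ltry.
- exact: measurable_rect.
- exact: measurable_itv.
- apply: measurable_set_lt1 => //; exact: measurableT_comp measurable_fst measurable_fst.
- exact: lebesgue_stieltjes_prod_fin.
- by rewrite qE// ltry.
- move=> [x x']; rewrite /rect /= !in_itv/= => -[/andP[ax xa] _]; rewrite -qE//; congr (q _).
  apply/seteqP; split=> y /=; rewrite !in_itv/=.
    by move=> [/andP[_ ->] ->].
  by move=> /andP[xy ->]; rewrite (lt_trans ax xy).
- move=> y; rewrite /= in_itv/= => /andP[ay ya].
  rewrite EFinM -lebesgue_stieltjes_measure_oo// -(lebesgue_stieltjes_measure_itv K b12).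
  rewrite -product_measure1E; [|exact: measurable_itv..]; congr ((LS G \x LS K)%E _).
  apply/seteqP; split=> -[x x'] /=; rewrite /rect /= !in_itv/=.
    by move=> [[/andP[-> _] ->] ->].
  by move=> [/andP[-> xy] ->]; rewrite xy (le_trans (ltW xy)).
Qed.

Lemma fubini_stieltjes_side2 (q : {measure set mR -> \bar R}) (Qf : R -> R -> R)
    (a1 a2 b1 b2 : R) : (forall c d : R, c <= d -> q `]c, d]%classic = (Qf c d)%:E) ->
  a1 <= a2 -> b1 <= b2 ->
  [/\ (LS G \x LS K)%E.-integrable (rect (a1, b1) (a2, b2)) (fun z => (Qf z.2 b2)%:E),
      q.-integrable `]b1, b2]%classic (fun y => ((G a2 - G a1) * (Kl y - K b1))%:E) &
      \int[(LS G \x LS K)%E]_(z in rect (a1, b1) (a2, b2)) Qf z.2 b2 =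
      \int[q]_(y in `]b1, b2]) ((G a2 - G a1) * (Kl y - K b1))].
Proof.
move=> qE a12 b12.
apply: (@fubini_sections_sigma_finite _ _ (mR * mR)%type mR (LS G \x LS K)%E q
  (rect (a1, b1) (a2, b2)) `]b1, b2]%classic [set w | (w.1.2 : R) < w.2]
  (fun z => Qf z.2 b2) (fun y => (G a2 - G a1) * (Kl y - K b1))).
- exact: sigma_finite_lebesgue_stieltjes_prod.
- by apply: sigma_finite_itv => c d cd; rewrite qE// ltry.
- exact: measurable_rect.
- exact: measurable_itv.
- apply: measurable_set_lt1 => //; exact: measurableT_comp measurable_snd measurable_fst.
- exact: lebesgue_stieltjes_prod_fin.
- by rewrite qE// ltry.
- move=> [x' x]; rewrite /rect /= !in_itv/= => -[_ /andP[ax xa]]; rewrite -qE//; congr (q _).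
  apply/seteqP; split=> y /=; rewrite !in_itv/=.
    by move=> [/andP[_ ->] ->].
  by move=> /andP[xy ->]; rewrite (lt_trans ax xy).
- move=> y; rewrite /= in_itv/= => /andP[ay ya].
  rewrite EFinM -lebesgue_stieltjes_measure_oo// -(lebesgue_stieltjes_measure_itv G a12).
  rewrite -product_measure1E; [|exact: measurable_itv..]; congr ((LS G \x LS K)%E _).
  apply/seteqP; split=> -[x' x] /=; rewrite /rect /= !in_itv/=.
    by move=> [[-> /andP[-> _]] ->].
  by move=> [-> /andP[-> xy]]; rewrite xy (le_trans (ltW xy)).
Qed.

Section dim2.
Context (p : {measure set (mR * mR) -> \bar R}) (Pf : R -> R -> R -> R -> R).
Hypothesis pE : forall a1 a2 b1 b2 : R, a1 <= a2 -> b1 <= b2 ->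
  p (`]a1, a2]%classic `*` `]b1, b2]%classic) = (Pf a1 a2 b1 b2)%:E.

Let sigma_finite_p : sigma_finite setT p.
Proof. by apply: sigma_finite_rect => -[? ?] [? ?] /= ? ?; rewrite /rect pE// ltry. Qed.

Lemma fubini_stieltjes2 (a1 a2 b1 b2 : R) : a1 <= a2 -> b1 <= b2 ->
  [/\ (LS G \x LS K)%E.-integrable (rect (a1, b1) (a2, b2)) (fun z => (Pf z.1 a2 z.2 b2)%:E),
      p.-integrable (rect (a1, b1) (a2, b2)) (fun z => ((Gl z.1 - G a1) * (Kl z.2 - K b1))%:E) &
      \int[(LS G \x LS K)%E]_(z in rect (a1, b1) (a2, b2)) Pf z.1 a2 z.2 b2 =
      \int[p]_(z in rect (a1, b1) (a2, b2)) ((Gl z.1 - G a1) * (Kl z.2 - K b1))].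
Proof.
move=> a12 b12.
apply: (@fubini_sections_sigma_finite _ _ (mR * mR)%type (mR * mR)%type (LS G \x LS K)%E p
  (rect (a1, b1) (a2, b2)) (rect (a1, b1) (a2, b2))
  ([set w | (w.1.1 : R) < w.2.1] `&` [set w | (w.1.2 : R) < w.2.2])
  (fun z => Pf z.1 a2 z.2 b2) (fun z => (Gl z.1 - G a1) * (Kl z.2 - K b1))).
- exact: sigma_finite_lebesgue_stieltjes_prod.
- exact: sigma_finite_p.
- exact: measurable_rect.
- exact: measurable_rect.
- apply: measurableI; apply: measurable_set_lt1.
  + exact: measurableT_comp measurable_fst measurable_fst.
  + exact: measurableT_comp measurable_fst measurable_snd.
  + exact: measurableT_comp measurable_snd measurable_fst.
  + exact: measurableT_comp measurable_snd measurable_snd.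
- exact: lebesgue_stieltjes_prod_fin.
- by rewrite /rect pE// ltry.
- move=> [x x']; rewrite /rect /= !in_itv/= => -[/andP[ax xa] /andP[bx xb]].
  rewrite -pE//; congr (p _).
  apply/seteqP; split=> -[y y'] /=; rewrite !in_itv/=.
    by move=> [[/andP[_ ->] /andP[_ ->]] [-> ->]].
  by move=> [/andP[xy ->] /andP[xy' ->]]; rewrite (lt_trans ax xy) (lt_trans bx xy').
- move=> [y y']; rewrite /rect /= !in_itv/= => -[/andP[ay ya] /andP[by_ yb]].
  rewrite EFinM -!lebesgue_stieltjes_measure_oo//.
  rewrite -product_measure1E; [|exact: measurable_itv..]; congr ((LS G \x LS K)%E _).
  apply/seteqP; split=> -[x x'] /=; rewrite !in_itv/=.
    by move=> [[/andP[-> _] /andP[-> _]] [-> ->]].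
  move=> [/andP[-> xy] /andP[-> xy']].
  by rewrite xy xy' (le_trans (ltW xy))// (le_trans (ltW xy')).
Qed.

(** Here a measure on the line meets a planar measure through its first coordinate only. Such terms
    come from expanding [(Gl z.1 - G a1) * (Kl z.2 - K b1)]. *)
Lemma fubini_stieltjes2_fst (a1 a2 b1 b2 : R) : a1 <= a2 -> b1 <= b2 ->
  [/\ (LS G).-integrable `]a1, a2]%classic (fun x => (Pf x a2 b1 b2)%:E),
      p.-integrable (rect (a1, b1) (a2, b2)) (fun z => (Gl z.1 - G a1)%:E) &
      \int[LS G]_(x in `]a1, a2]) Pf x a2 b1 b2 =
      \int[p]_(z in rect (a1, b1) (a2, b2)) (Gl z.1 - G a1)].
Proof.
move=> a12 b12.
apply: (@fubini_sections_sigma_finite _ _ mR (mR * mR)%type (LS G) p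
  `]a1, a2]%classic (rect (a1, b1) (a2, b2)) [set w | (w.1 : R) < w.2.1]
  (fun x => Pf x a2 b1 b2) (fun z => Gl z.1 - G a1)).
- by apply: sigma_finite_itv => c d cd; exact: LSfin.
- exact: sigma_finite_p.
- exact: measurable_itv.
- exact: measurable_rect.
- apply: measurable_set_lt1 => //; exact: measurableT_comp measurable_fst measurable_snd.
- exact: LSfin.
- by rewrite /rect pE// ltry.
- move=> x; rewrite /rect /= !in_itv/= => /andP[ax xa].
  rewrite -pE//; congr (p _).
  apply/seteqP; split=> -[y y'] /=; rewrite !in_itv/=.
    by move=> [[/andP[_ ->] ->] ->].
  by move=> [/andP[xy ->] ->]; rewrite (lt_trans ax xy).
- move=> [y y']; rewrite /rect /= !in_itv/= => -[/andP[ay ya] _].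
  rewrite -lebesgue_stieltjes_measure_oo//; congr (LS G _).
  apply/seteqP; split=> x /=; rewrite !in_itv/=.
    by move=> [/andP[-> _] ->].
  by move=> /andP[-> xy]; rewrite xy (le_trans (ltW xy)).
Qed.

Lemma fubini_stieltjes2_snd (a1 a2 b1 b2 : R) : a1 <= a2 -> b1 <= b2 ->
  [/\ (LS K).-integrable `]b1, b2]%classic (fun x => (Pf a1 a2 x b2)%:E),
      p.-integrable (rect (a1, b1) (a2, b2)) (fun z => (Kl z.2 - K b1)%:E) &
      \int[LS K]_(x in `]b1, b2]) Pf a1 a2 x b2 =
      \int[p]_(z in rect (a1, b1) (a2, b2)) (Kl z.2 - K b1)].
Proof.
move=> a12 b12.
apply: (@fubini_sections_sigma_finite _ _ mR (mR * mR)%type (LS K) p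
  `]b1, b2]%classic (rect (a1, b1) (a2, b2)) [set w | (w.1 : R) < w.2.2]
  (fun x => Pf a1 a2 x b2) (fun z => Kl z.2 - K b1)).
- by apply: sigma_finite_itv => c d cd; exact: LSfin.
- exact: sigma_finite_p.
- exact: measurable_itv.
- exact: measurable_rect.
- apply: measurable_set_lt1 => //; exact: measurableT_comp measurable_snd measurable_snd.
- exact: LSfin.
- by rewrite /rect pE// ltry.
- move=> x; rewrite /rect /= !in_itv/= => /andP[ax xa].
  rewrite -pE//; congr (p _).
  apply/seteqP; split=> -[y' y] /=; rewrite !in_itv/=.
    by move=> [[-> /andP[_ ->]] ->].
  by move=> [-> /andP[xy ->]]; rewrite (lt_trans ax xy).
- move=> [y' y]; rewrite /rect /= !in_itv/= => -[_ /andP[ay ya]].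
  rewrite -lebesgue_stieltjes_measure_oo//; congr (LS K _).
  apply/seteqP; split=> x /=; rewrite !in_itv/=.
    by move=> [/andP[-> _] ->].
  by move=> /andP[-> xy]; rewrite xy (le_trans (ltW xy)).
Qed.

End dim2.

End fubini_stieltjes.

Section has_integral.
Context {R : realType} d (T : measurableType d).
Implicit Types (mu : {measure set T -> \bar R}) (D : set T) (f g : T -> R).

(** Integrability and value travel together, so that linear combinations of integrals need no
    separate side conditions. *)
Definition has_integral mu D f (v : R) :=
  mu.-integrable D (EFin \o f) /\ \int[mu]_(x in D) f x = v.

Lemma has_integral_unique mu D f v v' :
  has_integral mu D f v -> has_integral mu D f v' -> v = v'.
Proof. by move=> [_ <-] [_ <-]. Qed.

Lemma has_integral_integrable mu D f : mu.-integrable D (EFin \o f) ->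
  has_integral mu D f (\int[mu]_(x in D) f x).
Proof. by []. Qed.

Lemma has_integral_eq mu D f g v w : (forall x, D x -> f x = g x) -> v = w ->
  measurable D -> has_integral mu D f v -> has_integral mu D g w.
Proof.
move=> fg <- mD [intf <-]; split.
  by apply: eq_integrable intf => // x /set_mem Dx /=; rewrite fg.
by apply: eq_Rintegral => x /set_mem Dx; rewrite -fg.
Qed.

Lemma has_integralD mu D f g v w : measurable D ->
  has_integral mu D f v -> has_integral mu D g w ->
  has_integral mu D (fun x => f x + g x) (v + w).
Proof.
move=> mD [intf <-] [intg <-]; split; last by rewrite RintegralD.
by rewrite (_ : _ \o _ = (EFin \o f) \+ (EFin \o g))%E//; exact: integrableD.
Qed.

Lemma has_integralZ mu D f v c : measurable D ->
  has_integral mu D f v -> has_integral mu D (fun x => c * f x) (c * v).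
Proof.
move=> mD [intf <-]; split; last by rewrite RintegralZl.
by rewrite (_ : _ \o _ = (fun x => c%:E * (EFin \o f) x))%E//; exact: integrableZl.
Qed.

Lemma has_integralB mu D f g v w : measurable D ->
  has_integral mu D f v -> has_integral mu D g w ->
  has_integral mu D (fun x => f x - g x) (v - w).
Proof.
move=> mD hf hg; have := has_integralD mD hf (has_integralZ (-1) mD hg).
by apply: has_integral_eq => // [x _|]; rewrite mulN1r.
Qed.

Lemma has_integral_cst mu D c r : measurable D -> mu D = r%:E ->
  has_integral mu D (fun=> c) (c * r).
Proof.
move=> mD muD; split; last by rewrite Rintegral_cst// muD.
apply/integrableP; split; first exact: measurable_cst.
rewrite (eq_integral (cst `|c|%:E)) ?integral_cst// muD.
by rewrite -EFinM ltry.
Qed.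

End has_integral.

(** * Integration by parts on intervals and rectangles *)

Section integration_by_parts.
Context {R : realType}.
Local Notation mR := (measurableTypeR R).
Local Notation LS := lebesgue_stieltjes_measure.

Section dim1.
Context (G : cumulative R R) (psi : R -> R) (bv : BVloc_rc psi).
Local Notation Gl := (left_limit G).

Lemma stieltjes_parts a b : a <= b -> exists u1 u2,
  [/\ has_integral (stieltjes_pos psi) `]a, b]%classic (fun y => Gl y - G a) u1,
      has_integral (stieltjes_neg psi) `]a, b]%classic (fun y => Gl y - G a) u2 &
      has_integral (LS G) `]a, b]%classic (fun x => psi b - psi x) (u1 - u2)].
Proof.
move=> ab; have mI : measurable (`]a, b]%classic : set mR) by exact: measurable_itv.
have [i1 j1 e1] := fubini_stieltjes1 G (fun c d => stieltjes_posE bv) ab.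
have [i2 j2 e2] := fubini_stieltjes1 G (fun c d => stieltjes_negE bv) ab.
exists (\int[stieltjes_pos psi]_(y in `]a, b]) (Gl y - G a)).
exists (\int[stieltjes_neg psi]_(y in `]a, b]) (Gl y - G a)).
split => //.
have := has_integralB mI (conj i1 e1) (conj i2 e2).
by apply: has_integral_eq => // x _; exact: jordan1B.
Qed.

Lemma stieltjes_left_limit a b : a <= b -> exists u1 u2,
  [/\ has_integral (stieltjes_pos psi) `]a, b]%classic Gl u1,
      has_integral (stieltjes_neg psi) `]a, b]%classic Gl u2 &
      has_integral (LS G) `]a, b]%classic (fun x => psi b - psi x)
        (u1 - u2 - G a * (psi b - psi a))].
Proof.
move=> ab; have mI : measurable (`]a, b]%classic : set mR) by exact: measurable_itv.
have [u1 [u2 [h1 h2 h3]]] := stieltjes_parts ab.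
have k1 := has_integral_cst (G a) mI (stieltjes_posE bv ab).
have k2 := has_integral_cst (G a) mI (stieltjes_negE bv ab).
exists (u1 + G a * jordan1 1 psi a b), (u2 + G a * jordan1 (-1) psi a b); split.
- by apply: has_integral_eq (has_integralD mI h1 k1) => // x _; rewrite subrK.
- by apply: has_integral_eq (has_integralD mI h2 k2) => // x _; rewrite subrK.
- by apply: has_integral_eq h3 => //; rewrite -(jordan1B psi a b); ring.
Qed.

Lemma integration_by_parts1 a b : a <= b ->
  [/\ (stieltjes_pos psi).-integrable `]a, b]%classic (EFin \o Gl),
      (stieltjes_neg psi).-integrable `]a, b]%classic (EFin \o Gl) &
      has_integral (LS G) `]a, b]%classic psi
        (G b * psi b - G a * psi a - stieltjes_integral psi `]a, b]%classic Gl)].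
Proof.
move=> ab; have mI : measurable (`]a, b]%classic : set mR) by exact: measurable_itv.
have [u1 [u2 [[i1 h1] [i2 h2] h3]]] := stieltjes_left_limit ab.
split => //.
have := has_integralB mI
  (has_integral_cst (psi b) mI (lebesgue_stieltjes_measure_itv G ab)) h3.
apply: has_integral_eq => // [x _|]; first by ring.
by rewrite /stieltjes_integral h1 h2; ring.
Qed.

End dim1.

Section dim2.
Context (G K : cumulative R R) (g : R -> R -> R) (bv : BV2loc_rc g).
Context (bv1 : forall y, BVloc_rc (g ^~ y)) (bv2 : forall x, BVloc_rc (g x)).
Local Notation Gl := (left_limit G).
Local Notation Kl := (left_limit K).

Definition stieltjes2_integral_on (D : set (R * R)) (f : R * R -> R) : R :=
  \int[stieltjes2_pos g]_(z in D) f z - \int[stieltjes2_neg g]_(z in D) f z.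

Lemma integration_by_parts2 a1 a2 b1 b2 : a1 <= a2 -> b1 <= b2 ->
  let D := rect (a1, b1) (a2, b2) in
  let SA b := stieltjes_integral (g ^~ b) `]a1, a2]%classic Gl in
  let SB a := stieltjes_integral (g a) `]b1, b2]%classic Kl in
  [/\ (stieltjes2_pos g).-integrable D (fun z => (Gl z.1 * Kl z.2)%:E),
      (stieltjes2_neg g).-integrable D (fun z => (Gl z.1 * Kl z.2)%:E) &
      has_integral (LS G \x LS K)%E D (fun z => g z.1 z.2)
        (stieltjes2_integral_on D (fun z => Gl z.1 * Kl z.2)
         - (K b2 * SA b2 - K b1 * SA b1) - (G a2 * SB a2 - G a1 * SB a1)
         + (G a2 * K b2 * g a2 b2 - G a1 * K b2 * g a1 b2
            - G a2 * K b1 * g a2 b1 + G a1 * K b1 * g a1 b1))].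
Proof.
move=> a12 b12 D SA SB.
have mI1 : measurable (`]a1, a2]%classic : set mR) by exact: measurable_itv.
have mI2 : measurable (`]b1, b2]%classic : set mR) by exact: measurable_itv.
have mD : measurable (D : set (mR * mR)) by exact: measurable_rect.
pose pE := fun c1 c2 d1 d2 => @stieltjes2_posE R g c1 c2 d1 d2 bv.
pose nE := fun c1 c2 d1 d2 => @stieltjes2_negE R g c1 c2 d1 d2 bv.
have [w1i w1j w1e] := fubini_stieltjes2 G K pE a12 b12.
have [w2i w2j w2e] := fubini_stieltjes2 G K nE a12 b12.
have [u1i u1j u1e] := fubini_stieltjes2_fst G pE a12 b12.
have [u2i u2j u2e] := fubini_stieltjes2_fst G nE a12 b12.
have [t1i t1j t1e] := fubini_stieltjes2_snd K pE a12 b12.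
have [t2i t2j t2e] := fubini_stieltjes2_snd K nE a12 b12.
rewrite -/D in w1i w1j w1e w2i w2j w2e u1j u1e u2j u2e t1j t1e t2j t2e.
pose w (p : {measure set (mR * mR) -> \bar R}) :=
  \int[p]_(z in D) ((Gl z.1 - G a1) * (Kl z.2 - K b1)).
pose u (p : {measure set (mR * mR) -> \bar R}) := \int[p]_(z in D) (Gl z.1 - G a1).
pose t (p : {measure set (mR * mR) -> \bar R}) := \int[p]_(z in D) (Kl z.2 - K b1).
pose W := w (stieltjes2_pos g) - w (stieltjes2_neg g).
pose U := u (stieltjes2_pos g) - u (stieltjes2_neg g).
pose V := t (stieltjes2_pos g) - t (stieltjes2_neg g).
(* g = increment2 g _ a2 _ b2 - (g a2 b2 - g _ b2) - (g a2 b2 - g a2 _) + g a2 b2, where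
   the first three terms are masses of the region beyond the integration variable. *)
have hW : has_integral (LS G \x LS K)%E D (fun z => increment2 g z.1 a2 z.2 b2) W.
  have := has_integralB mD (conj w1i w1e) (conj w2i w2e).
  by apply: has_integral_eq => // z _; exact: jordan2B.
pose A b := SA b - G a1 * (g a2 b - g a1 b).
pose B a := SB a - K b1 * (g a b2 - g a b1).
have hA b : has_integral (LS G) `]a1, a2]%classic (fun x => g a2 b - g x b) (A b).
  by have [? [? [[_ e1] [_ e2] h]]] := stieltjes_left_limit G (bv1 b) a12;
    apply: has_integral_eq h => //; rewrite /A /SA /stieltjes_integral e1 e2.
have hB a : has_integral (LS K) `]b1, b2]%classic (fun x => g a b2 - g a x) (B a).
  by have [? [? [[_ e1] [_ e2] h]]] := stieltjes_left_limit K (bv2 a) b12;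
    apply: has_integral_eq h => //; rewrite /B /SB /stieltjes_integral e1 e2.
(* The integrand in [U] depends on the first coordinate only, so [dg] acts through its marginal over
   []b1, b2]], which is generated by the difference of the sections of [g] at [b2] and [b1]. *)
have UE : U = A b2 - A b1.
  have hU := has_integralB mI1 (conj u1i u1e) (conj u2i u2e).
  apply: (has_integral_unique hU).
  apply: has_integral_eq (has_integralB mI1 (hA b2) (hA b1)) => // x _.
  by rewrite jordan2B /increment2; ring.
have VE : V = B a2 - B a1.
  have hV := has_integralB mI2 (conj t1i t1e) (conj t2i t2e).
  apply: (has_integral_unique hV).
  apply: has_integral_eq (has_integralB mI2 (hB a2) (hB a1)) => // x _.
  by rewrite jordan2B /increment2; ring.
have hside1 : has_integral (LS G \x LS K)%E D (fun z => g a2 b2 - g z.1 b2)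
    ((K b2 - K b1) * A b2).
  have [s1 [s2 [h1 h2 h3]]] := stieltjes_parts G (bv1 b2) a12.
  have AE := has_integral_unique (hA b2) h3.
  have [i1 _ e1] := fubini_stieltjes_side1 G K (fun c d => stieltjes_posE (bv1 b2)) a12 b12.
  have [i2 _ e2] := fubini_stieltjes_side1 G K (fun c d => stieltjes_negE (bv1 b2)) a12 b12.
  have k1 := has_integralZ (K b2 - K b1) mI1 h1.
  have k2 := has_integralZ (K b2 - K b1) mI1 h2.
  have {}k1 := has_integral_eq (fun x _ => mulrC _ _) erefl mI1 k1.
  have {}k2 := has_integral_eq (fun x _ => mulrC _ _) erefl mI1 k2.
  have := has_integralB mD (conj i1 (etrans e1 k1.2)) (conj i2 (etrans e2 k2.2)).
  apply: has_integral_eq => // [z _|]; first exact: jordan1B.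
  by rewrite AE; ring.
have hside2 : has_integral (LS G \x LS K)%E D (fun z => g a2 b2 - g a2 z.2)
    ((G a2 - G a1) * B a2).
  have [s1 [s2 [h1 h2 h3]]] := stieltjes_parts K (bv2 a2) b12.
  have BE := has_integral_unique (hB a2) h3.
  have [i1 _ e1] := fubini_stieltjes_side2 G K (fun c d => stieltjes_posE (bv2 a2)) a12 b12.
  have [i2 _ e2] := fubini_stieltjes_side2 G K (fun c d => stieltjes_negE (bv2 a2)) a12 b12.
  have k1 := has_integralZ (G a2 - G a1) mI2 h1.
  have k2 := has_integralZ (G a2 - G a1) mI2 h2.
  have := has_integralB mD (conj i1 (etrans e1 k1.2)) (conj i2 (etrans e2 k2.2)).
  apply: has_integral_eq => // [z _|]; first exact: jordan1B.
  by rewrite BE; ring.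
have hcst c := has_integral_cst c mD (lebesgue_stieltjes_prod_rect G K a12 b12).
(* The products that Fubini's theorem yields are anchored at the lower corner; the anchors [G a1]
   and [K b1] are removed by expanding [((Gl - G a1) + G a1) * ((Kl - K b1) + K b1)]. *)
have expand (p : {measure set (mR * mR) -> \bar R}) (v : R) : p D = v%:E ->
    p.-integrable D (fun z => ((Gl z.1 - G a1) * (Kl z.2 - K b1))%:E) ->
    p.-integrable D (fun z => (Gl z.1 - G a1)%:E) ->
    p.-integrable D (fun z => (Kl z.2 - K b1)%:E) ->
    has_integral p D (fun z => Gl z.1 * Kl z.2)
      (w p + G a1 * t p + K b1 * u p + G a1 * K b1 * v).
  move=> pD pw pu pt.
  have := has_integralD mD (has_integralD mD (has_integralD mD (has_integral_integrable pw)
    (has_integralZ (G a1) mD (has_integral_integrable pt)))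
    (has_integralZ (K b1) mD (has_integral_integrable pu)))
    (has_integral_cst (G a1 * K b1) mD pD).
  by apply: has_integral_eq => // z _; ring.
have [i1 e1] := expand _ _ (pE _ _ _ _ a12 b12) w1j u1j t1j.
have [i2 e2] := expand _ _ (nE _ _ _ _ a12 b12) w2j u2j t2j.
split => //.
have := has_integralD mD (has_integralB mD (has_integralB mD hW hside1) hside2) (hcst (g a2 b2)).
apply: has_integral_eq => // [z _|]; first by rewrite /increment2; ring.
rewrite /stieltjes2_integral_on e1 e2.
have : jordan2 1 g a1 a2 b1 b2 = jordan2 (-1) g a1 a2 b1 b2 + increment2 g a1 a2 b1 b2.
  by rewrite -(jordan2B g a1 a2 b1 b2) addrC subrK.
move=> ->; have : w (stieltjes2_pos g) = W + w (stieltjes2_neg g) by rewrite /W subrK.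
move=> ->; have : u (stieltjes2_pos g) = A b2 - A b1 + u (stieltjes2_neg g).
  by rewrite -UE /U subrK.
move=> ->; have : t (stieltjes2_pos g) = B a2 - B a1 + t (stieltjes2_neg g).
  by rewrite -VE /V subrK.
by move=> ->; rewrite /A /B /increment2; ring.
Qed.

End dim2.

End integration_by_parts.

(** * Passage to the whole line and the whole plane *)

Section exhaustion.
Context {R : realType} d (T : measurableType d) (mu : {measure set T -> \bar R}).

Lemma cvg_Rintegral_exhaustion (f : T -> R) (D : nat -> set T) :
  (forall n, measurable (D n)) -> (forall x, \forall n \near \oo, D n x) ->
  mu.-integrable setT (EFin \o f) ->
  \int[mu]_(x in D n) f x @[n --> \oo] --> \int[mu]_x f x.
Proof.
move=> mD Dx intf; have mf := measurable_int mu intf.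
have [|||||_ _ h] := @dominated_convergence _ _ _ mu setT measurableT
  (fun n => (EFin \o f) \_ (D n)) (EFin \o f) (abse \o (EFin \o f)).
- move=> n; apply/(measurable_restrictT _ (mD n)).
  exact: measurable_funTS.
- exact: mf.
- apply/aeW => x _; have [n _ Dn] := Dx x.
  apply: cvg_near_cst; exists n => // k nk; rewrite /= patchE mem_set//.
  exact: Dn.
- exact: integrable_abse.
- apply/aeW => x n _; rewrite patchE; case: ifPn => //= _.
  by rewrite normr0 lee_fin.
apply: fine_cvg; rewrite fineK; last exact: integrable_fin_num.
by under eq_fun do rewrite integral_mkcond.
Qed.

End exhaustion.

Lemma cvgNr_idn {R : realType} : (- n%:R : R) @[n --> \oo] --> -oo.
Proof. exact: (iffRL (cvgNrNy (fun n => n%:R)) (@cvgr_idn R)). Qed.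

Section whole_line.
Context {R : realType}.
Local Notation mR := (measurableTypeR R).
Local Notation LS := lebesgue_stieltjes_measure.
Context (G F : cumulative R R).
Local Notation H := (fun x => G x - F x).
Local Notation Gl := (left_limit G).
Local Notation Fl := (left_limit F).
Local Notation Hl := (left_limit H).

Lemma left_limitB x : Hl x = Gl x - Fl x.
Proof.
apply/cvg_lim => //; apply: cvgB; apply: left_limit_cvg.
  exact: cumulative_is_nondecreasing.
exact: cumulative_is_nondecreasing.
Qed.

Lemma stieltjes_integral_left_limitB (psi : R -> R) (a b : R) : BVloc_rc psi -> a <= b ->
  stieltjes_integral psi `]a, b]%classic Hl =
  stieltjes_integral psi `]a, b]%classic Gl - stieltjes_integral psi `]a, b]%classic Fl.
Proof.
move=> bvp ab; have mD : measurable (`]a, b]%classic : set mR) by exact: measurable_itv.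
have [iG1 iG2 _] := integration_by_parts1 G bvp ab.
have [iF1 iF2 _] := integration_by_parts1 F bvp ab.
have L (p : {measure set mR -> \bar R}) : p.-integrable `]a, b]%classic (EFin \o Gl) ->
    p.-integrable `]a, b]%classic (EFin \o Fl) -> \int[p]_(x in `]a, b]) Hl x =
    \int[p]_(x in `]a, b]) Gl x - \int[p]_(x in `]a, b]) Fl x.
  by move=> iG' iF'; rewrite -RintegralB//; apply: eq_Rintegral => x _; exact: left_limitB.
rewrite /stieltjes_integral (L (stieltjes_pos psi))// (L (stieltjes_neg psi))//.
by do 4! move: (Rintegral _ _ _) => ?; ring.
Qed.

Let itv_exhaust (x : R) : \forall n \near \oo, `]- n%:R, n%:R]%classic x.
Proof.
have : (\bigcup_n `]- n%:R, n%:R]%classic) x by rewrite (bigcup_itvT false false).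
move=> [k _ kx]; exists k => // n /= kn; move: kx.
apply: subset_itv; rewrite bnd_simp ?lerN2 ler_nat//.
Qed.

(** The formulas for [G] and [F] on []-n, n]] are subtracted before the limit is taken: the boundary
    terms are controlled only for the difference [H]. *)
Lemma integration_by_parts_line (psi : R -> R) : BVloc_rc psi ->
  (LS G).-integrable setT (EFin \o psi) -> (LS F).-integrable setT (EFin \o psi) ->
  stieltjes_integrable psi Hl -> vanishes_at_infinity (fun x => H x * psi x) ->
  \int[LS G]_x psi x - \int[LS F]_x psi x = - stieltjes_integral psi setT Hl.
Proof.
move=> bv iG iF [ip in_] [van1 van2].
pose D n : set mR := `]- n%:R, n%:R]%classic.
have mD n : measurable (D n) by exact: measurable_itv.
have E n : \int[LS G]_(x in D n) psi x - \int[LS F]_(x in D n) psi x =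
    H n%:R * psi n%:R - H (- n%:R) * psi (- n%:R) - stieltjes_integral psi (D n) Hl.
  have [_ _ [_ ->]] := integration_by_parts1 G bv (lerN_natr n).
  have [_ _ [_ ->]] := integration_by_parts1 F bv (lerN_natr n).
  rewrite (stieltjes_integral_left_limitB bv (lerN_natr n)).
  by do 2! move: (stieltjes_integral _ _ _) => ?; ring.
have c1 : \int[LS G]_(x in D n) psi x - \int[LS F]_(x in D n) psi x @[n --> \oo]
    --> \int[LS G]_x psi x - \int[LS F]_x psi x.
  by apply: cvgB; apply: cvg_Rintegral_exhaustion.
have c2 : H n%:R * psi n%:R - H (- n%:R) * psi (- n%:R) - stieltjes_integral psi (D n) Hl
    @[n --> \oo] --> 0 - 0 - stieltjes_integral psi setT Hl.
  apply: cvgB; first apply: cvgB.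
  - exact: (cvg_comp _ _ (@cvgr_idn R) van2).
  - exact: (cvg_comp _ _ (@cvgNr_idn R) van1).
  - by apply: cvgB; apply: cvg_Rintegral_exhaustion.
rewrite (_ : - _ = 0 - 0 - stieltjes_integral psi setT Hl); last by ring.
by rewrite (funext E) in c1; exact: (cvg_unique _ c1 c2).
Qed.

End whole_line.

Section whole_plane.
Context {R : realType}.
Local Notation mR := (measurableTypeR R).
Local Notation LS := lebesgue_stieltjes_measure.
Context (G F : cumulative R R) (g : R -> R -> R).
Local Notation H := (fun x => G x - F x).
Local Notation Gl := (left_limit G).
Local Notation Fl := (left_limit F).
Local Notation Hl := (left_limit H).
Context (bv : BV2loc_rc g).
Context (bv1 : forall x, locally_BV (g x)) (bv2 : forall y, locally_BV (g ^~ y)).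

Lemma BVloc_rc_section2 x : BVloc_rc (g x).
Proof.
split=> //.
exact: (upper_right_continuous1 (upper_right_continuous_tr bv.1)).
Qed.

Lemma BVloc_rc_section1 y : BVloc_rc (g ^~ y).
Proof. by split=> //; exact: (upper_right_continuous1 bv.1). Qed.

Let I (K L : cumulative R R) (D : set (mR * mR)) :=
  \int[(LS K \x LS L)%E]_(z in D) g z.1 z.2.

Let e1 (q : (R * R) * (R * R)) :=
  H q.2.2 * stieltjes_integral (g ^~ q.2.2) `]q.1.1, q.2.1]%classic Hl -
  H q.1.2 * stieltjes_integral (g ^~ q.1.2) `]q.1.1, q.2.1]%classic Hl.
Let e2 (q : (R * R) * (R * R)) :=
  H q.2.1 * stieltjes_integral (g q.2.1) `]q.1.2, q.2.2]%classic Hl -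
  H q.1.1 * stieltjes_integral (g q.1.1) `]q.1.2, q.2.2]%classic Hl.
Let e3 (q : (R * R) * (R * R)) :=
  H q.2.1 * H q.2.2 * g q.2.1 q.2.2 - H q.1.1 * H q.2.2 * g q.1.1 q.2.2 -
  H q.2.1 * H q.1.2 * g q.2.1 q.1.2 + H q.1.1 * H q.1.2 * g q.1.1 q.1.2.

(** The rectangle formula for the pairs [GG], [GF], [FG], [FF], taken with signs [+ - - +], is
    bilinear in the pair, so its boundary terms collect into expressions in [H] alone. *)
Lemma integration_by_parts_box (q : (R * R) * (R * R)) :
  q.1.1 <= q.2.1 -> q.1.2 <= q.2.2 ->
  I G G (rect q.1 q.2) - I G F (rect q.1 q.2) - I F G (rect q.1 q.2) + I F F (rect q.1 q.2) =
  stieltjes2_integral_on g (rect q.1 q.2) (fun z => Hl z.1 * Hl z.2) - e1 q - e2 q + e3 q.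
Proof.
case: q => -[a1 b1] [a2 b2] /= a12 b12; set D := rect _ _.
have mD : measurable (D : set (mR * mR)) by exact: measurable_rect.
have [iGG jGG [_ eGG]] := integration_by_parts2 G G bv BVloc_rc_section1 BVloc_rc_section2 a12 b12.
have [iGF jGF [_ eGF]] := integration_by_parts2 G F bv BVloc_rc_section1 BVloc_rc_section2 a12 b12.
have [iFG jFG [_ eFG]] := integration_by_parts2 F G bv BVloc_rc_section1 BVloc_rc_section2 a12 b12.
have [iFF jFF [_ eFF]] := integration_by_parts2 F F bv BVloc_rc_section1 BVloc_rc_section2 a12 b12.
have {}eGG : I G G D = _ := eGG.
have {}eGF : I G F D = _ := eGF.
have {}eFG : I F G D = _ := eFG.
have {}eFF : I F F D = _ := eFF.
rewrite eGG eGF eFG eFF.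
have L (p : {measure set (mR * mR) -> \bar R}) :
    p.-integrable D (fun z => (Gl z.1 * Gl z.2)%:E) ->
    p.-integrable D (fun z => (Gl z.1 * Fl z.2)%:E) ->
    p.-integrable D (fun z => (Fl z.1 * Gl z.2)%:E) ->
    p.-integrable D (fun z => (Fl z.1 * Fl z.2)%:E) ->
    \int[p]_(z in D) (Hl z.1 * Hl z.2) =
    \int[p]_(z in D) (Gl z.1 * Gl z.2) - \int[p]_(z in D) (Gl z.1 * Fl z.2) -
    \int[p]_(z in D) (Fl z.1 * Gl z.2) + \int[p]_(z in D) (Fl z.1 * Fl z.2).
  move=> k1 k2 k3 k4.
  have h := has_integralD mD (has_integralB mD (has_integralB mD
    (has_integral_integrable k1) (has_integral_integrable k2))
    (has_integral_integrable k3)) (has_integral_integrable k4).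
  have [|] // := has_integral_eq (g := fun z : mR * mR => Hl z.1 * Hl z.2) _ erefl mD h.
  by move=> z _; rewrite !left_limitB; do 4! move: (left_limit _ _) => ?; ring.
rewrite /stieltjes2_integral_on !L//.
rewrite /e1 /e2 /e3 /= !stieltjes_integral_left_limitB//;
  try solve [exact: BVloc_rc_section1|exact: BVloc_rc_section2].
do 8! move: (Rintegral _ _ _) => ?; do 8! move: (stieltjes_integral _ _ _) => ?.
do 4! move: (G _) => ?; do 4! move: (F _) => ?; do 4! move: (g _ _) => ?.
by ring.
Qed.

Lemma integration_by_parts_plane :
  (LS G \x LS G)%E.-integrable setT (fun z => (g z.1 z.2)%:E) ->
  (LS G \x LS F)%E.-integrable setT (fun z => (g z.1 z.2)%:E) ->
  (LS F \x LS G)%E.-integrable setT (fun z => (g z.1 z.2)%:E) ->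
  (LS F \x LS F)%E.-integrable setT (fun z => (g z.1 z.2)%:E) ->
  stieltjes2_integrable g (fun z => Hl z.1 * Hl z.2) ->
  e1 q @[q --> box_to_plane] --> (0 : R) ->
  e2 q @[q --> box_to_plane] --> (0 : R) ->
  e3 q @[q --> box_to_plane] --> (0 : R) ->
  I G G setT - I G F setT - I F G setT + I F F setT =
  stieltjes2_integral g (fun z => Hl z.1 * Hl z.2).
Proof.
move=> iGG iGF iFG iFF [ip in_] c1 c2 c3.
(* The boundary terms vanish along the whole filter of growing boxes, so one sequence of squares may
   be chosen. *)
pose q (n : nat) : (R * R) * (R * R) := ((- n%:R, - n%:R), (n%:R, n%:R)).
have qc : q n @[n --> \oo] --> box_to_plane.
  have cN : (- n%:R : R) @[n --> \oo] --> -oo := @cvgNr_idn R.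
  have cP : (n%:R : R) @[n --> \oo] --> +oo := @cvgr_idn R.
  exact: (cvg_pair (cvg_pair cN cN) (cvg_pair cP cP)).
have mD n : measurable (rect (q n).1 (q n).2 : set (mR * mR)) by exact: measurable_rect.
have Dx (x : R * R) : \forall n \near \oo, rect (q n).1 (q n).2 x.
  have : (\bigcup_n rect (q n).1 (q n).2) x by rewrite bigcup_rect.
  move=> [k _ [kx1 kx2]]; exists k => // n /= kn; split=> /=.
    by move: kx1; apply: subset_itv; rewrite bnd_simp/= ?lerN2 ler_nat.
  by move: kx2; apply: subset_itv; rewrite bnd_simp/= ?lerN2 ler_nat.
pose D n := rect (q n).1 (q n).2.
pose lhs n := I G G (D n) - I G F (D n) - I F G (D n) + I F F (D n).
pose rhs n := stieltjes2_integral_on g (D n) (fun z => Hl z.1 * Hl z.2)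
  - e1 (q n) - e2 (q n) + e3 (q n).
have lhsE : lhs = rhs.
  by apply/funext => n; exact: (@integration_by_parts_box (q n) (lerN_natr n) (lerN_natr n)).
have cI (K L : cumulative R R) : (LS K \x LS L)%E.-integrable setT (fun z => (g z.1 z.2)%:E) ->
    I K L (D n) @[n --> \oo] --> I K L setT.
  exact: cvg_Rintegral_exhaustion.
have lhs_cvg : lhs n @[n --> \oo] -->
    I G G setT - I G F setT - I F G setT + I F F setT.
  by apply: cvgD; [apply: cvgB; [apply: cvgB|]|]; exact: cI.
have rhs_cvg : rhs n @[n --> \oo] -->
    stieltjes2_integral g (fun z => Hl z.1 * Hl z.2) - 0 - 0 + 0.
  apply: cvgD; last exact: cvg_comp qc c3.
  apply: cvgB; last exact: cvg_comp qc c2.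
  apply: cvgB; last exact: cvg_comp qc c1.
  by apply: cvgB; exact: cvg_Rintegral_exhaustion.
rewrite lhsE in lhs_cvg.
have := cvg_unique (F := rhs @ \oo) _ lhs_cvg rhs_cvg.
by rewrite !subr0 addr0; apply.
Qed.

End whole_plane.

(** * Expansion of V-statistics *)

Section v_statistic_decomposition.
Context {R : realType}.
Local Notation mR := (measurableTypeR R).
Local Notation LS := lebesgue_stieltjes_measure.
Context (G F : cumulative R R) (g : R -> R -> R).

(** Integrability of every section makes [gproj1] the true inner integral at each point, rather than
    the real default for an infinite one, so it is the inner integral in Fubini's theorem. *)
Lemma has_integral_gproj1 (K : cumulative R R) :
  (forall x, (LS F).-integrable setT (fun y => (g x y)%:E)) ->
  (LS K \x LS F)%E.-integrable setT (fun z => (g z.1 z.2)%:E) ->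
  has_integral (LS K) setT (gproj1 g F) (\int[(LS K \x LS F)%E]_z g z.1 z.2).
Proof.
move=> iF iKF; have FE : fubini_F (LS F) (fun z : mR * mR => (g z.1 z.2)%:E) = EFin \o gproj1 g F.
  apply/funext => x; rewrite /fubini_F /= /gproj1 /Rintegral fineK//.
  exact: integrable_fin_num.
split; first by rewrite -FE; exact: integrable_fubini_F.
by rewrite /Rintegral -(integral12_prod_meas1 iKF); congr fine; rewrite FE.
Qed.

Lemma integrable_fubini_G d1 d2 (T1 : measurableType d1) (T2 : measurableType d2)
    (m1 : {sigma_finite_measure set T1 -> \bar R})
    (m2 : {sigma_finite_measure set T2 -> \bar R}) (f : T1 * T2 -> \bar R) :
  (m1 \x m2)%E.-integrable setT f -> m2.-integrable setT (fubini_G m1 f).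
Proof.
move=> intf; have mf := measurable_int _ intf.
have maf : measurable_fun setT (abse \o f) by exact: measurableT_comp.
have mG := @measurable_fun_fubini_tonelli_G _ _ _ _ _ m1 _ maf (fun=> abse_ge0 _).
apply/integrableP; split; first exact: (measurable_fubini_G intf).
apply: le_lt_trans ((integrable21ltyP m1 m2 mf).1 intf).
apply: ge0_le_integral => //.
- by apply: measurableT_comp => //; exact: (measurable_fubini_G intf).
- move=> y _; apply: le_abse_integral => //.
  exact: measurableT_comp mf (pair2_measurable y).
Qed.

Lemma has_integral_gproj2 (K : cumulative R R) :
  (forall y, (LS F).-integrable setT (fun x => (g x y)%:E)) ->
  (LS F \x LS K)%E.-integrable setT (fun z => (g z.1 z.2)%:E) ->
  has_integral (LS K) setT (gproj2 g F) (\int[(LS F \x LS K)%E]_z g z.1 z.2).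
Proof.
move=> iF iFK; have GE : fubini_G (LS F) (fun z : mR * mR => (g z.1 z.2)%:E) = EFin \o gproj2 g F.
  apply/funext => y; rewrite /fubini_G /= /gproj2 /Rintegral fineK//.
  exact: integrable_fin_num.
split; first by rewrite -GE; exact: integrable_fubini_G.
by rewrite /Rintegral -(integral21_prod_meas1 iFK); congr fine; rewrite GE.
Qed.

Context (iF1 : forall x, (LS F).-integrable setT (fun y => (g x y)%:E)).
Context (iF2 : forall y, (LS F).-integrable setT (fun x => (g x y)%:E)).
Context (iGF : (LS G \x LS F)%E.-integrable setT (fun z => (g z.1 z.2)%:E)).
Context (iFG : (LS F \x LS G)%E.-integrable setT (fun z => (g z.1 z.2)%:E)).
Context (iFF : (LS F \x LS F)%E.-integrable setT (fun z => (g z.1 z.2)%:E)).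

(** Once Fubini's theorem has turned the projections into double integrals, all mixed terms
    cancel. *)
Lemma von_mises_decomposition :
  Vfun g G - Vfun g F =
  (\int[LS G]_x gproj1 g F x - \int[LS F]_x gproj1 g F x) +
  (\int[LS G]_x gproj2 g F x - \int[LS F]_x gproj2 g F x) +
  (\int[(LS G \x LS G)%E]_z g z.1 z.2 - \int[(LS G \x LS F)%E]_z g z.1 z.2 -
   \int[(LS F \x LS G)%E]_z g z.1 z.2 + \int[(LS F \x LS F)%E]_z g z.1 z.2).
Proof.
have [_ ->] := has_integral_gproj1 iF1 iGF.
have [_ ->] := has_integral_gproj1 iF1 iFF.
have [_ ->] := has_integral_gproj2 iF2 iFG.
have [_ ->] := has_integral_gproj2 iF2 iFF.
by rewrite /Vfun; do 4! move: (Rintegral _ _ _) => ?; ring.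
Qed.

End v_statistic_decomposition.

(** * The signed measure of a difference of cumulative functions *)

Section difference_of_cumulative.
Context {R : realType}.
Local Notation mR := (measurableTypeR R).
Local Notation LS := lebesgue_stieltjes_measure.
Context (G F : cumulative R R).
Local Notation H := (fun x => G x - F x).

Lemma BVloc_rc_cumulativeB : BVloc_rc H.
Proof.
split=> [x|a b].
  by apply: cvgB; exact: cumulative_is_right_continuous.
have ndG := cumulative_is_nondecreasing G; have ndF := cumulative_is_nondecreasing F.
have [ab|ba] := ltP a b.
  apply: bounded_variationD => //; last apply: bounded_variationN.
    by apply: nondecreasing_bounded_variation => x y _ _; exact: ndG.
  by apply: nondecreasing_bounded_variation => x y _ _; exact: ndF.
apply: nondecreasing_bounded_variation => x y; rewrite !in_itv/= => /andP[ax xb] /andP[ay yb] _.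
have ->// : x = y.
by apply/eqP; rewrite eq_le (le_trans xb (le_trans ba ay)) (le_trans yb (le_trans ba ax)).
Qed.

Lemma total_variation_cumulativeB a b : a <= b ->
  fine (total_variation a b H) <= (G b - G a) + (F b - F a).
Proof.
move=> ab; rewrite -lee_fin -total_variation_fin//; last exact: BVloc_rc_cumulativeB.2.
apply: (le_trans (total_variation_le G (\- F) ab)).
rewrite total_variationN EFinD leeD// nondecreasing_total_variation// => x y _ _;
  exact: cumulative_is_nondecreasing.
Qed.

(* G and F need not be the Jordan components of H, but they differ from them by the same K. *)
Lemma stieltjes_cumulativeB : exists K : cumulative R R,
  (forall A, measurable A -> LS G A = measure_add (stieltjes_pos H) (LS K) A) /\
  (forall A, measurable A -> LS F A = measure_add (stieltjes_neg H) (LS K) A).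
Proof.
have bvH := BVloc_rc_cumulativeB.
have [|P PE] := @jordan1_cumulative R 1 H _ bvH; first by rewrite normr1.
pose k x := G x - P x.
have kE a b : a <= b -> k b - k a = (G b - G a) - jordan1 1 H a b.
  by move=> ab; rewrite PE// /k; ring.
(* The total variation of [H] is at most the sum of the increments of [G] and [F], so its positive
   variation is at most the increment of [G]. *)
have ndk : {homo k : x y / x <= y}.
  move=> x y xy; rewrite -subr_ge0 kE//; have := total_variation_cumulativeB xy.
  by rewrite /jordan1; lra.
have rck : right_continuous k.
  by move=> x; apply: cvgB; exact: cumulative_is_right_continuous.
pose K : cumulative R R := HB.pack_for (cumulative R R) k (isCumulative.Build R _ R k ndk rck).
exists K; split; apply: measure_itv_unique => a b ab.
- have EG := lebesgue_stieltjes_measure_itv G ab.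
  have EK : LS K `]a, b]%classic = (k b - k a)%:E := lebesgue_stieltjes_measure_itv K ab.
  have Goo : (LS G `]a, b]%classic < +oo)%E by rewrite EG ltry.
  have E : LS G `]a, b]%classic = measure_add (stieltjes_pos H) (LS K) `]a, b]%classic.
    by rewrite measure_addE [X in (_ + X)%E]EK EG stieltjes_posE// -EFinD kE//; congr EFin; ring.
  by split; [exact: E|exact: Goo].
- have EF := lebesgue_stieltjes_measure_itv F ab.
  have EK : LS K `]a, b]%classic = (k b - k a)%:E := lebesgue_stieltjes_measure_itv K ab.
  have Foo : (LS F `]a, b]%classic < +oo)%E by rewrite EF ltry.
  have E : LS F `]a, b]%classic = measure_add (stieltjes_neg H) (LS K) `]a, b]%classic.
    rewrite measure_addE [X in (_ + X)%E]EK EF stieltjes_negE// -EFinD kE//; congr EFin.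
    by rewrite /jordan1; field.
  by split; [exact: E|exact: Foo].
Qed.

Lemma Rintegral_measure_split d (T : measurableType d)
    (mu m1 m2 : {measure set T -> \bar R}) (f : T -> R) :
  (forall A, measurable A -> mu A = measure_add m1 m2 A) ->
  mu.-integrable setT (EFin \o f) ->
  \int[mu]_x f x = \int[m1]_x f x + \int[m2]_x f x.
Proof.
move=> muE intf; have mf := measurable_int mu intf.
have E h : (\int[mu]_x h x = \int[measure_add m1 m2]_x h x)%E.
  by apply: eq_measure_integral => A mA _; exact: muE.
have maf : measurable_fun setT (abse \o (EFin \o f)) by exact: measurableT_comp.
have := (integrableP _ _ _ intf).2; rewrite E ge0_integral_measure_add// => oo.
have i1 : m1.-integrable setT (EFin \o f).
  apply/integrableP; split => //; apply: le_lt_trans oo.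
  by rewrite leeDl// integral_ge0.
have i2 : m2.-integrable setT (EFin \o f).
  apply/integrableP; split => //; apply: le_lt_trans oo.
  by rewrite leeDr// integral_ge0.
rewrite /Rintegral E integral_measure_add// fineD//; exact: integrable_fin_num.
Qed.

(** The common part [K] cancels. This translates between [degenerate], stated with Jordan measures,
    and the integrals of the von Mises decomposition. *)
Lemma stieltjes_integral_cumulativeB (psi : R -> R) :
  (LS G).-integrable setT (EFin \o psi) -> (LS F).-integrable setT (EFin \o psi) ->
  stieltjes_integral H setT psi = \int[LS G]_x psi x - \int[LS F]_x psi x.
Proof.
move=> iG iF; have [K [GE FE]] := stieltjes_cumulativeB.
rewrite (Rintegral_measure_split GE iG) (Rintegral_measure_split FE iF).
by rewrite /stieltjes_integral; do 3! move: (Rintegral _ _ _) => ?; ring.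
Qed.

End difference_of_cumulative.

Section pathwise_expansion.
Context {R : realType}.
Local Notation mR := (measurableTypeR R).
Local Notation LS := lebesgue_stieltjes_measure.
Context (G F : cumulative R R) (g : R -> R -> R).
Local Notation H := (fun x => G x - F x).
Local Notation Hl := (left_limit H).

Context (mg : measurable_fun [set: R * R] (fun z => g z.1 z.2)).

Lemma integrable_of_abs (K L : cumulative R R) :
  (\int[(LS K \x LS L)%E]_z `|g z.1 z.2|%:E < +oo)%E ->
  (LS K \x LS L)%E.-integrable setT (fun z => (g z.1 z.2)%:E).
Proof.
move=> oo; apply/integrableP; split; last exact: oo.
by apply/measurable_EFinP; exact: mg.
Qed.

Context (hA6 : condA6 g) (hA3 : condA3 g F).
Context (oGG : (\int[(LS G \x LS G)%E]_z `|g z.1 z.2|%:E < +oo)%E).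
Context (oGF : (\int[(LS G \x LS F)%E]_z `|g z.1 z.2|%:E < +oo)%E).
Context (oFG : (\int[(LS F \x LS G)%E]_z `|g z.1 z.2|%:E < +oo)%E).
Context (oFF : (\int[(LS F \x LS F)%E]_z `|g z.1 z.2|%:E < +oo)%E).
Context (int1 : stieltjes_integrable (gproj1 g F) Hl).
Context (int2 : stieltjes_integrable (gproj2 g F) Hl).
Context (int12 : stieltjes2_integrable g (fun z => Hl z.1 * Hl z.2)).
Context (van1 : vanishes_at_infinity (fun x => H x * gproj1 g F x)).
Context (van2 : vanishes_at_infinity (fun x => H x * gproj2 g F x)).
Context (box1 : (H q.2.2 * stieltjes_integral (g ^~ q.2.2) `]q.1.1, q.2.1]%classic Hl
  - H q.1.2 * stieltjes_integral (g ^~ q.1.2) `]q.1.1, q.2.1]%classic Hl)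
  @[q --> box_to_plane] --> (0 : R)).
Context (box2 : (H q.2.1 * stieltjes_integral (g q.2.1) `]q.1.2, q.2.2]%classic Hl
  - H q.1.1 * stieltjes_integral (g q.1.1) `]q.1.2, q.2.2]%classic Hl)
  @[q --> box_to_plane] --> (0 : R)).
Context (box3 : (H q.2.1 * H q.2.2 * g q.2.1 q.2.2 - H q.1.1 * H q.2.2 * g q.1.1 q.2.2
  - H q.2.1 * H q.1.2 * g q.2.1 q.1.2 + H q.1.1 * H q.1.2 * g q.1.1 q.1.2)
  @[q --> box_to_plane] --> (0 : R)).

(** The linear terms are kept in both forms: as integrals against [dH], where degeneracy applies,
    and as integrals of [H_-], which are the values of the functionals on [V]. *)
Lemma v_statistic_expansion :
  Vfun g G - Vfun g F =
    stieltjes_integral H setT (gproj1 g F) + stieltjes_integral H setT (gproj2 g F) +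
    stieltjes2_integral g (fun z => Hl z.1 * Hl z.2) /\
  stieltjes_integral H setT (gproj1 g F) = - stieltjes_integral (gproj1 g F) setT Hl /\
  stieltjes_integral H setT (gproj2 g F) = - stieltjes_integral (gproj2 g F) setT Hl.
Proof.
have [bv bv1 bv2] := hA6; have [iF1 [iF2 [bvg1 bvg2]]] := hA3.
have iGG := integrable_of_abs oGG; have iGF := integrable_of_abs oGF.
have iFG := integrable_of_abs oFG; have iFF := integrable_of_abs oFF.
have [i1G _] := has_integral_gproj1 iF1 iGF.
have [i1F _] := has_integral_gproj1 iF1 iFF.
have [i2G _] := has_integral_gproj2 iF2 iFG.
have [i2F _] := has_integral_gproj2 iF2 iFF.
have S1 := stieltjes_integral_cumulativeB i1G i1F.
have S2 := stieltjes_integral_cumulativeB i2G i2F.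
have L1 := integration_by_parts_line bvg1 i1G i1F int1 van1.
have L2 := integration_by_parts_line bvg2 i2G i2F int2 van2.
have PL := integration_by_parts_plane bv bv1 bv2 iGG iGF iFG iFF int12 box1 box2 box3.
have VM := von_mises_decomposition iF1 iF2 iGF iFG iFF.
split; last by split; [exact: etrans S1 L1|exact: etrans S2 L2].
apply: (etrans VM); congr (_ + _ + _); [exact: esym S1|exact: esym S2|exact: PL].
Qed.

End pathwise_expansion.

(** * Convergence in distribution *)

Section expectation_ae.
Context {R : realType} d (T : measurableType d) (mu : {measure set T -> \bar R}).

Import HBNNSimple.

(** The integral of any nonnegative function is a supremum over simple functions below it.
    Multiplying such a function by the indicator of the complement of [N] puts it below [g] without
    changing its integral. *)
Let ge0_le_integral_ae (f g : T -> \bar R) (N : set T) :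
  (forall x, 0 <= f x)%E -> (forall x, 0 <= g x)%E -> measurable N -> mu N = 0%E ->
  (forall x, ~ N x -> f x = g x) -> (\int[mu]_x f x <= \int[mu]_x g x)%E.
Proof.
move=> f0 g0 mN N0 fg.
have mnn (k : {nnsfun T >-> R}) : measurable_fun setT (fun x => (k x)%:E).
  by apply/measurable_EFinP; exact: measurable_funPT.
rewrite [leLHS]ge0_integralTE// [leRHS]ge0_integralTE//.
apply: ge_ereal_sup => _ [h /= hf <-].
have mNC : measurable (~` N) by exact: measurableC.
apply: ereal_sup_ubound; exists (proj_nnsfun h mNC) => /=.
  move=> x; rewrite /proj_nnsfun/= mindicE; have [Nx|Nx] := pselect (N x).
    by rewrite memNset ?mulr0//=; exact.
  by rewrite mem_set// mulr1 -fg.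
rewrite -!integralT_nnsfun; apply: ge0_ae_eq_integral => //.
- by move=> x _; rewrite lee_fin.
- by move=> x _; rewrite lee_fin.
- exists N; split=> // x /= /not_implyP[_]; apply: contra_notP => Nx.
  by rewrite /proj_nnsfun/= mindicE mem_set// mulr1.
Qed.

(* For nonmeasurable integrands such as w |-> V_g(F_n(w)), on which no measurability is assumed. *)
Lemma integral_ae_eq_nonmeasurable (f g : T -> \bar R) :
  {ae mu, forall x, f x = g x} -> (\int[mu]_x f x = \int[mu]_x g x)%E.
Proof.
move=> [N [mN N0 fgN]].
have fg x : ~ N x -> f x = g x by move=> Nx; apply: contrapT => /fgN.
rewrite [LHS]integralE [RHS]integralE; congr (_ - _)%E.
  apply/eqP; rewrite eq_le; apply/andP; split;
    apply: (ge0_le_integral_ae (N := N)) => // x Nx;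
    by rewrite !funeposE fg.
apply/eqP; rewrite eq_le; apply/andP; split;
  apply: (ge0_le_integral_ae (N := N)) => // x Nx;
  by rewrite !funenegE fg.
Qed.

End expectation_ae.

Section bounded_expectation.
Context {R : realType} d (T : measurableType d) (P : probability T R).

Lemma bounded_integrable (Y : T -> R) (C : R) : measurable_fun setT Y ->
  (forall w, `|Y w| <= C) -> P.-integrable setT (EFin \o Y).
Proof.
move=> mY YC; apply: (@le_integrable _ _ _ P _ measurableT _ (cst C%:E)).
- exact/measurable_EFinP.
- by move=> w _; rewrite /= lee_fin (le_trans (YC w))// ler_norm.
- exact: finite_measure_integrable_cst.
Qed.

Lemma bounded_expectationE (Y : T -> R) (C : R) : measurable_fun setT Y ->
  (forall w, `|Y w| <= C) -> 'E_P[Y]%E = (\int[P]_w Y w)%:E.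
Proof.
move=> mY YC; rewrite unlock /Rintegral fineK//.
by apply: integrable_fin_num => //; exact: bounded_integrable YC.
Qed.

Lemma expectation_ae_eq (X Y : T -> R) : {ae P, forall w, X w = Y w} -> 'E_P[X]%E = 'E_P[Y]%E.
Proof.
move=> XY; rewrite unlock; apply: integral_ae_eq_nonmeasurable.
by apply: filterS XY => w ->.
Qed.

End bounded_expectation.

Section measurable_for.
Context {R : realType}.

(** Preimages of products are intersections of two sets of [M], and the planar sets with preimage in
    [M] form a sigma-algebra. *)
Lemma measurable_for_pair (S : Type) (M : set (set S)) (f g : S -> R) (k : R * R -> R) :
  sigma_algebra setT M -> measurable_for M f -> measurable_for M g ->
  measurable_fun setT k -> measurable_for M (fun s => k (f s, g s)).
Proof.
move=> [M0 MC MU] mf mg mk B mB.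
have MI X Y : M X -> M Y -> M (X `&` Y).
  move=> MX MY; rewrite -[X `&` Y]setCK setCI -!setTD; apply: (MC).
  rewrite -bigcup2E !setTD; apply: MU => -[|[|n]] /=; rewrite -?setTD;
    [exact: MC|exact: MC|exact: M0].
have {mk mB} mkB : measurable (k @^-1` B) by rewrite -[_ @^-1` _]setTI; exact: mk.
suff : measurable `<=` [set D : set (R * R) | M ((fun s => (f s, g s)) @^-1` D)].
  by move/(_ _ mkB).
rewrite measurable_prod_measurableType; apply: smallest_sub.
  split=> /= [|D MD|F MF].
  - by rewrite preimage_set0.
  - by rewrite setTD preimage_setC -setTD; exact: MC.
  - by rewrite preimage_bigcup; exact: MU.
move=> _ [X mX [Y mY <-]] /=.
by rewrite (_ : _ @^-1` _ = f @^-1` X `&` g @^-1` Y)//; apply: MI; [exact: mf|exact: mg].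
Qed.

Lemma random_element_measurable (S : Type) (M : set (set S)) d (T : measurableType d)
    (xi : T -> S) (f : S -> R) :
  random_element M xi -> measurable_for M f -> measurable_fun setT (f \o xi).
Proof. by move=> rxi mf _ B mB; rewrite setTI comp_preimage; apply: rxi; exact: mf. Qed.

Lemma sigma_algebra_trace (V : metric_subspace R) :
  sigma_algebra setT (@trace_sigma_algebra R V).
Proof.
have sD : sigma_algebra (@bounded_cadlag R) (@projection_sigma_algebra R).
  exact: smallest_sigma_algebra.
have [S0 SC SU] := sD; split.
- by exists set0 => //; rewrite preimage_set0 setI0.
(* The projection sigma-algebra lives on the bounded cadlag functions, so complements are relative
   to these; every element of [V] is one of them. *)
- move=> _ [A SA <-]; exists (@bounded_cadlag R `\` A); first exact: SC.
  apply/seteqP; split=> [f [_ [_ nA]]|f [_ nA]]; split=> //.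
    by move=> [].
  by split; [apply: (@ms_cadlag R V); exact: set_valP|move=> Af; apply: nA].
- move=> F MF; have /choice[A FA] : forall n, exists A, @projection_sigma_algebra R A /\
      setT `&` @ms_fun R V @^-1` A = F n.
    by move=> n; have [A SA <-] := MF n; exists A.
  exists (\bigcup_n A n); first by apply: SU => n; have [] := FA n.
  rewrite preimage_bigcup setI_bigcupr; apply: eq_bigcupr => n _.
  by have [_ ->] := FA n.
Qed.

End measurable_for.

(** * Continuous mapping with a vanishing perturbation *)

Section perturbed_convergence.
Context {R : realType}.

(** Only [x] is confined to the compact interval, while [y] may leave it. Compactness is used in its
    near-covering form, the radius being the parameter that tends to 0. *)
Lemma uniform_continuity_itv (h : R -> R) (K e : R) : continuous h -> 0 < e ->
  exists2 r, 0 < r & forall x y, `|x| <= K -> `|y - x| < r -> `|h y - h x| <= e.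
Proof.
move=> ch e0; have e20 : 0 < e / 2 by rewrite divr_gt0.
have := @segment_compact R (- K) K; rewrite compact_near_coveringP.
move=> /(_ R (0^'+) (fun r x => forall y, `|y - x| < r -> `|h y - h x| <= e) _)[|r0 /= r00 hr].
  move=> x _; have /cvgrPdist_lt/(_ _ e20) := ch x.
  move=> /nbhs_ballP[r /= r0 hr]; have r20 : 0 < r / 2 by rewrite divr_gt0.
  exists (ball x (r / 2), [set s | s < r / 2]).
    by split; [exact: nbhsx_ballx|exact: nbhs_right_lt].
  move=> [x' s] [/= xx' sr] y yx'.
  have xx'r : ball x r x' by apply: le_ball xx'; have : 0 < r by []; lra.
  have xyr : ball x r y.
    rewrite /ball/= (_ : x - y = (x - x') - (y - x')); last by ring.
    rewrite (le_lt_trans (ler_normB _ _))// [ltRHS]splitr ltrD//.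
    exact: lt_trans yx' sr.
  have h1 := hr _ xx'r; have h2 := hr _ xyr.
  rewrite (_ : h y - h x' = (h x - h x') - (h x - h y)); last by ring.
  by rewrite (le_trans (ler_normB _ _))// [leRHS]splitr lerD// ltW.
exists (r0 / 2); first by rewrite divr_gt0.
move=> x y xK; apply: (hr (r0 / 2)) => //=.
- by rewrite sub0r normrN gtr0_norm ?divr_gt0// ltr_pdivrMr// ltr_pMr// ltr1n.
- by rewrite divr_gt0.
- by rewrite in_itv/= -ler_norml.
Qed.

(** A continuous stand-in for the indicator of a tail, rising linearly from 0 at [K] to 1 at
    [K + 1], so that tail probabilities can be bounded with a test function. *)
Definition cutoff (K t : R) : R := Num.min (Num.max (t - K) 0) 1.

Lemma cutoff_ge0 K t : 0 <= cutoff K t.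
Proof. by rewrite /cutoff le_min ler01 le_max lexx orbT. Qed.

Lemma cutoff_le1 K t : cutoff K t <= 1.
Proof. by rewrite /cutoff ge_min lexx orbT. Qed.

Lemma cutoff_eq0 K t : t <= K -> cutoff K t = 0.
Proof.
move=> tK; rewrite /cutoff max_r ?subr_le0// min_l//.
Qed.

Lemma cutoff_eq1 K t : K + 1 <= t -> cutoff K t = 1.
Proof.
by move=> tK; rewrite /cutoff min_r// le_max lerBrDl tK.
Qed.

Lemma continuous_cutoff K : continuous (cutoff K).
Proof.
move=> t; apply: (@continuous_min R R (fun t => Num.max (t - K) 0) (cst 1));
  last exact: cst_continuous.
apply: (@continuous_max R R (fun t => t - K) (cst 0)); last exact: cst_continuous.
by apply: cvgB; [exact: cvg_id|exact: cvg_cst].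
Qed.

Context (S : topologicalType) (M : set (set S)) (sM : sigma_algebra setT M).
Context d (T : measurableType d) (P : probability T R) (Z : nat -> T -> S).
Context d' (T' : measurableType d') (P' : probability T' R) (B : T' -> S).
Context (Z_random : forall n, random_element M (Z n)) (B_random : random_element M B).
Context (Z_cvg : cvg_in_distribution M P Z P' B).
Context (Phi Psi : S -> R).
Context (Phi_cont : continuous Phi) (Psi_cont : continuous Psi).
Context (Phi_meas : measurable_for M Phi) (Psi_meas : measurable_for M Psi).

Lemma cvg_bounded_continuous (f : S -> R) (C : R) :
  continuous f -> measurable_for M f -> (forall s, `|f s| <= C) ->
  \int[P]_w f (Z n w) @[n --> \oo] --> \int[P']_w f (B w).
Proof.
move=> cf mf fC; have := Z_cvg cf mf (ex_intro _ C fC).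
have -> : (fun n => 'E_P[f \o Z n]%E) = fun n => (\int[P]_w f (Z n w))%:E.
  apply/funext => n; apply: (@bounded_expectationE _ _ _ _ _ C) => [|w /=]; last exact: fC.
  exact: random_element_measurable (Z_random n) mf.
have -> : 'E_P'[f \o B]%E = (\int[P']_w f (B w))%:E.
  apply: (@bounded_expectationE _ _ _ _ _ C) => [|w /=]; last exact: fC.
  exact: random_element_measurable B_random mf.
by move/fine_cvg.
Qed.

(* Slutsky's lemma; tightness of (Phi, Psi)(Z n) comes from testing the convergence against
   [cutoff K (`|Phi| + `|Psi|)], whose limit expectation is small for large K. *)
Lemma cvg_in_distribution_perturbed (c : nat -> R) (xi : nat -> T -> R) :
  c n @[n --> \oo] --> 0 ->
  (forall n, {ae P, forall w, xi n w = Phi (Z n w) + c n * Psi (Z n w)}) ->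
  cvg_in_distribution (S := R) measurable P xi P' (Phi \o B).
Proof.
move=> c0 xiE h ch mh [C hC].
have C0 : 0 <= C by exact: le_trans (normr_ge0 _) (hC 0).
have mh' : measurable_fun setT h by exact: continuous_measurable_fun.
have mX n : measurable_fun setT (fun w => Phi (Z n w) + c n * Psi (Z n w)).
  apply: measurable_funD; last apply: measurable_funM => //.
    exact: random_element_measurable (Z_random n) Phi_meas.
  exact: random_element_measurable (Z_random n) Psi_meas.
(* The possibly nonmeasurable [xi n] is replaced here, under the integral, by its measurable almost
   sure expression. *)
have -> : (fun n => 'E_P[h \o xi n]%E) =
    fun n => (\int[P]_w h (Phi (Z n w) + c n * Psi (Z n w)))%:E.
  apply/funext => n.
  rewrite (@expectation_ae_eq _ _ _ _ _ (fun w => h (Phi (Z n w) + c n * Psi (Z n w)))); last first.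
    by apply: filterS (xiE n) => w /= ->.
  apply: (@bounded_expectationE _ _ _ _ _ C) => [|w /=]; last exact: hC.
  exact: measurableT_comp mh' (mX n).
have mhPhi : measurable_for M (h \o Phi) by move=> A mA; exact: (Phi_meas (mh A mA)).
have chPhi : continuous (h \o Phi).
  by move=> s; exact: (@continuous_comp _ _ _ Phi h s (@Phi_cont s) (@ch (Phi s))).
have -> : 'E_P'[h \o (Phi \o B)]%E = (\int[P']_w h (Phi (B w)))%:E.
  apply: (@bounded_expectationE _ _ _ _ _ C) => [|w /=]; last exact: hC.
  exact: random_element_measurable B_random mhPhi.
apply: cvg_EFin; first by near=> n.
have main := cvg_bounded_continuous chPhi mhPhi (fun s => hC (Phi s)).
pose r s := `|Phi s| + `|Psi s|.
pose kap K s := cutoff K (r s).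
have cr : continuous r.
  by move=> s; apply: cvgD; apply: cvg_norm; [exact: Phi_cont|exact: Psi_cont].
have ckap K : continuous (kap K).
  by move=> s; exact: (@continuous_comp _ _ _ r (cutoff K) s (@cr s) (@continuous_cutoff K (r s))).
have mkap K : measurable_for M (kap K).
  apply: (@measurable_for_pair R S M Phi Psi (fun z => cutoff K (`|z.1| + `|z.2|))) => //.
  apply: measurableT_comp; first by apply: continuous_measurable_fun; exact: continuous_cutoff.
  by apply: measurable_funD; apply: measurableT_comp => //.
have kap1 K s : `|kap K s| <= 1 by rewrite ger0_norm ?cutoff_ge0// cutoff_le1.
(* At each fixed point the cutoffs vanish once [K] exceeds [r], and they are bounded by 1. *)
have kap_small : \int[P']_w kap K%:R (B w) @[K --> \oo] --> 0.
  have [|||||_ _ dc] := @dominated_convergence _ _ _ P' setT measurableT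
    (fun K => EFin \o (fun w => kap K%:R (B w))) (cst 0%E) (cst 1%:E).
  - move=> K; apply/measurable_EFinP.
    exact: random_element_measurable B_random (mkap _).
  - exact: measurable_cst.
  - apply/aeW => w _; apply: cvg_near_cst.
    have := archi_boundP (addr_ge0 (normr_ge0 (Phi (B w))) (normr_ge0 (Psi (B w)))).
    set k := Num.bound _ => rk; exists k => // K /= kK.
    by rewrite /kap cutoff_eq0// (le_trans (ltW rk))// ler_nat.
  - exact: finite_measure_integrable_cst.
  - by apply/aeW => w K _ /=; rewrite lee_fin.
  by move: dc; rewrite integral0 => /fine_cvg.
apply/cvgrPdist_le => e e0.
(* The errors add up to [(2 + 2 * C) * e1]: one [e1] for the limit of the unperturbed integrals, one
   for uniform continuity, and [2 * C * e1] for the tail; the final 1 is slack. *)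
pose e1 := e / (2 + 2 * C + 1); have D0 : 0 < 2 + 2 * C + 1 :> R by lra.
have e10 : 0 < e1 by rewrite divr_gt0.
have [K _ /(_ K (leqnn K))] : \forall K \near \oo, \int[P']_w kap K%:R (B w) < e1.
  by have /cvgr_lt/(_ _ e10) := kap_small.
rewrite /= => hK; have [rho rho0 hrho] := uniform_continuity_itv (K%:R + 1) ch e10.
have hkap := cvg_bounded_continuous (ckap K%:R) (mkap K%:R) (kap1 K%:R).
have near_kap : \forall n \near \oo, \int[P]_w kap K%:R (Z n w) < e1.
  by have /cvgr_lt := hkap; apply.
have K10 : 0 < K%:R + 1 :> R by rewrite ltr_wpDl.
have near_c : \forall n \near \oo, `|c n| < rho / (K%:R + 1).
  have /cvgr0Pnorm_lt := c0; apply.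
  by rewrite divr_gt0.
have near_main : \forall n \near \oo,
    `|\int[P']_w h (Phi (B w)) - \int[P]_w h (Phi (Z n w))| <= e1.
  by have /cvgrPdist_le := main; apply.
near=> n.
have ckn : `|c n| < rho / (K%:R + 1) by near: n.
have ekap : \int[P]_w kap K%:R (Z n w) < e1 by near: n.
have emain : `|\int[P']_w h (Phi (B w)) - \int[P]_w h (Phi (Z n w))| <= e1 by near: n.
(* Where [r] is at least [K + 1] the cutoff is 1 and [h] differs by at most [2 * C]. Elsewhere [Phi]
   and [Psi] are bounded by [K + 1], so the perturbation stays below [rho]. *)
have pw w : `|h (Phi (Z n w) + c n * Psi (Z n w)) - h (Phi (Z n w))| <=
    e1 + 2 * C * kap K%:R (Z n w).
  have [rK|rK] := leP (K%:R + 1) (r (Z n w)).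
    rewrite /kap cutoff_eq1// mulr1 (le_trans (ler_normB _ _))//.
    have := hC (Phi (Z n w) + c n * Psi (Z n w)); have := hC (Phi (Z n w)).
    by move: e10; lra.
  rewrite -[leLHS]addr0 lerD ?mulr_ge0 ?cutoff_ge0//.
  apply: hrho.
    by rewrite (le_trans _ (ltW rK))// /r lerDl.
  rewrite addrAC subrr add0r normrM.
  have Psi_le : `|Psi (Z n w)| <= K%:R + 1 by rewrite (le_trans _ (ltW rK))// /r lerDr.
  apply: (@le_lt_trans _ _ (`|c n| * (K%:R + 1))); first by rewrite ler_wpM2l.
  by rewrite -ltr_pdivlMr.
have i1 : P.-integrable setT (EFin \o (fun w => h (Phi (Z n w) + c n * Psi (Z n w)))).
  apply: (@bounded_integrable _ _ _ P _ C) => [|w]; last exact: hC.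
  exact: measurableT_comp mh' (mX n).
have i2 : P.-integrable setT (EFin \o (fun w => h (Phi (Z n w)))).
  apply: (@bounded_integrable _ _ _ P _ C) => [|w]; last exact: hC.
  exact: random_element_measurable (Z_random n) mhPhi.
have i3 : P.-integrable setT (EFin \o (fun w => kap K%:R (Z n w))).
  apply: (@bounded_integrable _ _ _ P _ 1) => [|w]; last exact: kap1.
  exact: random_element_measurable (Z_random n) (mkap _).
have h3 := has_integralD measurableT
  (has_integral_cst e1 measurableT (probability_setT P))
  (has_integralZ (2 * C) measurableT (has_integral_integrable i3)).
have [i12 e12] := has_integralB measurableT
  (has_integral_integrable i1) (has_integral_integrable i2).
have diff : `|\int[P]_w h (Phi (Z n w) + c n * Psi (Z n w)) - \int[P]_w h (Phi (Z n w))|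
    <= e1 + 2 * C * e1.
  rewrite -e12 (le_trans (le_normr_Rintegral _ i12))//.
  apply: (@le_trans _ _ (\int[P]_w (e1 + 2 * C * kap K%:R (Z n w)))).
    apply: le_Rintegral => //; first exact: integrable_norm.
    exact: h3.1.
  rewrite h3.2 mulr1 lerD2l ler_wpM2l ?mulr_ge0// ltW//.
rewrite (_ : _ - _ = (\int[P']_w h (Phi (B w)) - \int[P]_w h (Phi (Z n w))) -
  (\int[P]_w h (Phi (Z n w) + c n * Psi (Z n w)) - \int[P]_w h (Phi (Z n w)))); last first.
  by do 3! move: (Rintegral _ _ _) => ?; ring.
rewrite (le_trans (ler_normB _ _))// (le_trans (lerD emain diff))//.
have -> : e = (2 + 2 * C + 1) * e1 by rewrite /e1 mulrC divfK// gt_eqF.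
by nra.
Unshelve. all: by end_near. Qed.

End perturbed_convergence.

(** * Scaling, and the limit theorem for V-statistics *)

Section scaled_integrals.
Context {R : realType}.
Local Notation mR := (measurableTypeR R).

Lemma left_limitZ (c : R) (f : R -> R) (x l : R) :
  f y @[y --> x^'-] --> l -> left_limit (fun y => c * f y) x = c * l.
Proof. by move=> fl; apply/cvg_lim => //; apply: cvgM => //; exact: cvg_cst. Qed.

Lemma integrable_unscale d (T : measurableType d) (mu : {measure set T -> \bar R})
    (f : T -> R) (c : R) : c != 0 ->
  mu.-integrable setT (EFin \o (fun x => c * f x)) -> mu.-integrable setT (EFin \o f).
Proof.
move=> c0 intf; have [+ _] := has_integralZ c^-1 measurableT (has_integral_integrable intf).
by under eq_fun do rewrite mulKf//.
Qed.

(** The functionals on [V] are evaluated at the scaled process; dividing by [c] brings integrability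
    back to the process itself. *)
Lemma stieltjes_integrableZ (psi f : R -> R) (c : R) : c != 0 ->
  stieltjes_integrable psi (fun x => c * f x) -> stieltjes_integrable psi f /\
  stieltjes_integral psi setT (fun x => c * f x) = c * stieltjes_integral psi setT f.
Proof.
move=> c0 [i1 i2]; have j1 := integrable_unscale c0 i1; have j2 := integrable_unscale c0 i2.
by split => //; rewrite /stieltjes_integral !RintegralZl// -mulrBr.
Qed.

Lemma stieltjes2_integrableZ (g : R -> R -> R) (f : R * R -> R) (c : R) : c != 0 ->
  stieltjes2_integrable g (fun x => c * f x) -> stieltjes2_integrable g f /\
  stieltjes2_integral g (fun x => c * f x) = c * stieltjes2_integral g f.
Proof.
move=> c0 [i1 i2]; have j1 := integrable_unscale c0 i1; have j2 := integrable_unscale c0 i2.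
split; first by split.
rewrite /stieltjes2_integral.
have [_ ->] := has_integralZ c measurableT (has_integral_integrable j1).
have [_ ->] := has_integralZ c measurableT (has_integral_integrable j2).
by rewrite -mulrBr.
Qed.

End scaled_integrals.

Theorem theorem3p15 (R : realType)
  (d : measure_display) (T : measurableType d) (P : probability T R)
  (F : cumulativeBounded (0 : R) (1 : R))
  (X : nat -> {RV P >-> R})
  (cdfX : forall i x, cdf (X i) x = (F x)%:E)
  (g : R -> R -> R)
  (mg : measurable_fun [set: R * R] (fun z => g z.1 z.2))
  (Fn : nat -> T -> cumulative R R)
  (* Fn n is a function of the first n + 1 variables X 0, ..., X n *)
  (FnX : forall n x, measurable_for
     (g_sigma_preimage (fun i : 'I_n.+1 => (X i : T -> R)))
     (fun w => Fn n w x))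
  (V : metric_subspace R)
  (a : nat -> R) (a_gt0 : forall n, 0 < a n) (a_infty : a n @[n --> \oo] --> +oo)
  (hA1 : condA1 P g F Fn) (hA2 : condA2 P g F Fn) (hA3 : condA3 g F)
  (hA4 : condA4 P g F Fn) (hA5 : condA5 P g F Fn) (hA6 : condA6 g)
  (hA7 : condA7 P g F Fn) (hA8 : condA8 P g F Fn)
  (Phi1_def : forall f : V, stieltjes_integrable (gproj1 g F) (ms_left_limit f))
  (Phi2_def : forall f : V, stieltjes_integrable (gproj2 g F) (ms_left_limit f))
  (Phi3_def : forall f : V, stieltjes2_integrable g
     (fun z => ms_left_limit f z.1 * ms_left_limit f z.2))
  (Phi1 := fun f : V => - stieltjes_integral (gproj1 g F) setT (ms_left_limit f))
  (Phi2 := fun f : V => - stieltjes_integral (gproj2 g F) setT (ms_left_limit f))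
  (Phi3 := fun f : V => stieltjes2_integral g
     (fun z => ms_left_limit f z.1 * ms_left_limit f z.2))
  (Phi1_meas : measurable_for (@trace_sigma_algebra R V) Phi1)
  (Phi2_meas : measurable_for (@trace_sigma_algebra R V) Phi2)
  (Phi3_meas : measurable_for (@trace_sigma_algebra R V) Phi3)
  (Phi1_cont : continuous Phi1)
  (Phi2_cont : continuous Phi2)
  (Phi3_cont : continuous Phi3)
  (Z : nat -> T -> V)
  (ZE : forall n w, ms_fun (Z n w) =
     (fun x => a n * (extend_by_limits (Fn n w) x - extend_by_limits F x)))
  (Z_random : forall n, random_element (@trace_sigma_algebra R V) (Z n))
  (d' : measure_display) (T' : measurableType d') (P' : probability T' R)
  (B : T' -> V) (B_random : random_element (@trace_sigma_algebra R V) B)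
  (S : set V) (S_meas : @trace_sigma_algebra R V S) (S_sep : separable_subset S)
  (S_reg : forall f, S f ->
     completely_regular_point (R := R) (@trace_sigma_algebra R V) f)
  (B_S : P' (B @^-1` S) = 1%E)
  (Z_cvg : cvg_in_distribution (@trace_sigma_algebra R V) P Z P' B) :
  cvg_in_distribution (S := R) measurable
    P (fun n w => a n * (Vfun g (Fn n w) - Vfun g F))
    P' (fun w => - (stieltjes_integral (gproj1 g F) setT (ms_left_limit (B w)) +
                    stieltjes_integral (gproj2 g F) setT (ms_left_limit (B w))))
  /\
  (degenerate P g F Fn ->
   cvg_in_distribution (S := R) measurable
     P (fun n w => a n ^+ 2 * (Vfun g (Fn n w) - Vfun g F))
     P' (fun w => stieltjes2_integral g
           (fun z => ms_left_limit (B w) z.1 * ms_left_limit (B w) z.2))).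
Proof.
have sM := @sigma_algebra_trace R V.
have a_neq0 n : a n != 0 by rewrite gt_eqF.
pose H n w := Hdiff F Fn n w.
have Hlim n w x : H n w y @[y --> x^'-] --> left_limit (H n w) x.
  rewrite (left_limitB (Fn n w) F x).
  exact: (cvgB (left_limit_cvg (y := x) (cumulative_is_nondecreasing (Fn n w)))
    (left_limit_cvg (y := x) (cumulative_is_nondecreasing F))).
have ZlE n w : ms_left_limit (Z n w) = fun x => a n * left_limit (H n w) x.
  apply/funext => x; rewrite -(left_limitZ (a n) (Hlim n w x)) /ms_left_limit ZE.
  by [].
(* Every path of [Z n] lies in [V], where the functional is well defined, so the left limits of
   [F_n - F] are integrable for every [w]. *)
have i1 n w := stieltjes_integrableZ (a_neq0 n) (eq_ind _ _ (Phi1_def (Z n w)) _ (ZlE n w)).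
have i2 n w := stieltjes_integrableZ (a_neq0 n) (eq_ind _ _ (Phi2_def (Z n w)) _ (ZlE n w)).
have Zl2E n w : (fun z : R * R => ms_left_limit (Z n w) z.1 * ms_left_limit (Z n w) z.2) =
    fun z => a n ^+ 2 * (left_limit (H n w) z.1 * left_limit (H n w) z.2).
  by apply/funext => z; rewrite ZlE expr2 mulrACA.
have a2_neq0 n : a n ^+ 2 != 0 by rewrite expf_neq0.
have i3 n w := stieltjes2_integrableZ (a2_neq0 n) (eq_ind _ _ (Phi3_def (Z n w)) _ (Zl2E n w)).
have P1E n w : Phi1 (Z n w) = - (a n * stieltjes_integral (gproj1 g F) setT (left_limit (H n w))).
  by rewrite /Phi1 ZlE (i1 n w).2.
have P2E n w : Phi2 (Z n w) = - (a n * stieltjes_integral (gproj2 g F) setT (left_limit (H n w))).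
  by rewrite /Phi2 ZlE (i2 n w).2.
have P3E n w : Phi3 (Z n w) = a n ^+ 2 *
    stieltjes2_integral g (fun z => left_limit (H n w) z.1 * left_limit (H n w) z.2).
  by rewrite /Phi3 Zl2E (i3 n w).2.
have expansion n : {ae P, forall w, Vfun g (Fn n w) - Vfun g F =
    stieltjes_integral (H n w) setT (gproj1 g F) + stieltjes_integral (H n w) setT (gproj2 g F) +
    stieltjes2_integral g (fun z => left_limit (H n w) z.1 * left_limit (H n w) z.2) /\
  stieltjes_integral (H n w) setT (gproj1 g F) =
    - stieltjes_integral (gproj1 g F) setT (left_limit (H n w)) /\
  stieltjes_integral (H n w) setT (gproj2 g F) =
    - stieltjes_integral (gproj2 g F) setT (left_limit (H n w))}.
  have [oFF _ oGG] := hA1.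
  apply: filterS3 (filterI hA8 hA5) (hA2 n) (oGG n) => w [h8 h5] [oGF oFG] {}oGG.
  have [v1 v2] := h5 n; have [b1 b2 b3] := h8 n.
  exact: (v_statistic_expansion mg hA6 hA3 oGG oGF oFG oFF (i1 n w).1 (i2 n w).1
    (i3 n w).1 v1 v2 b1 b2 b3).
have Phi12_cont : continuous (fun f : V => Phi1 f + Phi2 f).
  by move=> f; exact: (cvgD (@Phi1_cont f) (@Phi2_cont f)).
have Phi12_meas : measurable_for (@trace_sigma_algebra R V) (fun f : V => Phi1 f + Phi2 f).
  apply: (@measurable_for_pair R V _ Phi1 Phi2 (fun z => z.1 + z.2)) => //.
  exact: measurable_funD.
have rescale (c s1 s2 t : R) : c != 0 ->
    c * (- s1 + - s2 + t) = - (c * s1) + - (c * s2) + c^-1 * (c ^+ 2 * t).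
  by move=> c0; field.
split.
  have -> : (fun w => - (stieltjes_integral (gproj1 g F) setT (ms_left_limit (B w)) +
      stieltjes_integral (gproj2 g F) setT (ms_left_limit (B w)))) =
      (fun f : V => Phi1 f + Phi2 f) \o B.
    by apply/funext => w; rewrite /= /Phi1 /Phi2 opprD.
  apply: (cvg_in_distribution_perturbed sM Z_random B_random Z_cvg Phi12_cont Phi3_cont
    Phi12_meas Phi3_meas (c := fun n => (a n)^-1)).
    by apply/gtr0_cvgV0 => //; near=> n.
  move=> n; apply: filterS (expansion n) => w [-> [-> ->]].
  rewrite P1E P2E P3E; exact: rescale.
move=> deg.
(* The degenerate case uses the same convergence lemma with main term [Phi3] and perturbation 0. *)
have cst0_meas : measurable_for (@trace_sigma_algebra R V) (fun _ : V => 0 : R).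
  apply: (@measurable_for_pair R V _ Phi1 Phi2 (fun z => 0)) => //.
have c0 : (0 : R) @[n --> \oo] --> (0 : R) by exact: cvg_cst.
have cst0_cont : continuous (fun _ : V => 0 : R) by exact: cst_continuous.
apply: (cvg_in_distribution_perturbed sM Z_random B_random Z_cvg Phi3_cont
  cst0_cont Phi3_meas cst0_meas c0).
move=> n; have := deg n; apply: filterS2 (expansion n) => w [-> _] degw.
by rewrite degw add0r mul0r addr0 P3E.
Unshelve. all: by end_near. Qed.
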